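(* (a) The front and back tracks of each bicycling geodesic in $\mathbb{R}^n$, $n\geq 3$, are contained in a 3-dimensional affine subspace. (b) Front tracks of bicycling geodesics in $\mathbb{R}^3$ are either straight lines or curves whose curvature $\kappa$ and torsion $\tau$, as functions of arc length, satisfy $$\kappa'' = \kappa\left[ \tau(\tau - b) + \frac{1 + a^2 - \kappa^2}{2}\right],\qquad \kappa^2 (2 \tau-b)=b(a^2-1),$$ and such that $$(\kappa ')^2+\frac{1}{4} \left( 1 + a^2 - \kappa^2 \right)^2+\kappa^2 (\tau-b)^2=a^2+b^2,$$ where $a,b\in\mathbb{R}$ are constants. These curves comprise a 2-parameter subfamily of Kirchhoff rods, with rod parameter values $$a_1=\frac{1+a^2}{2},\quad a_2=b,\quad a_3=b(a^2-1),\quad a_4=\sqrt{a^2+b^2}.$$ (c) Let $(\mathbf{x}(t),\mathbf{y}(t))$ be a unit speed bicycle path in $\mathbb{R}^3$, that is, $|\mathbf{x}'(t)|=1$, $|\mathbf{x}(t)-\mathbf{y}(t)|=1$ and $\mathbf{y}'(t)\parallel(\mathbf{x}(t)-\mathbf{y}(t))$ for all $t$, with initial conditions $\mathbf{x}_0=\mathbf{x}(0)$, $\mathbf{x}'_0=\mathbf{x}'(0)$, $\mathbf{y}_0=\mathbf{y}(0)$, and let $\mathbf{v}_0=\mathbf{x}_0-\mathbf{y}_0$. Then it is a bicycling geodesic if and only if either the front track $\mathbf{x}(t)$ is a unit circle with $\mathbf{y}(t)$ fixed at its center, or there exists $\mathbf{p}\in\mathbb{R}^3$, $\mathbf{p}\neq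 0$, with $\mathbf{v}_0\cdot(\mathbf{x}'_0-\mathbf{p})=0$, such that $\mathbf{x}(t)$ is a solution of $$\mathbf{x}''=\mathbf{x}'\times\mathbf{K},\qquad \mathbf{K}=(\mathbf{x}-\mathbf{x}_1)\times\mathbf{p}+\delta\,\mathbf{p},$$ where $$\mathbf{x}_1=\mathbf{y}_0+\frac{(\mathbf{x}'_0\times\mathbf{v}_0)\times\mathbf{p}}{|\mathbf{p}|^2},\qquad \delta=\frac{(\mathbf{x}'_0\times\mathbf{v}_0)\cdot\mathbf{p}}{|\mathbf{p}|^2}.$$ The parameters $a,b$ of item (b) are given by $$a^2+b^2=|\mathbf{p}|^2,\qquad b=-(\mathbf{x}'_0\times\mathbf{v}_0)\cdot\mathbf{p}.$$
   Context: A bicycle path in $\mathbb{R}^n$, $n\ge 2$, is a pair of (smooth) curves $(\mathbf{x}(t),\mathbf{y}(t))$ in $\mathbb{R}^n$ (the front and back tracks) such that, with $\mathbf{v}(t):=\mathbf{x}(t)-\mathbf{y}(t)$ (the frame direction), $|\mathbf{v}(t)|=1$ and $\mathbf{y}'(t)$ is parallel to $\mathbf{v}(t)$ for all $t$ (the no-skid condition; $\mathbf{y}'(t)=0$ is allowed). Its length is the ordinary length $\int|\mathbf{x}'(t)|\,dt$ of its front track. A placement is a pair of points $(\mathbf{x},\mathbf{y})$ with $|\mathbf{x}-\mathbf{y}|=1$. A bicycling geodesic is a bicycle path whose length between any two of its placements is critical among bicycle paths connecting these two placements (i.e. the length is stationary under variations through bicycle paths with the same end placements). Geodesics are parametrized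 so that the front track has unit speed. Frenet-Serret conventions along a curve in $\mathbb{R}^3$ parametrized by arc length: $\mathbf{x}'=\mathbf{T}$, $\mathbf{T}'=\kappa\mathbf{N}$, $\mathbf{N}'=-\kappa\mathbf{T}+\tau\mathbf{B}$, $\mathbf{B}'=-\tau\mathbf{N}$, $\mathbf{B}=\mathbf{T}\times\mathbf{N}$. For an analytic non-linear curve the frame extends analytically through the isolated inflection points ($\mathbf{x}''=0$), where $\kappa$ may change sign; the frame is then defined up to $(\mathbf{T},\mathbf{N},\mathbf{B},\kappa,\tau)\mapsto(\mathbf{T},-\mathbf{N},-\mathbf{B},-\kappa,\tau)$. A Kirchhoff rod is a curve in $\mathbb{R}^3$ that is either a straight line or whose curvature and torsion as functions of arc length satisfy $$\kappa''=\kappa\left[2a_1+\tau(\tau-a_2)-\frac{\kappa^2}{2}\right],\qquad \kappa^2(2\tau-a_2)=a_3,$$ for some $a_1,a_2,a_3\in\mathbb{R}$; these equations admit the conservation law $(\kappa')^2+\frac14(\kappa^2-2a_1)^2+\kappa^2(\tau-a_2)^2=(a_4)^2$ for some $a_4\in\mathbb{R}$.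
   Formalization: The Kirchhoff rod equation is taken as κ'' = κ[a₁ + τ(τ−a₂) − κ²/2], as its conservation law requires; with the printed 2a₁ in place of a₁ the stated rod parameters fail, e.g. for the unit circle. *)

(* Defs.v *)
From mathcomp Require Import all_boot all_order all_algebra.
From mathcomp Require Import all_classical all_reals all_analysis.

Set Implicit Arguments.
Unset Strict Implicit.
Unset Printing Implicit Defensive.
Import Order.TTheory GRing.Theory Num.Theory.
Import numFieldNormedType.Exports.

Local Open Scope ring_scope.
Local Open Scope classical_set_scope.

(* The library norm on 'rV_n is the sup norm; it induces the right topology,
   hence the right derivatives, but Euclidean lengths need [enorm]. *)
Definition dot (R : realType) (n : nat) (u v : 'rV[R]_n) : R :=
  \sum_(i < n) u 0 i * v 0 i.

Definition enorm (R : realType) (n : nat) (u : 'rV[R]_n) : R :=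
  Num.sqrt (dot u u).

Definition cross (R : realType) (u v : 'rV[R]_3) : 'rV[R]_3 :=
  \row_(i < 3)
    (if i == 0 then u 0 1 * v 0 2 - u 0 2 * v 0 1
     else if i == 1 then u 0 2 * v 0 0 - u 0 0 * v 0 2
     else u 0 0 * v 0 1 - u 0 1 * v 0 0).

(* Meaningful for open [U] and finite-dimensional [E]: only the germs of [f]
   at the points of [U] matter. *)
Fixpoint Ck (R : realType) (E V : normedModType R) (k : nat) (U : set E)
    (f : E -> V) : Prop :=
  match k with
  | 0%N => forall p, U p -> {for p, continuous f}
  | k'.+1 => (forall p, U p -> differentiable f p) /\
             (forall v : E, Ck k' U (fun p => 'D_v f p))
  end.

Definition smooth (R : realType) (E V : normedModType R) (U : set E)
    (f : E -> V) : Prop :=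
  forall k, Ck k U f.

Definition open_interval (R : realType) (I : set R) : Prop :=
  open I /\ is_interval I.

(* Unit frame and no-skid condition; the factor [c] may vanish. *)
Definition no_skid (R : realType) (n : nat) (D : set R)
    (x y : R -> 'rV[R]_n) : Prop :=
  forall t, D t ->
    enorm (x t - y t) = 1 /\ exists c : R, derive1 y t = c *: (x t - y t).

Definition bicycle_path (R : realType) (n : nat) (I : set R)
    (x y : R -> 'rV[R]_n) : Prop :=
  [/\ smooth I x, smooth I y & no_skid I x y].

Definition unit_speed (R : realType) (n : nat) (I : set R)
    (x : R -> 'rV[R]_n) : Prop :=
  forall t, I t -> enorm (derive1 x t) = 1.

Definition length (R : realType) (n : nat) (t0 t1 : R)
    (x : R -> 'rV[R]_n) : R :=
  (\int[lebesgue_measure]_(t in `[t0, t1]) enorm (derive1 x t))%R.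

(* A variation, through bicycle paths on [t0, t1] with fixed end placements,
   of the restriction of (x, y) to [t0, t1]. The first argument of [X], [Y] is
   the variation parameter s. Smoothness on the strip |s| < eps, t0 <= t <= t1
   is expressed on a neighbourhood of it; outside of the strip nothing else is
   required. *)
Definition variation (R : realType) (n : nat) (t0 t1 : R)
    (x y : R -> 'rV[R]_n) (X Y : R -> R -> 'rV[R]_n) : Prop :=
  exists2 eps : R, 0 < eps &
    let U := [set p : R * R | `|p.1| < eps /\ t0 - eps < p.2 < t1 + eps] in
    [/\ smooth U (fun p => X p.1 p.2),
        smooth U (fun p => Y p.1 p.2),
        (forall s, `|s| < eps -> no_skid `[t0, t1] (X s) (Y s)),
        (forall t, t0 <= t <= t1 -> X 0 t = x t /\ Y 0 t = y t) &
        (forall s, `|s| < eps ->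
           [/\ X s t0 = x t0, Y s t0 = y t0, X s t1 = x t1 & Y s t1 = y t1])].

Definition bicycling_geodesic (R : realType) (n : nat) (I : set R)
    (x y : R -> 'rV[R]_n) : Prop :=
  [/\ bicycle_path I x y, unit_speed I x &
      forall t0 t1 : R, I t0 -> I t1 -> t0 < t1 ->
      forall X Y : R -> R -> 'rV[R]_n, variation t0 t1 x y X Y ->
        is_derive (0 : R) 1 (fun s : R => length t0 t1 (X s)) 0].

Definition straight_line (R : realType) (n : nat) (I : set R)
    (x : R -> 'rV[R]_n) : Prop :=
  exists q u : 'rV[R]_n, forall t, I t -> x t = q + t *: u.

(* [k] and [tau] are the curvature and torsion of the unit speed curve [x]
   relative to a frame that is smooth across inflection points, so that [k]
   may change sign. If the inflection points are isolated then the frame is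
   unique up to (T, N, B, k, tau) |-> (T, -N, -B, -k, tau); for an analytic
   curve that is not a line it is thus the analytic one. *)
Definition frenet (R : realType) (I : set R) (x : R -> 'rV[R]_3)
    (k tau : R -> R) : Prop :=
  exists T N B : R -> 'rV[R]_3,
    [/\ [/\ smooth I T, smooth I N & smooth I B],
        smooth I k, smooth I tau &
        forall t, I t ->
          [/\ [/\ enorm (T t) = 1, enorm (N t) = 1 & dot (T t) (N t) = 0],
              B t = cross (T t) (N t),
              derive1 x t = T t,
              derive1 T t = k t *: N t &
              derive1 N t = - k t *: T t + tau t *: B t /\
              derive1 B t = - tau t *: N t]].

(* "The curvature and torsion of [x] satisfy [P]": they exist, and [P] holds
   for every choice of them. *)
Definition curvature_torsion_satisfy (R : realType) (I : set R)
    (x : R -> 'rV[R]_3) (P : (R -> R) -> (R -> R) -> Prop) : Prop :=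
  (exists k tau : R -> R, frenet I x k tau) /\
  (forall k tau : R -> R, frenet I x k tau -> P k tau).

Definition bicycle_equations (R : realType) (I : set R) (a b : R)
    (k tau : R -> R) : Prop :=
  forall t, I t ->
    [/\ derive1n 2 k t =
          k t * (tau t * (tau t - b) + (1 + a ^+ 2 - k t ^+ 2) / 2),
        k t ^+ 2 * (2 * tau t - b) = b * (a ^+ 2 - 1) &
        derive1 k t ^+ 2 + (1 + a ^+ 2 - k t ^+ 2) ^+ 2 / 4
          + k t ^+ 2 * (tau t - b) ^+ 2 = a ^+ 2 + b ^+ 2].

(* Normalized so that the conservation law below follows by multiplying the
   first equation by k' and integrating: the bracket contains
   (2 a1 - k^2) / 2. *)
Definition rod_equations (R : realType) (I : set R) (a1 a2 a3 : R)
    (k tau : R -> R) : Prop :=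
  forall t, I t ->
    derive1n 2 k t = k t * (tau t * (tau t - a2) + (2 * a1 - k t ^+ 2) / 2) /\
    k t ^+ 2 * (2 * tau t - a2) = a3.

Definition rod_conservation (R : realType) (I : set R) (a1 a2 a4 : R)
    (k tau : R -> R) : Prop :=
  forall t, I t ->
    derive1 k t ^+ 2 + (k t ^+ 2 - 2 * a1) ^+ 2 / 4
      + k t ^+ 2 * (tau t - a2) ^+ 2 = a4 ^+ 2.

Definition kirchhoff_rod (R : realType) (I : set R)
    (x : R -> 'rV[R]_3) : Prop :=
  straight_line I x \/
  exists a1 a2 a3 : R, curvature_torsion_satisfy I x (rod_equations I a1 a2 a3).

Definition kirchhoff_rod_with_parameters (R : realType) (I : set R)
    (a1 a2 a3 a4 : R) (x : R -> 'rV[R]_3) : Prop :=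
  curvature_torsion_satisfy I x (fun k tau =>
    rod_equations I a1 a2 a3 k tau /\ rod_conservation I a1 a2 a4 k tau).

Definition unit_circle_about (R : realType) (I : set R)
    (x y : R -> 'rV[R]_3) : Prop :=
  exists c w : 'rV[R]_3, w != 0 /\
    forall t, I t ->
      [/\ y t = c, enorm (x t - c) = 1 & dot (x t - c) w = 0].

(* x'' = x' * K, K = (x - x1) * p + delta p, with x1 and delta determined by
   [p] and the initial conditions at t = 0. *)
Definition front_track_ode (R : realType) (I : set R)
    (x y : R -> 'rV[R]_3) (p : 'rV[R]_3) : Prop :=
  let w0 := cross (derive1 x 0) (x 0 - y 0) in
  let x1 := y 0 + (enorm p ^+ 2)^-1 *: cross w0 p in
  let delta := dot w0 p / enorm p ^+ 2 in
  let K := fun t => cross (x t - x1) p + delta *: p in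
  forall t, I t -> derive1n 2 x t = cross (derive1 x t) (K t).

(* Main.v *)
From HB Require Import structures.
Require Import Defs.
From mathcomp Require Import all_boot all_order all_algebra.
From mathcomp Require Import all_classical all_reals all_analysis.
From mathcomp Require Import ring lra.
Set Implicit Arguments.
Unset Strict Implicit.
Unset Printing Implicit Defensive.
Import Order.TTheory GRing.Theory Num.Theory.
Import numFieldNormedType.Exports.
Local Open Scope ring_scope.
Local Open Scope classical_set_scope.

(** Write v = x - y for the frame direction, T = x' for the velocity of the front
    wheel and c = T . v for the signed speed of the back wheel, so that
    y' = c v, v' = T - c v and c^2 + |v'|^2 = 1 at unit speed. In the formulas
    below u * w is the cross product of two vectors and u . w their dot product.

    Everything follows from [geodesic_momentumP]: in R^n, a unit speed bicycle
    path is a bicycling geodesic if and only if there is a vector p with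
        c = p . v   and   T' = (p . T - 1) v + c (T - p).
    A bicycle path is determined by v, by c and by the initial position of the
    back wheel. So the only constraint on a variation of v and c with fixed end
    values of v is that the integral of c v, the displacement of the back wheel,
    is prescribed; p is the Lagrange multiplier of this vector constraint, and
    the two equations are the Euler-Lagrange equations of the integral of
    sqrt(c^2 + |v'|^2) - p . (c v).

    Sufficiency ([geodesic_of_momentum]) rests on [first_variation], which gives
    the length of a varied path up to an error that is quadratic in the
    parameter. The error is controlled by comparing the varied path with the
    given one, both with their velocities, and these differences are linear in
    the parameter, uniformly in time; no derivative with respect to the
    parameter occurs under an integral. For necessity ([euler_lagrange]) one
    variation is enough, provided that it satisfies the constraint exactly:
    [constrained_variation] corrects the back speed by a combination of the
    components of v, whose coefficients solve a linear system. This system is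
    nondegenerate on the span of v, and all vectors are kept in that span. In
    particular p is unique in the span of v, so it is the same for all long
    enough segments. Paths whose frame direction spans a proper subspace, which
    include the singular ones, thus call for no separate treatment.

    (a) A vector u orthogonal to p and to the initial values of v and T stays
    orthogonal to v, as (u . v, u . T) solves a linear system
    ([orth_preserved]). So v stays in the span of three vectors.

    (c) In R^3 the vector K = v * p + T * v satisfies T' = T * K and K' = T * p.
    So K - x * p is constant, which is the differential equation of the front
    track; for p = 0 the path is a unit circle about a fixed back wheel.
    Conversely, the equation determines K and v by uniqueness for linear
    differential equations ([momentum_of_ode]).

    (b) The function T . K is constant, equal to - b. In a Frenet frame this
    reads K = - b T - k B, and K' = T * p gives
        p = (1 + a^2 - k^2) / 2 T - k' N - k (tau - b) B,
    with a^2 + b^2 = |p|^2. The three curvature equations say that p . N has the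
    right derivative, that p . K = - b and that the norm of p is constant
    ([bicycle_equations_of_momentum]); no division by k takes place, so the
    equations hold at inflection points too. A smooth frame exists
    ([bicycle_frenet]): at an inflection point of a curve that is not straight
    one has b <> 0, and the torsion is the constant b / 2, so that the frame is
    obtained by rotating the normal component of p through the integral of a
    known angular velocity. Conversely, for a rod with these parameters the
    formula for p defines a constant vector, and the frame direction is
    recovered from v * (p - T) = K ([bicycle_of_rod]). *)

(** * Calculus on the real line *)

Section derivative_rules.
Variables (R : realType).

Section field.
Variables (V : normedModType R) (x v : V).
Implicit Types f g : V -> R.

Lemma is_derive_mul f g a b : is_derive x v f a -> is_derive x v g b ->
  is_derive x v (fun t => f t * g t) (a * g x + f x * b).
Proof.
move=> df dg; apply: (is_derive_eq (is_deriveM df dg)).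
by rewrite addrC /GRing.scale /= (mulrC (g x)).
Qed.

Lemma is_derive_inv f a : f x != 0 -> is_derive x v f a ->
  is_derive x v (fun t => (f t)^-1) (- a * (f x)^-1 ^+ 2).
Proof.
move=> fx0 [df <-]; split; first exact: derivableV.
by rewrite deriveV// /GRing.scale /= exprVn mulNr mulrC mulNr.
Qed.

Variable W : normedModType R.
Implicit Types F G : V -> W.

Lemma is_derive_add F G a b : is_derive x v F a -> is_derive x v G b ->
  is_derive x v (fun t => F t + G t) (a + b).
Proof. by move=> df dg; exact: (is_deriveD df dg). Qed.

Lemma is_derive_sub F G a b : is_derive x v F a -> is_derive x v G b ->
  is_derive x v (fun t => F t - G t) (a - b).
Proof. by move=> df dg; exact: (is_deriveB df dg). Qed.

Lemma is_derive_opp F a : is_derive x v F a -> is_derive x v (fun t => - F t) (- a).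
Proof. by move=> df; exact: (is_deriveN df). Qed.

Lemma is_derive_const (w : W) : is_derive x v (fun=> w) 0.
Proof. exact: is_derive_cst. Qed.

Lemma is_derive_bigsum n (F : 'I_n -> V -> W) a : (forall i, is_derive x v (F i) (a i)) ->
  is_derive x v (fun t => \sum_i F i t) (\sum_i a i).
Proof.
move=> h; rewrite (_ : (fun t => _) = \sum_i F i); first exact: is_derive_sum.
by apply/funext => t; rewrite fct_sumE.
Qed.

Lemma is_derive_near F G a : (\near x, F x = G x) -> is_derive x v F a ->
  is_derive x v G a.
Proof.
move=> FG [dF <-].
have e : (\forall h \near (0 : R)^', h^-1 *: ((F \o shift x) (h *: v) - F x) =
    h^-1 *: ((G \o shift x) (h *: v) - G x)).
  have c : ((fun h : R => h *: v + x) @ (0 : R)^' --> x).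
    rewrite -[X in _ --> X]add0r -[X in _ --> X + _](scale0r v).
    apply: cvgD; last exact: cvg_cst.
    by apply: cvgZr_tmp; exact: (@nbhs_dnbhs R 0).
  have := c _ FG; apply: (@filterS _ (0^')%classic) => h /= <-.
  by rewrite (nbhs_singleton FG).
have h : (fun h => h^-1 *: ((G \o shift x) (h *: v) - G x)) @ (0 : R)^' -->
    'D_v F x by apply: cvg_trans dF; exact: near_eq_cvg.
by split; [apply/cvg_ex; exists ('D_v F x) | exact: cvg_lim].
Qed.

End field.

Section real_line.
Implicit Types (f : R -> R) (x : R).

Lemma is_derive_expR_comp f x a : is_derive x 1 f a ->
  is_derive x 1 (fun t => expR (f t)) (expR (f x) * a).
Proof. by move=> df; apply: is_derive1_comp. Qed.

Lemma is_derive_chain f (g : R -> R) x a b : is_derive x 1 f a -> is_derive (f x) 1 g b ->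
  is_derive x 1 (fun t => g (f t)) (b * a).
Proof. by move=> df dg; apply: is_derive1_comp. Qed.

Lemma is_derive_continuous f x a : is_derive x 1 f a -> {for x, continuous f}.
Proof. by move=> [df _]; apply/differentiable_continuous/derivable1_diffP. Qed.

Lemma within_continuous_segment f df (a b : R) :
  (forall t, a <= t <= b -> is_derive t 1 f (df t)) ->
  {within `[a, b], continuous f}.
Proof.
move=> h; apply: derivable_within_continuous => t; rewrite in_itv /= => /h.
by case.
Qed.

Lemma increment_le f df (a b M : R) : a <= b ->
  (forall t, a <= t <= b -> is_derive t 1 f (df t)) ->
  (forall t, a < t < b -> df t <= M) -> f b - f a <= M * (b - a).
Proof.
rewrite le_eqVlt => /predU1P[<- _ _|ab h hM]; first by rewrite !subrr mulr0.
have [||c] := @MVT _ f df a b ab.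
- by move=> t; rewrite in_itv /= => /andP[? ?]; apply: h; rewrite !ltW.
- exact: within_continuous_segment h.
rewrite in_itv /= => cab ->; rewrite ler_wpM2r ?hM// subr_ge0; exact: ltW.
Qed.

Lemma increment_norm_le f df (a b M : R) : a <= b ->
  (forall t, a <= t <= b -> is_derive t 1 f (df t)) ->
  (forall t, a < t < b -> `|df t| <= M) -> `|f b - f a| <= M * (b - a).
Proof.
move=> ab h hM; rewrite ler_norml; apply/andP; split.
  rewrite lerNl opprB -[leLHS](_ : (- f b) - (- f a) = _); last by ring.
  apply: (@increment_le (fun t => - f t) (fun t => - df t)) => // t tab.
    by apply: is_derive_opp; exact: h.
  by have := hM t tab; rewrite ler_norml => /andP[]; lra.
apply: (increment_le ab h) => t tab.
by have := hM t tab; rewrite ler_norml => /andP[].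
Qed.

Lemma constant_on_segment f (a b : R) : a <= b ->
  (forall t, a <= t <= b -> is_derive t 1 f 0) -> f b = f a.
Proof.
move=> ab h; apply/eqP; rewrite -subr_eq0 -normr_le0.
by rewrite (le_trans (increment_norm_le (M := 0) ab h _)) ?mul0r// => t _; rewrite normr0.
Qed.

Lemma constant_on_interval (I : set R) f : is_interval I ->
  (forall t, I t -> is_derive t 1 f 0) -> forall s t, I s -> I t -> f s = f t.
Proof.
move=> itv h s t Is It; wlog st : s t Is It / s <= t.
  by move=> w; have [/w|/ltW/w] := leP s t; [apply|move=> ->].
apply/esym/constant_on_segment => // u /andP[su ut]; apply: h.
by apply: (itv s t) => //; rewrite su.
Qed.

(** Multiplication by exp(-M t), respectively by exp(M t), makes f nonincreasing
    after [t0], respectively nondecreasing before [t0]. *)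
Lemma gronwall_zero (I : set R) f df (M t0 : R) : is_interval I -> I t0 ->
  (forall t, I t -> is_derive t 1 f (df t)) ->
  (forall t, I t -> 0 <= f t) -> (forall t, I t -> `|df t| <= M * f t) ->
  f t0 = 0 -> forall t, I t -> f t = 0.
Proof.
move=> itv I0 hd h0 hM f0 t It; apply/eqP; rewrite eq_le h0 // andbT.
have dE (c u : R) : I u ->
    is_derive u 1 (fun t => f t * expR (c * t)) ((df u + c * f u) * expR (c * u)).
  move=> Iu; have := is_derive_mul (hd u Iu) (is_derive_expR_comp (is_derive_mul (is_derive_const u 1 c) (is_derive_id u 1))).
  by move/is_derive_eq; apply; ring.
have sub a b u : I a -> I b -> a <= u <= b -> I u by move=> ? ? ?; apply: (itv a b).
have [t0t|/ltW tt0] := leP t0 t.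
  have := @increment_le (fun t => f t * expR (- M * t)) _ t0 t 0 t0t
    (fun u hu => dE (- M) u (sub _ _ _ I0 It hu)).
  rewrite f0 mul0r subr0 mul0r pmulr_lle0 ?expR_gt0 //; apply=> u /andP[u1 u2].
  have Iu : I u by apply: (sub t0 t) => //; rewrite !ltW.
  rewrite pmulr_lle0 ?expR_gt0 //.
  by have := hM u Iu; rewrite ler_norml => /andP[]; lra.
have dE' c u : I u -> is_derive u 1 (fun t => - (f t * expR (c * t)))
    (- ((df u + c * f u) * expR (c * u))).
  by move=> Iu; apply: is_derive_opp; exact: dE.
have := @increment_le (fun t => - (f t * expR (M * t))) _ t t0 0 tt0
  (fun u hu => dE' M u (sub _ _ _ It I0 hu)).
rewrite f0 mul0r oppr0 sub0r opprK mul0r pmulr_lle0 ?expR_gt0 //; apply=> u /andP[u1 u2].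
have Iu : I u by apply: (sub t t0) => //; rewrite !ltW.
rewrite oppr_le0 mulr_ge0 ?expR_ge0 //.
by have := hM u Iu; rewrite ler_norml => /andP[]; lra.
Qed.

End real_line.

Section primitive.
Implicit Types (f F : R -> R).
Notation mu := (@lebesgue_measure R).

Lemma segment_integrable f (a b : R) :
  (forall t, a <= t <= b -> {for t, continuous f}) ->
  mu.-integrable `[a, b] (EFin \o f).
Proof.
move=> h; apply: continuous_compact_integrable; first exact: segment_compact.
by apply: continuous_in_subspaceT => t; rewrite inE /= in_itv /=; exact: h.
Qed.

Lemma integral_eq_increment f F (a b : R) : a < b ->
  (forall t, a <= t <= b -> {for t, continuous f}) ->
  (forall t, a <= t <= b -> is_derive t 1 F (f t)) ->
  (\int[mu]_(t in `[a, b]) f t)%R = F b - F a.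
Proof.
move=> ab cf dF; rewrite /Rintegral (@continuous_FTC2 _ f F a b) //.
- by apply: continuous_in_subspaceT => t; rewrite inE /= in_itv /=; exact: cf.
- split.
  + move=> t; rewrite in_itv /= => /andP[? ?].
    by have [] : is_derive t 1 F (f t) by apply: dF; rewrite !ltW.
  + apply: cvg_at_right_filter; apply: (is_derive_continuous (a := f a)).
    by apply: dF; rewrite lexx ltW.
  + apply: cvg_at_left_filter; apply: (is_derive_continuous (a := f b)).
    by apply: dF; rewrite lexx ltW.
- move=> t; rewrite in_itv /= => /andP[? ?]; rewrite derive1E.
  by have [_ ->] : is_derive t 1 F (f t) by apply: dF; rewrite !ltW.
Qed.

Lemma open_interval_nbhs (I : set R) t : open_interval I -> I t ->
  exists a b, [/\ a < t, t < b, I a, I b & forall u, a <= u <= b -> I u].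
Proof.
move=> [oI itv] It; have := open_nbhs_nbhs (conj oI It).
move=> /nbhs_ballP[e /= e0 he].
have Ia : I (t - e / 2).
  apply: he; rewrite /ball /= opprB addrC subrK ger0_norm ?divr_ge0 ?ltW //.
  by rewrite ltr_pdivrMr // ltr_pMr // ltr1n.
have Ib : I (t + e / 2).
  apply: he; rewrite /ball /= opprD addrA subrr sub0r normrN ger0_norm ?divr_ge0 ?ltW //.
  by rewrite ltr_pdivrMr // ltr_pMr // ltr1n.
have e20 : 0 < e / 2 by rewrite divr_gt0.
exists (t - e / 2), (t + e / 2); split => //; [lra|lra|].
by move=> u hu; exact: (itv _ _ Ia Ib).
Qed.

Lemma open_interval_nbhs_pair (I : set R) t0 t1 : open_interval I -> I t0 -> I t1 ->
  exists a b, [/\ a < Num.min t0 t1, Num.max t0 t1 < b, I a, I b & forall u, a <= u <= b -> I u].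
Proof.
move=> oI I0 I1.
have [a0 [b0 [h1 h2 h3 h4 _]]] := open_interval_nbhs oI I0.
have [a1 [b1 [k1 k2 k3 k4 _]]] := open_interval_nbhs oI I1.
have Ia : I (Num.min a0 a1) by case: leP.
have Ib : I (Num.max b0 b1) by case: leP.
exists (Num.min a0 a1), (Num.max b0 b1); split => //.
- by rewrite lt_min !gt_min h1 k1 orbT.
- by rewrite gt_max !lt_max h2 k2 orbT.
- by move=> u hu; apply: (oI.2 _ _ Ia Ib).
Qed.

(** The primitive is the integral from a base point [t0], with a sign on its
    left. Near any point it differs by a constant from an integral with a
    fixed left end point in I, which lies below both this point and [t0]. *)
Lemma primitive (I : set R) f : open_interval I ->
  (forall t, I t -> {for t, continuous f}) ->
  exists F, forall t, I t -> is_derive t 1 F (f t).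
Proof.
move=> oI cf; have [[t0 I0]|nI] := pselect (exists t0, I t0); last first.
  by exists (fun=> 0) => t It; case: nI; exists t.
pose G a t := (\int[mu]_(u in `[a, t]) f u)%R.
exists (fun t => G t0 t - G t t0) => t1 I1.
have [a [b [al be Ia Ib sub]]] := open_interval_nbhs_pair oI I0 I1.
move: al be; rewrite lt_min gt_max => /andP[a0 a1] /andP[b0 b1].
have intab : mu.-integrable `[a, b] (EFin \o f).
  by apply: segment_integrable => t /sub/cf.
have addG u v : a <= u -> u <= v -> v <= b -> G a v - G a u = G u v.
  move=> au uv vb; rewrite /G Rintegral_itvB ?bnd_simp //; last first.
    by apply: integrableS intab => //; apply: subset_itvl; rewrite bnd_simp.
  rewrite Rintegral_itv_obnd_cbnd //; apply: integrableS intab => //.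
  by apply: subset_itv; rewrite bnd_simp.
have Gself u : G u u = 0 by rewrite /G set_itv1 Rintegral_set1.
have Gempty u v : v < u -> G u v = 0.
  by move=> vu; rewrite /G set_itv_ge ?Rintegral_set0 // bnd_simp -ltNge.
apply: (@is_derive_near _ _ _ _ (fun t => G a t - G a t0)).
  near=> t.
  have at_ : a < t by near: t; exact: lt_nbhsr.
  have tb : t < b by near: t; exact: lt_nbhsl.
  have [tt0|t0t|->] := ltgtP t t0.
  - by rewrite (Gempty t0 t) // sub0r -(addG t t0) ?ltW // opprB.
  - by rewrite (Gempty t t0) // subr0 -(addG t0 t) // ltW.
  - by rewrite !subrr.
rewrite -[f t1]subr0; apply: (is_derive_sub _ (is_derive_const _ _ _)).
have [|d e] := @continuous_FTC1_closed _ f a t1 b b1 intab a1; first exact: cf.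
split; first exact: d.
by rewrite -derive1E; exact: e.
Unshelve. all: by end_near.
Qed.

End primitive.
End derivative_rules.

(** * Euclidean vectors *)

Section euclid.
Variables (R : realType) (n : nat).
Implicit Types (u v w : 'rV[R]_n) (a : R).

Lemma dotC u v : dot u v = dot v u.
Proof. by apply: eq_bigr => i _; rewrite mulrC. Qed.

Lemma dotDl u v w : dot (u + v) w = dot u w + dot v w.
Proof. by rewrite /dot -big_split /=; apply: eq_bigr => i _; rewrite mxE mulrDl. Qed.

Lemma dotZl a u v : dot (a *: u) v = a * dot u v.
Proof. by rewrite /dot mulr_sumr; apply: eq_bigr => i _; rewrite mxE mulrA. Qed.

Lemma dotDr u v w : dot w (u + v) = dot w u + dot w v.
Proof. by rewrite dotC dotDl !(dotC w). Qed.

Lemma dotZr a u v : dot v (a *: u) = a * dot v u.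
Proof. by rewrite dotC dotZl dotC. Qed.

Lemma dotNl u v : dot (- u) v = - dot u v.
Proof. by rewrite -scaleN1r dotZl mulN1r. Qed.

Lemma dotNr u v : dot v (- u) = - dot v u.
Proof. by rewrite dotC dotNl dotC. Qed.

Lemma dotBl u v w : dot (u - v) w = dot u w - dot v w.
Proof. by rewrite dotDl dotNl. Qed.

Lemma dotBr u v w : dot w (u - v) = dot w u - dot w v.
Proof. by rewrite dotDr dotNr. Qed.

Lemma dot0l u : dot 0 u = 0.
Proof. by rewrite -(scale0r 0) dotZl mul0r. Qed.

Lemma dot0r u : dot u 0 = 0.
Proof. by rewrite dotC dot0l. Qed.

Definition dotE := (dotDl, dotDr, dotBl, dotBr, dotZl, dotZr, dotNl, dotNr, dot0l, dot0r).

Lemma dot_ge0 u : 0 <= dot u u.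
Proof. by apply: sumr_ge0 => i _; rewrite -expr2 sqr_ge0. Qed.

Lemma dot_eq0 u : (dot u u == 0) = (u == 0).
Proof.
apply/eqP/eqP => [/eqP|->]; last by rewrite dot0l.
rewrite psumr_eq0 => [/allP h|i _]; last by rewrite -expr2 sqr_ge0.
apply/rowP => i; have := h i; rewrite mem_index_enum => /(_ isT) /=.
by rewrite -expr2 sqrf_eq0 mxE => /eqP.
Qed.

Lemma dot_gt0 u : (0 < dot u u) = (u != 0).
Proof. by rewrite lt_def dot_eq0 dot_ge0 andbT. Qed.

Lemma dot_mulmx u v : u *m v^T = (dot u v)%:M.
Proof.
apply/matrixP => i j; rewrite !ord1 !mxE /= mulr1n.
by apply: eq_bigr => k _; rewrite mxE.
Qed.

Lemma enorm_ge0 u : 0 <= enorm u.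
Proof. exact: sqrtr_ge0. Qed.

Lemma enorm_sqr u : enorm u ^+ 2 = dot u u.
Proof. by rewrite sqr_sqrtr // dot_ge0. Qed.

Lemma enorm_unit u : enorm u = 1 <-> dot u u = 1.
Proof.
by rewrite -enorm_sqr; split=> [->|h]; rewrite ?expr1n //; have := enorm_ge0 u; nra.
Qed.

Lemma cauchy_schwarz_sqr u v : dot u v ^+ 2 <= dot u u * dot v v.
Proof.
have [->|v0] := eqVneq v 0; first by rewrite !dot0r expr0n mulr0.
have vv : 0 < dot v v by rewrite dot_gt0.
have := dot_ge0 (dot v v *: u - dot u v *: v); rewrite !dotE (dotC v u) => h.
suff : 0 <= dot v v * (dot u u * dot v v - dot u v ^+ 2) by rewrite pmulr_rge0 // subr_ge0.
by apply: le_trans h _; rewrite le_eqVlt; apply/orP; left; apply/eqP; ring.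
Qed.

Lemma cauchy_schwarz u v : `|dot u v| <= enorm u * enorm v.
Proof.
rewrite -ler_sqr ?nnegrE ?mulr_ge0 ?enorm_ge0 // real_normK ?num_real // exprMn !enorm_sqr.
exact: cauchy_schwarz_sqr.
Qed.

Lemma dot_le u v : dot u v <= enorm u * enorm v.
Proof. exact: le_trans (ler_norm _) (cauchy_schwarz u v). Qed.

Lemma enormD u v : enorm (u + v) <= enorm u + enorm v.
Proof.
rewrite -ler_sqr ?nnegrE ?addr_ge0 ?enorm_ge0 // sqrrD !enorm_sqr !dotE (dotC v u).
by have := dot_le u v; lra.
Qed.

Lemma enormZ a u : enorm (a *: u) = `|a| * enorm u.
Proof. by rewrite /enorm !dotE mulrA -expr2 sqrtrM ?sqr_ge0 // sqrtr_sqr. Qed.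

Lemma enormN u : enorm (- u) = enorm u.
Proof. by rewrite -scaleN1r enormZ normrN1 mul1r. Qed.

Lemma enormB u v : enorm (u - v) <= enorm u + enorm v.
Proof. by rewrite (le_trans (enormD _ _)) // enormN. Qed.

Lemma enorm_le_sum u : enorm u <= \sum_i `|u 0 i|.
Proof.
have sq0 : 0 <= \sum_i `|u 0 i| by apply: sumr_ge0.
rewrite -ler_sqr ?nnegrE ?enorm_ge0 // enorm_sqr expr2 mulr_suml; apply: ler_sum => i _.
rewrite -expr2 -real_normK ?num_real // expr2 ler_wpM2l // (bigD1 i) //= lerDl.
by apply: sumr_ge0.
Qed.

End euclid.

Section vector_derivative.
Variables (R : realType) (V : normedModType R) (x v : V).

Lemma is_derive_coordP n (f : V -> 'rV[R]_n) df : is_derive x v f df <->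
  forall i, is_derive x v (fun t => f t 0 i) (df 0 i).
Proof.
split=> [[hf <-] i|h].
  have hi := (derivable_mxP f x v).1 hf 0 i.
  by split=> //; rewrite derive_mx // mxE.
have hf : derivable f x v.
  by apply/derivable_mxP => j i; rewrite ord1; have [] := h i.
split=> //; rewrite derive_mx //; apply/matrixP => j i; rewrite ord1 mxE.
by have [_ ->] := h i.
Qed.

Lemma is_derive_coord n (f : V -> 'rV[R]_n) df i : is_derive x v f df ->
  is_derive x v (fun t => f t 0 i) (df 0 i).
Proof. by move=> /is_derive_coordP. Qed.

Lemma is_derive_scale n (f : V -> R) (g : V -> 'rV[R]_n) a b :
  is_derive x v f a -> is_derive x v g b ->
  is_derive x v (fun t => f t *: g t) (a *: g x + f x *: b).
Proof.
move=> df dg; apply/is_derive_coordP => i; rewrite !mxE.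
rewrite (_ : (fun t => _) = (fun t => f t * g t 0 i)); last by apply/funext => t; rewrite mxE.
by have := is_derive_mul df (is_derive_coord i dg).
Qed.

Lemma is_derive_dot n (f g : V -> 'rV[R]_n) a b :
  is_derive x v f a -> is_derive x v g b ->
  is_derive x v (fun t => dot (f t) (g t)) (dot a (g x) + dot (f x) b).
Proof.
move=> df dg; rewrite /dot -big_split /=; apply: is_derive_bigsum => i.
exact: is_derive_mul (is_derive_coord i df) (is_derive_coord i dg).
Qed.

Lemma is_derive_cross (f g : V -> 'rV[R]_3) a b :
  is_derive x v f a -> is_derive x v g b ->
  is_derive x v (fun t => cross (f t) (g t)) (cross a (g x) + cross (f x) b).
Proof.
move=> df dg; apply/is_derive_coordP => i; rewrite !mxE.
rewrite (_ : (fun t => _) = (fun t =>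
  (if i == 0 then f t 0 1 * g t 0 2 - f t 0 2 * g t 0 1
     else if i == 1 then f t 0 2 * g t 0 0 - f t 0 0 * g t 0 2
     else f t 0 0 * g t 0 1 - f t 0 1 * g t 0 0))); last by apply/funext => t; rewrite mxE.
have dM i j := is_derive_mul (is_derive_coord i df) (is_derive_coord j dg).
by case: ifP => _; [|case: ifP => _];
  apply: (is_derive_eq (is_derive_sub (dM _ _) (dM _ _))); ring.
Qed.

End vector_derivative.

(** * Smooth functions *)

Section smooth_functions.
Variables (R : realType) (E : normedModType R).
Implicit Types (U : set E) (k : nat).

(** The difference of two functions with the same germ has differential 0. *)
Lemma differentiable_near (W : normedModType R) (f g : E -> W) p :
  (\near p, f p = g p) -> differentiable f p -> differentiable g p.
Proof.
move=> fg df; pose d := g - f.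
have e : d \o shift p = cst (d p) + \0 +o_ 0 id.
  apply/eqaddoP => _ /posnumP[r].
  have : \near p, d p = 0 by apply: filterS fg => q qe; rewrite /d !fctE qe subrr.
  move=> d0; have dp := nbhs_singleton d0.
  have c : (fun h : E => h + p) @ 0 --> p.
    by rewrite -[X in _ --> X]add0r; apply: cvgD; [exact: cvg_id | exact: cvg_cst].
  have := c _ d0; apply: (@filterS _ (nbhs (0 : E))) => h /= hh.
  by rewrite !fctE /= hh dp /cst addr0 subrr normr0 mulr_ge0.
have c0 : continuous (\0 : E -> W) by move=> ?; exact: cvg_cst.
have dd : 'd d p = \0 :> (E -> W) by exact: diff_unique.
have hd : differentiable d p by apply/diff_locallyP; rewrite dd; split.
rewrite (_ : g = f + d); first exact: differentiableD.
by apply/funext => q; rewrite /d !fctE addrC subrK.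
Qed.

Lemma Ck_ext (W : normedModType R) k U (f g : E -> W) : open U ->
  (forall p, U p -> f p = g p) -> Ck k U f -> Ck k U g.
Proof.
move=> oU; elim: k f g => [|k IH] f g fg.
  move=> cf p Up; have := cf p Up; rewrite /prop_for /continuous_at -fg //.
  apply: cvg_trans; apply: near_eq_cvg.
  by apply: filterS (open_nbhs_nbhs (conj oU Up)) => q; exact: fg.
have near_fg p : U p -> \near p, f p = g p.
  by move=> Up; apply: filterS (open_nbhs_nbhs (conj oU Up)) => q; exact: fg.
case=> df Df; split=> [p Up|v].
  exact: differentiable_near (near_fg p Up) (df p Up).
apply: IH (Df v) => p Up.
have dfv : is_derive p v f ('D_v f p) by apply: derivableP; apply: diff_derivable; exact: df.
by have [_ ->] := is_derive_near (near_fg p Up) dfv.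
Qed.

Lemma CkW (W : normedModType R) k U (f : E -> W) : Ck k.+1 U f -> Ck k U f.
Proof.
elim: k f => [|k IH] f [df Df]; first by move=> p Up; apply: differentiable_continuous; exact: df.
by split=> // v; exact: IH.
Qed.

Lemma Ck_cst (W : normedModType R) k U (a : W) : Ck k U (fun=> a : W).
Proof.
elim: k a => [|k IH] a; first by move=> p _; exact: cvg_cst.
split=> [p _|v]; first exact: differentiable_cst.
have -> : 'D_v (fun=> a : W) = (fun=> 0) :> (E -> W) by apply/funext => p; exact: derive_cst.
exact: IH.
Qed.

Lemma Ck_linear (W : normedModType R) k U (f : {linear E -> W}) : continuous f -> Ck k U f.
Proof.
move=> cf; case: k => [|k]; first by move=> p _; exact: cf.
split=> [p _|v]; first exact: linear_differentiable.
have -> : 'D_v f = (fun=> f v) :> (E -> W).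
  by apply/funext => p; rewrite deriveE ?diff_lin //; exact: linear_differentiable.
exact: Ck_cst.
Qed.

Lemma Ck_is_derive (W : normedModType R) k U (f : E -> W) p v : Ck k.+1 U f -> U p ->
  is_derive p v f ('D_v f p).
Proof. by case=> df _ /df h; apply: derivableP; exact: diff_derivable. Qed.

(** The product and chain rules give directional derivatives at the points of
    [U] only. As [U] is open this is enough, and the closure properties below
    follow by induction on k. *)
Lemma CkS (W : normedModType R) k U (f : E -> W) (df : E -> E -> W) : open U ->
  (forall p, U p -> differentiable f p) ->
  (forall v p, U p -> is_derive p v f (df v p)) -> (forall v, Ck k U (df v)) ->
  Ck k.+1 U f.
Proof.
move=> oU h1 h2 h3; split=> // v; apply: Ck_ext (h3 v) => // p Up.
by have [_ ->] := h2 v p Up.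
Qed.

Lemma CkD (W : normedModType R) k U (f g : E -> W) : open U ->
  Ck k U f -> Ck k U g -> Ck k U (fun p => f p + g p).
Proof.
move=> oU; elim: k f g => [|k IH] f g hf hg.
  by move=> p Up; apply: cvgD; [exact: hf|exact: hg].
apply: (@CkS _ _ _ _ (fun v p => 'D_v f p + 'D_v g p)) => //.
- by move=> p Up; apply: differentiableD; [exact: hf.1|exact: hg.1].
- by move=> v p Up; apply: is_derive_add; apply: (@Ck_is_derive _ k U).
- by move=> v; apply: IH; [exact: hf.2|exact: hg.2].
Qed.

Lemma CkM k U (f g : E -> R) : open U ->
  Ck k U f -> Ck k U g -> Ck k U (fun p => f p * g p).
Proof.
move=> oU; elim: k f g => [|k IH] f g hf hg.
  by move=> p Up; apply: cvgM; [exact: hf|exact: hg].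
apply: (@CkS _ _ _ _ (fun v p => 'D_v f p * g p + f p * 'D_v g p)) => //.
- by move=> p Up; apply: differentiableM; [exact: hf.1|exact: hg.1].
- by move=> v p Up; apply: is_derive_mul; apply: (@Ck_is_derive _ k U).
- move=> v; apply: CkD => //; apply: IH; [exact: hf.2 | exact: CkW | exact: CkW | exact: hg.2].
Qed.

Lemma CkV k U (f : E -> R) : open U -> (forall p, U p -> f p != 0) ->
  Ck k U f -> Ck k U (fun p => (f p)^-1).
Proof.
move=> oU f0; elim: k => [|k IH] hf.
  by move=> p Up; apply: cvgV; [exact: f0|exact: hf].
apply: (@CkS _ _ _ _ (fun v p => ((-1) * 'D_v f p) * ((f p)^-1 * (f p)^-1))) => //.
- by move=> p Up; apply: differentiableV; [exact: hf.1|exact: f0].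
- move=> v p Up.
  by have /is_derive_eq := is_derive_inv (f0 p Up) (Ck_is_derive v hf Up); apply; rewrite expr2 mulN1r.
- move=> v; have hv : Ck k U (fun p => (f p)^-1) by apply: IH; exact: CkW.
  by do 2?[apply: CkM => //]; [exact: Ck_cst|exact: hf.2].
Qed.

Lemma Ck_comp k U (J : set R) (f : E -> R) (g : R -> R) : open U ->
  (forall p, U p -> J (f p)) -> Ck k U f -> Ck k J g -> Ck k U (fun p => g (f p)).
Proof.
move=> oU fJ; elim: k g => [|k IH] g hf hg.
  by move=> p Up; apply: (@continuous_comp _ _ _ f g); [exact: hf|exact: hg (fJ p Up)].
have dg p : U p -> differentiable g (f p) by move=> /fJ; exact: hg.1.
apply: (@CkS _ _ _ _ (fun v p => 'D_v f p * 'D_1 g (f p))) => //.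
- by move=> p Up; apply: differentiable_comp (hf.1 p Up) (dg p Up).
- move=> v p Up; have d0 := hf.1 p Up; have d1 := dg p Up.
  split; first by apply: diff_derivable; exact: differentiable_comp.
  have e1 : 'D_v f p = 'd f p v by exact: deriveE.
  have e2 : 'D_v (g \o f) p = 'd (g \o f) p v by exact: (deriveE _ (differentiable_comp d0 d1)).
  by rewrite -[LHS]/('D_v (g \o f) p) e1 e2 (diff_comp d0 d1) /= (diff1E d1) derive1E.
- move=> v; apply: CkM => //; first exact: hf.2.
  by apply: (IH ('D_1 g)); [exact: CkW|exact: hg.2].
Qed.

Lemma CkZr (W : normedModType R) k U (f : E -> R) (w : W) : open U ->
  Ck k U f -> Ck k U (fun p => f p *: w).
Proof.
move=> oU; elim: k f => [|k IH] f hf.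
  by move=> p Up; apply: cvgZr_tmp; exact: hf.
apply: (@CkS _ _ _ _ (fun v p => 'D_v f p *: w)) => //.
- by move=> p Up; apply: differentiableZl; exact: hf.1.
- move=> v p Up; have d0 := hf.1 p Up.
  split; first by apply: diff_derivable; exact: differentiableZl.
  have e1 : 'D_v f p = 'd f p v by exact: deriveE.
  by rewrite e1 (deriveE _ (differentiableZl w d0)) (diffZl w d0).
- by move=> v; apply: IH; exact: hf.2.
Qed.

Lemma Ck_sum (W : normedModType R) k U (I : Type) (r : seq I) (P : pred I)
    (f : I -> E -> W) : open U ->
  (forall i, Ck k U (f i)) -> Ck k U (fun p => \sum_(i <- r | P i) f i p).
Proof.
move=> oU hf; elim: r => [|i r IH].
  by rewrite (_ : (fun p => _) = fun=> 0); [exact: Ck_cst|apply/funext => p; rewrite big_nil].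
case Pi : (P i); last first.
  by rewrite (_ : (fun p => _) = fun p => \sum_(i <- r | P i) f i p) //;
    apply/funext => p; rewrite big_cons Pi.
rewrite (_ : (fun p => _) = fun p => f i p + \sum_(i <- r | P i) f i p); first exact: CkD.
by apply/funext => p; rewrite big_cons Pi.
Qed.

Lemma Ck_prod k U (I : Type) (r : seq I) (P : pred I) (f : I -> E -> R) : open U ->
  (forall i, Ck k U (f i)) -> Ck k U (fun p => \prod_(i <- r | P i) f i p).
Proof.
move=> oU hf; elim: r => [|i r IH].
  by rewrite (_ : (fun p => _) = fun=> 1); [exact: Ck_cst|apply/funext => p; rewrite big_nil].
case Pi : (P i); last first.
  by rewrite (_ : (fun p => _) = fun p => \prod_(i <- r | P i) f i p) //;
    apply/funext => p; rewrite big_cons Pi.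
rewrite (_ : (fun p => _) = fun p => f i p * \prod_(i <- r | P i) f i p); first exact: CkM.
by apply/funext => p; rewrite big_cons Pi.
Qed.

Lemma Ck_coord k U n (f : E -> 'rV[R]_n) i : open U ->
  Ck k U f -> Ck k U (fun p => f p 0 i).
Proof.
move=> oU; elim: k f => [|k IH] f hf.
  move=> p Up; apply: (@continuous_comp _ _ _ f (fun M : 'rV[R]_n => M 0 i)); first exact: hf.
  exact: coord_continuous.
apply: (@CkS _ _ _ _ (fun v p => 'D_v f p 0 i)) => //.
- move=> p Up; apply: (@differentiable_comp _ _ _ _ f (fun M : 'rV[R]_n => M 0 i)).
    exact: hf.1.
  exact: differentiable_coord.
- by move=> v p Up; apply: is_derive_coord; apply: (@Ck_is_derive _ k U).
- by move=> v; apply: IH; exact: hf.2.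
Qed.

Lemma Ck_row k U n (f : E -> 'rV[R]_n) : open U ->
  (forall i, Ck k U (fun p => f p 0 i)) -> Ck k U f.
Proof.
move=> oU hf; rewrite (_ : f = fun p => \sum_i f p 0 i *: delta_mx 0 i).
  by apply: Ck_sum => // i; exact: CkZr.
by apply/funext => p; exact: row_sum_delta.
Qed.

Lemma smooth_ext (W : normedModType R) U (f g : E -> W) : open U ->
  (forall p, U p -> f p = g p) -> smooth U f -> smooth U g.
Proof. by move=> oU fg hf k; exact: Ck_ext (hf k). Qed.

Lemma smooth_cst (W : normedModType R) U (a : W) : smooth U (fun=> a : W).
Proof. by move=> k; exact: Ck_cst. Qed.

Lemma smooth_linear (W : normedModType R) U (f : {linear E -> W}) :
  continuous f -> smooth U f.
Proof. by move=> cf k; exact: Ck_linear. Qed.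

Section algebra.
Variable U : set E.
Hypothesis oU : open U.

Lemma smoothD (W : normedModType R) (f g : E -> W) :
  smooth U f -> smooth U g -> smooth U (fun p => f p + g p).
Proof. by move=> hf hg k; exact: CkD. Qed.

Lemma smoothM (f g : E -> R) :
  smooth U f -> smooth U g -> smooth U (fun p => f p * g p).
Proof. by move=> hf hg k; exact: CkM. Qed.

Lemma smoothV (f : E -> R) : (forall p, U p -> f p != 0) ->
  smooth U f -> smooth U (fun p => (f p)^-1).
Proof. by move=> f0 hf k; exact: CkV. Qed.

Lemma smooth_comp (J : set R) (f : E -> R) (g : R -> R) : (forall p, U p -> J (f p)) ->
  smooth U f -> smooth J g -> smooth U (fun p => g (f p)).
Proof. by move=> fJ hf hg k; exact: (Ck_comp oU fJ). Qed.

Lemma smooth_sum (W : normedModType R) (I : Type) (r : seq I) (P : pred I)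
    (f : I -> E -> W) :
  (forall i, smooth U (f i)) -> smooth U (fun p => \sum_(i <- r | P i) f i p).
Proof. by move=> hf k; apply: Ck_sum => // i; exact: hf. Qed.

Lemma smooth_prod (I : Type) (r : seq I) (P : pred I) (f : I -> E -> R) :
  (forall i, smooth U (f i)) -> smooth U (fun p => \prod_(i <- r | P i) f i p).
Proof. by move=> hf k; apply: Ck_prod => // i; exact: hf. Qed.

Lemma smooth_coord n (f : E -> 'rV[R]_n) i : smooth U f -> smooth U (fun p => f p 0 i).
Proof. by move=> hf k; exact: Ck_coord. Qed.

Lemma smooth_row n (f : E -> 'rV[R]_n) :
  (forall i, smooth U (fun p => f p 0 i)) -> smooth U f.
Proof. by move=> hf k; apply: Ck_row => // i; exact: hf. Qed.

Lemma smoothZ n (f : E -> R) (g : E -> 'rV[R]_n) :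
  smooth U f -> smooth U g -> smooth U (fun p => f p *: g p).
Proof.
move=> hf hg; apply: smooth_row => i.
rewrite (_ : (fun p => _) = fun p => f p * g p 0 i); last by apply/funext => p; rewrite mxE.
by apply: smoothM => //; exact: smooth_coord.
Qed.

Lemma smoothNr (f : E -> R) : smooth U f -> smooth U (fun p => - f p).
Proof.
move=> hf; rewrite (_ : (fun p => _) = fun p => (-1) * f p).
  by apply: smoothM => //; exact: smooth_cst.
by apply/funext => p; rewrite mulN1r.
Qed.

Lemma smoothBr (f g : E -> R) : smooth U f -> smooth U g -> smooth U (fun p => f p - g p).
Proof. by move=> hf hg; apply: smoothD => //; exact: smoothNr. Qed.

Lemma smoothB n (f g : E -> 'rV[R]_n) :
  smooth U f -> smooth U g -> smooth U (fun p => f p - g p).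
Proof.
move=> hf hg; apply: smoothD => //.
rewrite (_ : (fun p => _) = fun p => (-1) *: g p).
  by apply: smoothZ => //; exact: smooth_cst.
by apply/funext => p; rewrite scaleN1r.
Qed.

Lemma smooth_dot n (f g : E -> 'rV[R]_n) :
  smooth U f -> smooth U g -> smooth U (fun p => dot (f p) (g p)).
Proof.
move=> hf hg; apply: smooth_sum => i; apply: smoothM; exact: smooth_coord.
Qed.

Lemma smooth_cross (f g : E -> 'rV[R]_3) :
  smooth U f -> smooth U g -> smooth U (fun p => cross (f p) (g p)).
Proof.
move=> hf hg; apply: smooth_row => i.
rewrite (_ : (fun p => _) = (fun p =>
  (if i == 0 then f p 0 1 * g p 0 2 - f p 0 2 * g p 0 1
     else if i == 1 then f p 0 2 * g p 0 0 - f p 0 0 * g p 0 2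
     else f p 0 0 * g p 0 1 - f p 0 1 * g p 0 0))); last by apply/funext => p; rewrite mxE.
have hM j l : smooth U (fun p => f p 0 j * g p 0 l).
  by apply: smoothM; exact: smooth_coord.
by case: (i == 0); [|case: (i == 1)]; apply: smoothBr.
Qed.

Lemma smooth_is_derive (W : normedModType R) (f : E -> W) p v : smooth U f -> U p ->
  is_derive p v f ('D_v f p).
Proof. by move=> hf; exact: Ck_is_derive (hf 1%N). Qed.

Lemma smooth_continuous (W : normedModType R) (f : E -> W) p : smooth U f -> U p ->
  {for p, continuous f}.
Proof. by move=> hf; exact: hf 0%N p. Qed.

Lemma smooth_directional (W : normedModType R) (f : E -> W) v : smooth U f ->
  smooth U (fun p => 'D_v f p).
Proof. by move=> hf k; exact: (hf k.+1).2. Qed.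

End algebra.
End smooth_functions.

Section smooth_curves.
Variables (R : realType) (I : set R).
Hypothesis oI : open I.

Lemma smooth_derive1 (W : normedModType R) (f : R -> W) : smooth I f -> smooth I (derive1 f).
Proof.
move=> hf; rewrite (_ : derive1 f = fun t => 'D_1 f t); first exact: smooth_directional.
by apply/funext => t; exact: derive1E.
Qed.

Lemma smooth_has_derive1 (W : normedModType R) (f : R -> W) t : smooth I f -> I t ->
  is_derive t 1 f (derive1 f t).
Proof. by move=> hf It; rewrite derive1E; exact: smooth_is_derive hf It. Qed.

Lemma is_derive_derive1 (W : normedModType R) (f : R -> W) (t : R) a :
  is_derive t 1 f a -> derive1 f t = a.
Proof. by case=> _; rewrite derive1E. Qed.

Lemma smooth_antiderivative (f F : R -> R) :
  smooth I f -> (forall t, I t -> is_derive t 1 F (f t)) -> smooth I F.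
Proof.
move=> hf dF; have h k : Ck k.+1 I F.
  apply: (@CkS R R R k I F (fun v t => v * f t)) => //.
  - by move=> t It; apply/derivable1_diffP; have [] := dF t It.
  - move=> v t It; have [d e] := dF t It; have d' := (derivable1_diffP _ _).1 d.
    split; first exact: diff_derivable.
    by rewrite (deriveE _ d') (diff1E d') derive1E e.
  - by move=> v; apply: CkM => //; exact: Ck_cst.
by case=> [|k]; [exact/CkW/h|exact: h].
Qed.

Lemma smooth_id : smooth I (fun t : R => t).
Proof. by have := @smooth_linear R R R I idfun; apply => t; exact: cvg_id. Qed.

End smooth_curves.

Lemma smooth_trigo (R : realType) :
  smooth [set: R] (@cos R) /\ smooth [set: R] (@sin R).
Proof.
suff h k : Ck k [set: R] (@cos R) /\ Ck k [set: R] (@sin R) by split=> k; case: (h k).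
elim: k => [|k [hc hs]].
  by split=> t _; [exact: continuous_cos|exact: continuous_sin].
have oT := @openT R.
split.
- apply: (@CkS R R R k _ _ (fun v t => v * ((-1) * sin t))) => //.
  + by move=> t _; apply/derivable1_diffP.
  + move=> v t _; have d' : differentiable cos t by apply/derivable1_diffP.
    by split; [exact: diff_derivable|rewrite (deriveE _ d') (diff1E d') derive1E derive_val mulN1r].
  + by move=> v; do 2?[apply: CkM => //]; exact: Ck_cst.
- apply: (@CkS R R R k _ _ (fun v t => v * cos t)) => //.
  + by move=> t _; apply/derivable1_diffP.
  + move=> v t _; have d' : differentiable sin t by apply/derivable1_diffP.
    by split; [exact: diff_derivable|rewrite (deriveE _ d') (diff1E d') derive1E derive_val].
  + by move=> v; apply: CkM => //; exact: Ck_cst.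
Qed.

Section smooth_square_root.
Variables (R : realType).

(** As for the inverse, the derivative is a rational expression in the function
    itself, so that the induction hypothesis applies to it. *)
Lemma smooth_sqrt_pos : smooth [set t : R | 0 < t] (@Num.sqrt R).
Proof.
have oP : open [set t : R | 0 < t] by exact: open_gt.
elim=> [|k IH]; first by move=> t _; exact: sqrt_continuous.
apply: (@CkS R R R k _ _ (fun v t => v * (2 * Num.sqrt t)^-1)) => //.
- by move=> t t0; apply/derivable1_diffP; case: (is_derive1_sqrt t0).
- move=> v t t0; have [d e] := is_derive1_sqrt t0.
  have d' := (derivable1_diffP _ _).1 d.
  by split; [exact: diff_derivable|rewrite (deriveE _ d') (diff1E d') derive1E e].
- move=> v; apply: CkM => //; first exact: Ck_cst.
  apply: CkV => // [t t0|]; first by rewrite mulf_neq0 // sqrtr_eq0 -ltNge.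
  by apply: CkM => //; exact: Ck_cst.
Qed.

Lemma smooth_sqrt (E : normedModType R) (U : set E) (f : E -> R) : open U ->
  (forall p, U p -> 0 < f p) -> smooth U f -> smooth U (fun p => Num.sqrt (f p)).
Proof. by move=> oU f0 hf; exact: smooth_comp oU _ _ _ f0 hf smooth_sqrt_pos. Qed.

End smooth_square_root.

(** * Uniform estimates for families of curves *)

Section strips.
Variables (R : realType) (t0 t1 eps : R).
Hypothesis eps0 : 0 < eps.

Let U := [set p : R * R | `|p.1| < eps /\ t0 - eps < p.2 < t1 + eps].

Lemma strip_open : open U.
Proof.
have -> : U = (fst : R * R -> R) @^-1` [set s | `|s| < eps] `&`
    (snd : R * R -> R) @^-1` `]t0 - eps, t1 + eps[.
  by apply/seteqP; split=> -[s t] /=; rewrite in_itv.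
apply: openI; apply: open_comp.
- by move=> p _; exact: cvg_fst.
- rewrite (_ : [set s | _] = ball (0 : R) eps); first exact: ball_open.
  by apply/seteqP; split=> s; rewrite /ball /= sub0r normrN.
- by move=> p _; exact: cvg_snd.
- exact: interval_open.
Qed.

(** The difference quotient of F along (0, 1) at (s, t) is literally the one of
    F s at t, which ties the derivatives of a two-parameter family to the time
    derivatives of its members. *)
Lemma slice_derive (W : normedModType R) (F : R -> R -> W) (p : R * R) :
  differentiable (fun q : R * R => F q.1 q.2) p ->
  is_derive p.2 1 (F p.1) ('D_((0, 1) : R * R) (fun q : R * R => F q.1 q.2) p).
Proof.
case: p => s t /= dF; have := @diff_derivable _ _ _ _ _ ((0, 1) : R * R) dF.
set q := fun h : R => h^-1 *: (F s (h * 1 + t) - F s t).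
have e : (fun h : R => h^-1 *: (((fun q : R * R => F q.1 q.2) \o shift (s, t)) (h *: ((0, 1) : R * R))
   - F s t)) = q.
  by apply/funext => h; rewrite /q /= scaler0 add0r.
by rewrite /derive /derivable /= e => cq; split.
Qed.

Lemma slice_derive_fst (W : normedModType R) (F : R -> R -> W) (p : R * R) :
  differentiable (fun q : R * R => F q.1 q.2) p ->
  is_derive p.1 1 (F ^~ p.2) ('D_((1, 0) : R * R) (fun q : R * R => F q.1 q.2) p).
Proof.
case: p => s t /= dF; have := @diff_derivable _ _ _ _ _ ((1, 0) : R * R) dF.
set q := fun h : R => h^-1 *: (F (h * 1 + s) t - F s t).
have e : (fun h : R => h^-1 *: (((fun q : R * R => F q.1 q.2) \o shift (s, t)) (h *: ((1, 0) : R * R))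
   - F s t)) = q.
  by apply/funext => h; rewrite /q /= scaler0 add0r.
by rewrite /derive /derivable /= e => cq; split.
Qed.

(** The partial derivative in s is continuous, hence bounded on the compact
    rectangle |s| <= eps / 2, t0 <= t <= t1. *)
Lemma strip_lipschitz n (F : R -> R -> 'rV[R]_n) : smooth U (fun q => F q.1 q.2) ->
  exists2 L : R, 0 <= L & forall s t, `|s| <= eps / 2 -> t0 <= t <= t1 ->
    enorm (F s t - F 0 t) <= L * `|s|.
Proof.
move=> hF; pose G := fun q : R * R => F q.1 q.2.
pose K := `[(- (eps / 2)), eps / 2] `*` `[t0, t1].
have KU : K `<=` U.
  move=> -[s t] [] /=; rewrite !in_itv /= => /andP[s1 s2] /andP[h1 h2].
  by rewrite /U /= ltr_norml; split; apply/andP; split; move: eps0; lra.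
have cK : compact K by apply: compact_setX; exact: segment_compact.
have cD : {within K, continuous ('D_((1, 0) : R * R) G)}.
  apply: continuous_in_subspaceT => p; rewrite inE => Kp.
  by apply: (hF 1%N).2; exact: KU.
have [M0' [_ hM0]] := compact_bounded (continuous_compact cD cK).
have := hM0 (M0' + 1) ltac:(by rewrite ltrDl); set M := M0' + 1 => hM {hM0}.
have M0 p : K p -> `|'D_((1, 0) : R * R) G p| <= `|M|.
  by move=> Kp; apply: le_trans (hM _ _) (ler_norm _); exists p.
exists (n%:R * `|M|); first by rewrite mulr_ge0.
move=> s t hs ht.
have Kst (u : R) : `|u| <= eps / 2 -> K (u, t).
  by move=> hu; split; rewrite /= in_itv //= -ler_norml.
have coord i : `|F s t 0 i - F 0 t 0 i| <= `|M| * `|s|.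
  have dF (u : R) : `|u| <= eps / 2 ->
      is_derive u 1 (fun u => F u t 0 i) ('D_((1, 0) : R * R) G (u, t) 0 i).
    move=> hu; apply: is_derive_coord; apply: (@slice_derive_fst _ F (u, t)).
    by apply: (hF 1%N).1; apply: KU; exact: Kst.
  have bd (u : R) : `|u| <= eps / 2 -> `|'D_((1, 0) : R * R) G (u, t) 0 i| <= `|M|.
    move=> hu; apply: le_trans (M0 _ (Kst u hu)).
    rewrite [leRHS]/Num.Def.normr /= mx_normrE.
    exact: (le_bigmax _ (fun ij : 'I_1 * 'I_n => `|'D_((1, 0) : R * R) G (u, t) ij.1 ij.2|) (0, i)).
  move: hs; rewrite ler_norml => /andP[s1 s2].
  have in_range (u a b : R) : - (eps / 2) <= a -> b <= eps / 2 -> a <= u <= b -> `|u| <= eps / 2.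
    by move=> *; rewrite ler_norml; lra.
  have [s0|/ltW s0] := leP 0 s.
    have := @increment_norm_le R (fun u => F u t 0 i) _ 0 s `|M| s0
      (fun u hu => dF u (in_range u 0 s ltac:(lra) s2 hu)).
    rewrite subr0 (ger0_norm s0); apply=> u hu; apply: bd.
    by apply: (in_range u 0 s) => //; lra.
  have := @increment_norm_le R (fun u => F u t 0 i) _ s 0 `|M| s0
    (fun u hu => dF u (in_range u s 0 s1 ltac:(lra) hu)).
  rewrite sub0r (ler0_norm s0) distrC; apply=> u hu; apply: bd.
  by apply: (in_range u s 0) => //; lra.
apply: le_trans (enorm_le_sum _) _.
apply: le_trans (ler_sum _ (G := fun=> `|M| * `|s|) _) _; first by move=> i _; rewrite !mxE.
by rewrite sumr_const card_ord -mulrnAl -mulr_natl.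
Qed.

End strips.

Section first_variation_algebra.
Variables (R : realType) (n : nat).
Implicit Types (p v w : 'rV[R]_n) (b c r : R).

(** Lower bound by Cauchy-Schwarz; upper bound from 2 |u| <= 1 + |u|^2. *)
Lemma norm_linearization (u e : 'rV[R]_n) : enorm e = 1 ->
  `|enorm u - dot e u| <= enorm (u - e) ^+ 2 / 2.
Proof.
move=> he; have := dot_le e u; rewrite he mul1r => h.
rewrite ger0_norm ?subr_ge0 // enorm_sqr !dotE (dotC u e) -!enorm_sqr he.
have := sqr_ge0 (enorm u - 1); nra.
Qed.

Lemma dot_unit_pair v w : dot v v = 1 -> dot w w = 1 ->
  dot v w = 1 - enorm (w - v) ^+ 2 / 2.
Proof. by move=> hv hw; rewrite enorm_sqr !dotE hv hw (dotC w v); field. Qed.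

(** The integrand of the first variation. A bicycle with frame direction v that
    turns with velocity v', and with back speed b, has front velocity b v + v',
    here of norm 1; the varied one has w, w' and c instead. The front speed is
    linearized at b v + v', and every remaining term has two small factors,
    because v . w' = (v - w) . w', w . v' = (w - v) . v' and v . w - 1 is
    quadratic in w - v. The vector [p] splits b into p . v and the rest: p . (c w)
    is the velocity of the back wheel along [p], whose integral is prescribed. *)
Lemma first_variation_pointwise p v (v' : 'rV[R]_n) w (w' : 'rV[R]_n) b c r :
  dot v v = 1 -> dot w w = 1 -> dot v v' = 0 -> dot w w' = 0 ->
  b ^+ 2 + dot v' v' = 1 -> 0 <= r <= 1 ->
  enorm (w - v) <= r -> enorm (w' - v') <= r -> enorm (c *: w - b *: v) <= r ->
  `|enorm (c *: w + w') - 1 - ((b - dot p v) * (c - b) + dot p (c *: w - b *: v)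
     + dot v' (w' - v') - b * dot p (w - v))| <= (7 + 2 * enorm p) * r ^+ 2.
Proof.
move=> hv hw hv' hw' hb /andP[r0 r1] h1 h2 h3.
have P0 := enorm_ge0 p.
have b1 : `|b| <= 1.
  rewrite -(@ler_sqr _ `|b|) ?nnegrE // real_normK ?num_real // expr1n.
  by have := dot_ge0 v'; lra.
have n' : enorm v' <= 1.
  rewrite -(@ler_sqr _ (enorm v')) ?nnegrE ?enorm_ge0 // enorm_sqr expr1n.
  by have := sqr_ge0 b; lra.
have E := norm_linearization (c *: w + w') (e := b *: v + v') _.
have unit_e : enorm (b *: v + v') = 1.
  by apply/enorm_unit; rewrite !dotE (dotC v' v) hv hv' !mulr0 addr0 add0r mulr1 -expr2.
move: {E}(E unit_e).
have -> : c *: w + w' - (b *: v + v') = (c *: w - b *: v) + (w' - v').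
  by rewrite opprD addrACA.
set X := enorm (_ + (w' - v')) => E.
have X0 : 0 <= X by exact: enorm_ge0.
have X2 : X <= 2 * r by rewrite (le_trans (enormD _ _)) // mulr_natl mulr2n lerD.
pose D := w - v; pose D' := w' - v'.
have D0 : 0 <= enorm D <= r by rewrite enorm_ge0.
have D'0 : 0 <= enorm D' <= r by rewrite enorm_ge0.
have vw := dot_unit_pair hv hw.
have cb : `|c - b| <= 2 * r.
  have -> : c - b = dot (c *: w - b *: v) w - b * (enorm D ^+ 2 / 2).
    by rewrite !dotE hw vw /D; ring.
  apply: le_trans (ler_normB _ _) _.
  have := cauchy_schwarz (c *: w - b *: v) w.
  have -> : enorm w = 1 by exact/enorm_unit.
  rewrite mulr1 => k1.
  have k2 : `|b * (enorm D ^+ 2 / 2)| <= r ^+ 2 / 2.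
    rewrite normrM (ger0_norm (_ : 0 <= enorm D ^+ 2 / 2)); last by rewrite divr_ge0 // sqr_ge0.
    by rewrite -[leRHS]mul1r ler_pM ?divr_ge0 ?sqr_ge0 // ler_wpM2r // ler_sqr ?nnegrE //; lra.
  have : r ^+ 2 <= r by rewrite expr2; nra.
  lra.
have c3 : `|c| <= 3.
  have : `|c| <= `|c - b| + `|b| by rewrite -{1}(subrK b c) ler_normD.
  lra.
pose e1 := enorm (c *: w + w') - dot (b *: v + v') (c *: w + w').
pose e2 := b * c * (enorm D ^+ 2 / 2).
pose e3 := (c - b) * dot v' D.
pose e4 := b * dot D' D.
pose e5 := (c - b) * dot p D.
have -> : enorm (c *: w + w') - 1 - ((b - dot p v) * (c - b) + dot p (c *: w - b *: v)
     + dot v' (w' - v') - b * dot p (w - v)) = e1 - e2 + e3 - e4 - e5.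
  rewrite /e1 /e2 /e3 /e4 /e5 enorm_sqr /D /D' !dotE hv hw.
  have -> : dot v' v = 0 by rewrite dotC.
  have -> : dot w' w = 0 by rewrite dotC.
  rewrite (dotC w' v) (dotC w v).
  have -> : dot v' v' = 1 - b ^+ 2 by lra.
  by field.
have B2 : `|e2| <= 3 / 2 * r ^+ 2.
  rewrite /e2 (normrM (b * c)) (normrM b) (ger0_norm (_ : 0 <= enorm D ^+ 2 / 2)); last first.
    by rewrite divr_ge0 // sqr_ge0.
  have : `|b| * `|c| <= 3 by rewrite -[leRHS]mul1r ler_pM.
  have : enorm D ^+ 2 <= r ^+ 2 by rewrite ler_sqr ?nnegrE //; lra.
  have := mulr_ge0 (normr_ge0 b) (normr_ge0 c); have := sqr_ge0 (enorm D); have := sqr_ge0 r.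
  set Q := `|b| * `|c|; set S := enorm D ^+ 2; set T := r ^+ 2; clearbody Q S T.
  move=> T0 S0 Q0 S1 Q1.
  have : Q * S <= 3 * T by rewrite ler_pM.
  lra.
have CS (a e : R) u z : `|a| <= e * r -> enorm u <= 1 -> enorm z <= r ->
    `|a * dot u z| <= e * r ^+ 2.
  move=> ha hu hz; rewrite normrM expr2 mulrA ler_pM //.
  apply: le_trans (cauchy_schwarz _ _) _.
  by rewrite -[leRHS]mul1r ler_pM ?enorm_ge0.
have B3 : `|e3| <= 2 * r ^+ 2 by apply: CS => //; lra.
have B4 : `|e4| <= r ^+ 2.
  rewrite /e4 normrM -[leRHS]mul1r ler_pM //.
  by apply: le_trans (cauchy_schwarz _ _) _; rewrite expr2 ler_pM ?enorm_ge0 //; lra.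
have B5 : `|e5| <= 2 * enorm p * r ^+ 2.
  rewrite /e5 normrM expr2.
  apply: le_trans (_ : _ <= 2 * r * (enorm p * r)) _; last by rewrite le_eqVlt; apply/orP; left; apply/eqP; ring.
  apply: ler_pM => //; apply: le_trans (cauchy_schwarz _ _) _.
  by rewrite ler_wpM2l //; lra.
have B1 : `|e1| <= 2 * r ^+ 2.
  apply: le_trans E _.
  have : X ^+ 2 <= (2 * r) ^+ 2 by rewrite ler_sqr ?nnegrE //; lra.
  by rewrite exprMn; lra.
move: B1 B2 B3 B4 B5; rewrite !ler_norml.
by move=> /andP[? ?] /andP[? ?] /andP[? ?] /andP[? ?] /andP[? ?]; lra.
Qed.

End first_variation_algebra.

(** * Bicycle paths and the first variation of length *)

Section kinematics.
Variables (R : realType) (n : nat).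

(** As |x - y| = 1, the velocity x' - y' of the frame is orthogonal to x - y, so
    that x' and y' have the same component along the frame. *)
Lemma no_skid_velocities (D : set R) (x y : R -> 'rV[R]_n) (t : R) dx dy :
  (\near t, D t) -> no_skid D x y -> is_derive t 1 x dx -> is_derive t 1 y dy ->
  [/\ dot (x t - y t) (x t - y t) = 1, dot (x t - y t) (dx - dy) = 0
    & dy = dot dx (x t - y t) *: (x t - y t)].
Proof.
move=> nD sk hx hy.
have unit_frame u : D u -> dot (x u - y u) (x u - y u) = 1.
  by move=> /sk[/enorm_unit].
have [_ [c hc]] := sk t (nbhs_singleton nD).
have hv := unit_frame t (nbhs_singleton nD).
have d1 : is_derive t 1 (fun u => dot (x u - y u) (x u - y u)) 0.
  apply: (@is_derive_near R R t 1 R (fun=> 1)).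
  by apply: filterS nD => u /unit_frame.
have orth : dot (x t - y t) (dx - dy) = 0.
  have [_ e1] := d1; have [_ e2] := is_derive_dot (is_derive_sub hx hy) (is_derive_sub hx hy).
  have : dot (dx - dy) (x t - y t) + dot (x t - y t) (dx - dy) = 0 by rewrite -e1 -e2.
  by rewrite (dotC (dx - dy)) => e3; lra.
split=> //; move: hc; rewrite (is_derive_derive1 hy) => hc.
suff -> : dot dx (x t - y t) = c by [].
have -> : dx = (dx - dy) + dy by rewrite subrK.
by rewrite dotDl dotC orth add0r hc dotZl hv mulr1.
Qed.

(** The component of the front velocity along the frame, which by the no-skid
    condition is the signed speed of the back wheel. *)
Definition back_speed (x y : R -> 'rV[R]_n) (t : R) : R := dot (derive1 x t) (x t - y t).

(** The velocity of the frame direction, that is of the front wheel relative to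
    the back wheel. *)
Definition frame_velocity (x y : R -> 'rV[R]_n) (t : R) : 'rV[R]_n :=
  derive1 x t - back_speed x y t *: (x t - y t).

Section path.
Variables (I : set R) (x y : R -> 'rV[R]_n).
Hypotheses (oI : open_interval I) (bp : bicycle_path I x y) (us : unit_speed I x).

Let T := derive1 x.
Let v t := x t - y t.
Let c := back_speed x y.
Let v' := frame_velocity x y.

Lemma interval_near t : I t -> \near t, I t.
Proof. by move=> It; exact: open_nbhs_nbhs (conj oI.1 It). Qed.

Lemma bicycle_velocities t : I t ->
  [/\ dot (v t) (v t) = 1, dot (v t) (v' t) = 0 & derive1 y t = c t *: v t].
Proof.
move=> It; case: bp => sx sy sk.
have [h1 h2 h3] := no_skid_velocities (interval_near It) sk
  (smooth_has_derive1 sx It) (smooth_has_derive1 sy It).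
by split=> //; move: h2; rewrite {1}h3.
Qed.

Lemma frame_unit t : I t -> dot (v t) (v t) = 1.
Proof. by case/bicycle_velocities. Qed.

Lemma frame_derive t : I t -> is_derive t 1 v (v' t).
Proof.
move=> It; case: bp => sx sy sk; have [_ _ e] := bicycle_velocities It.
by rewrite /v' /frame_velocity -/(c t) -e; apply: is_derive_sub; exact: smooth_has_derive1.
Qed.

Lemma front_unit t : I t -> dot (T t) (T t) = 1.
Proof. by move=> /us/enorm_unit. Qed.

Lemma front_derive t : I t -> is_derive t 1 x (T t).
Proof. by move=> It; case: bp => sx _ _; exact: smooth_has_derive1. Qed.

Lemma back_derive t : I t -> is_derive t 1 y (c t *: v t).
Proof.
move=> It; case: bp => _ sy _; have [_ _ <-] := bicycle_velocities It.
exact: smooth_has_derive1.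
Qed.

Lemma frame_speed t : I t -> c t ^+ 2 + dot (v' t) (v' t) = 1.
Proof.
move=> It; have alg (a b : 'rV[R]_n) : dot a a = 1 -> dot b b = 1 ->
    dot a b ^+ 2 + dot (a - dot a b *: b) (a - dot a b *: b) = 1.
  by move=> ha hb; rewrite !dotE ha hb (dotC b a); ring.
exact: alg (front_unit It) (frame_unit It).
Qed.

Lemma smooth_front_velocity : smooth I T.
Proof. by case: bp => sx _ _; exact: smooth_derive1. Qed.

Lemma smooth_frame : smooth I v.
Proof. by case: bp => sx sy _; apply: smoothB => //; exact: oI.1. Qed.

Lemma smooth_back_speed : smooth I c.
Proof. by apply: smooth_dot; [exact: oI.1|exact: smooth_front_velocity|exact: smooth_frame]. Qed.

Lemma smooth_frame_velocity : smooth I v'.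
Proof.
apply: smoothB; [exact: oI.1|exact: smooth_front_velocity|].
by apply: smoothZ; [exact: oI.1|exact: smooth_back_speed|exact: smooth_frame].
Qed.

(** The first variation of length, with a remainder that is quadratic in the
    parameter and uniform in time. Up to such a remainder, the terms with the
    arbitrary vector [p] add up to the derivative of - p . (Y - y), which
    vanishes at both end points. *)
Lemma first_variation t0 t1 (X Y : R -> R -> 'rV[R]_n) (p : 'rV[R]_n) : I t0 -> I t1 -> t0 < t1 ->
  Defs.variation t0 t1 x y X Y ->
  exists K L delta, [/\ 0 < delta, 0 <= K, 0 <= L,
    (forall s t, `|s| <= delta -> t0 <= t <= t1 -> enorm (X s t - Y s t - v t) <= L * `|s|) &
    forall s, `|s| <= delta -> forall (g G : R -> R) (M : R),
      (forall t, t0 <= t <= t1 -> is_derive t 1 G (g t)) ->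
      (forall t, t0 < t < t1 ->
         `|(c t - dot p (v t)) * (back_speed (X s) (Y s) t - c t)
           - dot (derive1 v' t + c t *: p) (X s t - Y s t - v t) - g t| <= M) ->
      `|length t0 t1 (X s) - (t1 - t0) - (G t1 - G t0)| <= (K * s ^+ 2 + M) * (t1 - t0)].
Proof.
move=> I0 I1 t01 [eps eps0 [sX sY sk XY0 XYend]].
set U := [set p : R * R | _] in sX sY.
have IJ u : t0 <= u <= t1 -> I u by exact: oI.2.
have [LX LX0 hLX] := strip_lipschitz eps0 sX.
have [LY LY0 hLY] := strip_lipschitz eps0 sY.
pose DX (s t : R) := 'D_((0, 1) : R * R) (fun p => X p.1 p.2) (s, t).
pose DY (s t : R) := 'D_((0, 1) : R * R) (fun p => Y p.1 p.2) (s, t).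
have sDX : smooth U (fun q : R * R => DX q.1 q.2).
  have -> : (fun q : R * R => DX q.1 q.2)
    = 'D_((0, 1) : R * R) (fun p => X p.1 p.2) by apply/funext => -[].
  exact: smooth_directional.
have sDY : smooth U (fun q : R * R => DY q.1 q.2).
  have -> : (fun q : R * R => DY q.1 q.2)
    = 'D_((0, 1) : R * R) (fun p => Y p.1 p.2) by apply/funext => -[].
  exact: smooth_directional.
have [LX' LX'0 hLX'] := strip_lipschitz eps0 sDX.
have [LY' LY'0 hLY'] := strip_lipschitz eps0 sDY.
have dX (s t : R) : U (s, t) -> is_derive t 1 (X s) (DX s t).
  by move=> Ust; apply: (@slice_derive _ _ X (s, t)); exact: (sX 1%N).1.
have dY (s t : R) : U (s, t) -> is_derive t 1 (Y s) (DY s t).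
  by move=> Ust; apply: (@slice_derive _ _ Y (s, t)); exact: (sY 1%N).1.
have contDX (s t : R) : U (s, t) -> {for t, continuous (DX s)}.
  move=> Ust; apply: (@continuous_comp _ _ _ (fun u => (s, u)) ('D_((0, 1) : R * R) (fun p => X p.1 p.2))) => //.
    by apply: differentiable_continuous; apply: differentiable_pair; first exact: differentiable_cst.
  by apply: (sX 1%N).2.
clearbody DX DY.
pose L := LX + LY + LX' + LY'.
have L0 : 0 <= L by rewrite !addr_ge0.
pose delta := Num.min (eps / 2) (L + 1)^-1.
have d0 : 0 < delta by rewrite lt_min divr_gt0 // invr_gt0 ltr_wpDl.
have UI s t : `|s| <= delta -> t0 <= t <= t1 -> U (s, t).
  move=> hs ht; have : `|s| <= eps / 2 by rewrite (le_trans hs) // ge_min lexx.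
  by move=> hs'; rewrite /U /=; split; [lra|apply/andP; split; lra].
have near_in t : t0 < t < t1 -> \near t, t0 <= t <= t1.
  move=> /andP[h1 h2]; near=> u; apply/andP; split; apply/ltW.
  - by near: u; exact: lt_nbhsr.
  - by near: u; exact: lt_nbhsl.
have DX0 t : t0 < t < t1 -> DX 0 t = T t.
  move=> ht; have := dX 0 t (UI 0 t ltac:(by rewrite normr0 ltW) ltac:(lra)).
  move=> h; have : is_derive t 1 x (DX 0 t).
    apply: is_derive_near h; apply: filterS (near_in t ht) => u hu.
    by have [] := XY0 u hu.
  by move/is_derive_derive1.
have DY0 t : t0 < t < t1 -> DY 0 t = c t *: v t.
  move=> ht; have := dY 0 t (UI 0 t ltac:(by rewrite normr0 ltW) ltac:(lra)).
  move=> h; have : is_derive t 1 y (DY 0 t).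
    apply: is_derive_near h; apply: filterS (near_in t ht) => u hu.
    by have [] := XY0 u hu.
  move/is_derive_derive1 => <-.
  by apply: is_derive_derive1; apply: back_derive; apply: IJ; lra.
have lipV s t : `|s| <= delta -> t0 <= t <= t1 -> enorm (X s t - Y s t - v t) <= L * `|s|.
  move=> hs ht; have hs' : `|s| <= eps / 2 by rewrite (le_trans hs) // ge_min lexx.
  have -> : X s t - Y s t - v t = (X s t - X 0 t) - (Y s t - Y 0 t).
    by have [-> ->] := XY0 t ht; apply/rowP => i; rewrite /v !mxE; ring.
  apply: le_trans (enormB _ _) _.
  have := hLX s t hs' ht; have := hLY s t hs' ht; rewrite /L.
  by have := mulr_ge0 LX'0 (normr_ge0 s); have := mulr_ge0 LY'0 (normr_ge0 s); lra.
exists ((7 + 2 * enorm p) * L ^+ 2), L, delta; split => //.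
  by rewrite mulr_ge0 ?sqr_ge0 // addr_ge0 // mulr_ge0 // enorm_ge0.
move=> s hs g G M dG hM.
have hse : `|s| < eps.
  have : delta <= eps / 2 by rewrite ge_min lexx.
  by lra.
have hs' : `|s| <= eps / 2 by rewrite (le_trans hs) // ge_min lexx.
have Ls1 : L * `|s| <= 1.
  have L1 : 0 < L + 1 by rewrite ltr_wpDl.
  have : `|s| * (L + 1) <= 1 by rewrite -ler_pdivlMr // mul1r (le_trans hs) // ge_min lexx orbT.
  by have := normr_ge0 s; nra.
pose J : set R := `]t0 - eps, t1 + eps[.
have oJ : open_interval J.
  by split; [exact: interval_open|exact: interval_is_interval].
have cDX : Ck 0 J (DX s).
  by move=> t; rewrite /J /= in_itv /= => ht; exact: contDX.
have cnorm t : J t -> {for t, continuous (fun t => enorm (DX s t))}.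
  move=> Jt; apply: (@continuous_comp _ _ _ (fun t => dot (DX s t) (DX s t)) (@Num.sqrt R)); last exact: sqrt_continuous.
  move: t Jt; rewrite -[forall t, _]/(Ck 0 J (fun t => dot (DX s t) (DX s t))).
  by apply: Ck_sum oJ.1 _ => i; apply: CkM oJ.1 _ _; exact: Ck_coord oJ.1 cDX.
have [F dF] := primitive oJ cnorm.
have cX t : t0 <= t <= t1 -> J t by move=> ht; rewrite /J /= in_itv /=; lra.
have lenE : length t0 t1 (X s) = F t1 - F t0.
  transitivity (\int[lebesgue_measure]_(t in `[t0, t1]) enorm (DX s t))%R.
    apply: eq_Rintegral => t; rewrite inE /= in_itv /= => ht.
    by congr enorm; exact: is_derive_derive1 (dX s t (UI s t hs ht)).
  exact: integral_eq_increment t01 (fun t ht => cnorm t (cX t ht)) (fun t ht => dF t (cX t ht)).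
pose Psi t := F t - t - (dot p (Y s t - y t) + dot (v' t) (X s t - Y s t - v t)) - G t.
pose dPsi t := enorm (DX s t) - 1 - (dot p (DY s t - c t *: v t) +
  (dot (derive1 v' t) (X s t - Y s t - v t) + dot (v' t) (DX s t - DY s t - v' t))) - g t.
have dPsiP t : t0 <= t <= t1 -> is_derive t 1 Psi (dPsi t).
  move=> ht; have It := IJ t ht; have Ust := UI s t hs ht.
  have h1 := is_derive_sub (dF t (cX t ht)) (is_derive_id t 1).
  have h2 : is_derive t 1 (fun t => dot p (Y s t - y t)) (dot p (DY s t - c t *: v t)).
    have := is_derive_dot (is_derive_const t 1 p) (is_derive_sub (dY s t Ust) (back_derive It)).
    by move/is_derive_eq; apply; rewrite dot0l add0r.
  have dv' : is_derive t 1 v' (derive1 v' t) by apply: smooth_has_derive1 It; exact: smooth_frame_velocity.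
  have h3 := is_derive_dot dv' (is_derive_sub (is_derive_sub (dX s t Ust) (dY s t Ust)) (frame_derive It)).
  exact: is_derive_sub (is_derive_sub h1 (is_derive_add h2 h3)) (dG t ht).
have bound t : t0 < t < t1 -> `|dPsi t| <= (7 + 2 * enorm p) * L ^+ 2 * s ^+ 2 + M.
  move=> ht; have ht' : t0 <= t <= t1 by lra.
  have It := IJ t ht'; have Ust := UI s t hs ht'.
  have [w1 w2 w3] := no_skid_velocities (near_in t ht) (sk s hse) (dX s t Ust) (dY s t Ust).
  have [u1 u2 _] := bicycle_velocities It.
  pose C := back_speed (X s) (Y s) t.
  have CE : DY s t = C *: (X s t - Y s t).
    by rewrite /C /back_speed (is_derive_derive1 (dX s t Ust)).
  have XE : DX s t = C *: (X s t - Y s t) + (DX s t - DY s t) by rewrite -CE addrC subrK.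
  have lip' : enorm (DX s t - DY s t - v' t) <= L * `|s|.
    have -> : DX s t - DY s t - v' t = (DX s t - DX 0 t) - (DY s t - DY 0 t).
      have alg (a a0 b b0 e f : 'rV[R]_n) : a0 = e -> b0 = f -> a - b - (e - f) = (a - a0) - (b - b0).
        by move=> -> ->; apply/rowP => i; rewrite !mxE; ring.
      by apply: alg; [exact: DX0|exact: DY0].
    apply: le_trans (enormB _ _) _.
    have := hLX' s t hs' ht'; have := hLY' s t hs' ht'; rewrite /L.
    by have := mulr_ge0 LX0 (normr_ge0 s); have := mulr_ge0 LY0 (normr_ge0 s); lra.
  have lipY : enorm (C *: (X s t - Y s t) - c t *: v t) <= L * `|s|.
    rewrite -CE -DY0 //; have := hLY' s t hs' ht'; rewrite /L.
    have := mulr_ge0 LX0 (normr_ge0 s); have := mulr_ge0 LY0 (normr_ge0 s).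
    by have := mulr_ge0 LX'0 (normr_ge0 s); lra.
  have r01 : 0 <= L * `|s| <= 1 by rewrite mulr_ge0.
  have := first_variation_pointwise p u1 w1 u2 w2 (frame_speed It) r01 (lipV s t hs ht') lip' lipY.
  rewrite -XE exprMn real_normK ?num_real // mulrA => B1.
  have B2 := hM t ht; rewrite -/C in B2.
  move: B1 B2; rewrite /dPsi CE !ler_norml (dotDl (derive1 v' t)) dotZl.
  set a1 := enorm _; set a2 := (_ - _) * (C - _); set a3 := dot p (C *: _ - _).
  set a4 := dot (v' t) _; set a5 := c t * dot p _; set a6 := dot (derive1 v' t) _.
  by move=> /andP[? ?] /andP[? ?]; apply/andP; split; lra.
have := increment_norm_le (ltW t01) dPsiP bound.
have [Xs0 Ys0 Xs1 Ys1] := XYend s hse.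
rewrite lenE /Psi Xs0 Ys0 Xs1 Ys1 /v !subrr !dot0r addr0 !subr0.
suff -> : F t1 - t1 - G t1 - (F t0 - t0 - G t0) = F t1 - F t0 - (t1 - t0) - (G t1 - G t0) by [].
ring.
Unshelve. all: by end_near.
Qed.

End path.
End kinematics.

(** * Smooth matrices, primitives and spanning times *)

Section tools.
Variable R : realType.

Section smooth_matrices.
Variables (E : normedModType R) (U : set E).
Hypothesis oU : open U.

Lemma smooth_det n (M : E -> 'M[R]_n) :
  (forall i j, smooth U (fun p => M p i j)) -> smooth U (fun p => \det (M p)).
Proof.
move=> sM; rewrite /determinant; apply: smooth_sum => // s; apply: smoothM => //.
  exact: smooth_cst.
by apply: smooth_prod => // i; exact: sM.
Qed.

Lemma smooth_adj n (M : E -> 'M[R]_n) :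
  (forall i j, smooth U (fun p => M p i j)) -> forall i j, smooth U (fun p => (\adj (M p)) i j).
Proof.
move=> sM i j; rewrite (_ : (fun p => _) = fun p => cofactor (M p) j i); last first.
  by apply/funext => p; rewrite mxE.
rewrite /cofactor; apply: smoothM => //; first exact: smooth_cst.
apply: smooth_det => k l.
rewrite (_ : (fun p => _) = fun p => M p (lift j k) (lift i l)) //.
by apply/funext => p; rewrite !mxE.
Qed.

(** By Cramer's rule. *)
Lemma smooth_invmx n (M : E -> 'M[R]_n) : (forall p, U p -> M p \in unitmx) ->
  (forall i j, smooth U (fun p => M p i j)) ->
  forall i j, smooth U (fun p => (invmx (M p)) i j).
Proof.
move=> uM sM i j.
apply: (smooth_ext (f := fun p => (\det (M p))^-1 * (\adj (M p)) i j)) => //.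
  by move=> p Up; rewrite /invmx uM // [RHS]mxE.
have det0 p : U p -> \det (M p) != 0 by move=> /uM; rewrite unitmxE unitfE.
by apply: smoothM => //; [apply: smoothV => //; exact: smooth_det|exact: smooth_adj].
Qed.

End smooth_matrices.

Lemma is_derive_of_quadratic (f : R -> R) (a K delta : R) : 0 < delta ->
  (forall s, `|s| <= delta -> `|f s - f 0 - s * a| <= K * s ^+ 2) ->
  is_derive (0 : R) 1 f a.
Proof.
move=> d0 h.
have lim : (fun k : R => k^-1 *: ((f \o shift 0) (k *: (1 : R)) - f 0)) @ (0 : R)^' --> a.
  apply/cvgrPdist_le => e e0; near=> k.
  have k0 : k != 0 by near: k; exact: nbhs_dnbhs_neq.
  have kd : `|k| <= delta.
    by near: k; apply: dnbhs0_le.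
  have kK : `|k| <= e / (`|K| + 1).
    by near: k; apply: dnbhs0_le; rewrite divr_gt0 // ltr_wpDl.
  have := h k kd; rewrite /= addr0 [k *: 1]mulr1 => hk.
  have -> : a - k^-1 *: (f k - f 0) = - k^-1 * (f k - f 0 - k * a).
    by rewrite /GRing.scale /=; field.
  rewrite normrM normrN normfV ler_pdivrMl ?normr_gt0 //.
  apply: le_trans hk _; rewrite -real_normK ?num_real // expr2.
  have K1 : 0 < `|K| + 1 by rewrite ltr_wpDl.
  rewrite ler_pdivlMr // in kK.
  rewrite [leRHS]mulrC mulrA ler_wpM2r //.
  apply: le_trans kK; rewrite mulrC ler_wpM2l //.
  by have := ler_norm K; lra.
split; first by apply/cvg_ex; exists a.
exact: cvg_lim lim.
Unshelve. all: by end_near. Qed.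

Lemma bounded_on_segment (a b : R) (f : R -> R) :
  (forall t, a <= t <= b -> {for t, continuous f}) ->
  exists2 M, 0 <= M & forall t, a <= t <= b -> `|f t| <= M.
Proof.
move=> cf; have cK := @segment_compact R a b.
have wf : {within `[a, b], continuous f}.
  by apply: continuous_in_subspaceT => t; rewrite inE /= in_itv /=; exact: cf.
have [M0 [_ hM0]] := compact_bounded (continuous_compact wf cK).
have hM := hM0 (M0 + 1) ltac:(by rewrite ltrDl).
exists `|M0 + 1| => // t ht; apply: le_trans (hM _ _) (ler_norm _).
by exists t => //=; rewrite in_itv.
Qed.

Lemma vector_primitive (I : set R) n (f : R -> 'rV[R]_n) (t0 : R) :
  open_interval I -> smooth I f ->
  exists F, [/\ smooth I F, F t0 = 0 & forall t, I t -> is_derive t 1 F (f t)].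
Proof.
move=> oI sf.
have hF i : exists F : R -> R, forall t, I t -> is_derive t 1 F (f t 0 i).
  by apply: primitive => // t It; apply: (smooth_continuous (U := I)) => //; apply: smooth_coord => //; exact: oI.1.
pose F i := sval (cid (hF i)).
have dF i t : I t -> is_derive t 1 (F i) (f t 0 i) by exact: (svalP (cid (hF i))).
pose G t := \row_i (F i t - F i t0).
have dG t : I t -> is_derive t 1 G (f t).
  move=> It; apply/is_derive_coordP => i.
  rewrite (_ : (fun t => _) = fun t => F i t - F i t0); last by apply/funext => u; rewrite mxE.
  by have := is_derive_sub (dF i t It) (is_derive_const t 1 (F i t0)); move/is_derive_eq; apply; rewrite subr0.
exists G; split => //; last by apply/rowP => i; rewrite !mxE subrr.
apply: smooth_row; first exact: oI.1.
move=> i; apply: (smooth_antiderivative oI.1 (f := fun t => f t 0 i)).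
  by apply: smooth_coord => //; exact: oI.1.
by move=> t It; apply: is_derive_coord; exact: dG.
Qed.

Lemma scalar_primitive (I : set R) (f : R -> R) (t0 : R) :
  open_interval I -> smooth I f ->
  exists F, [/\ smooth I F, F t0 = 0 & forall t, I t -> is_derive t 1 F (f t)].
Proof.
move=> oI sf; have [F dF] : exists F, forall t, I t -> is_derive t 1 F (f t).
  by apply: primitive => // t It; exact: smooth_continuous sf It.
have dG t : I t -> is_derive t 1 (fun t => F t - F t0) (f t).
  by move=> It; have := is_derive_sub (dF t It) (is_derive_const t 1 (F t0)); move/is_derive_eq; apply; rewrite subr0.
exists (fun t => F t - F t0); split => //; last by rewrite subrr.
by apply: (smooth_antiderivative oI.1 sf) => t It; exact: dG.
Qed.

Lemma mulmx_inj_unit n (M : 'M[R]_n) : (forall u : 'rV_n, u *m M = 0 -> u = 0) ->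
  M \in unitmx.
Proof.
move=> h; rewrite -row_free_unit -kermx_eq0; apply/eqP/row_matrixP => i.
by rewrite row0; apply: h; rewrite -row_mul mulmx_ker row0.
Qed.

(** Points outside of the span are added until the rank stops growing. That
    the times lie in a segment makes the span of [v] over any larger segment
    equal to its span over I. *)
Lemma finite_spanning_times (I : set R) n (v : R -> 'rV[R]_n) (t0 : R) :
  is_interval I -> I t0 ->
  exists a b m (A : 'M[R]_(m, n)), [/\ I a, I b, a <= b,
    forall i, exists2 t, a <= t <= b & row i A = v t &
    forall t, I t -> (v t <= A)%MS].
Proof.
move=> itv I0.
suff main d k (A0 : 'M[R]_(k, n)) a0 b0 : I a0 -> I b0 -> a0 <= b0 ->
    (forall i, exists2 t, a0 <= t <= b0 & row i A0 = v t) -> (n - \rank A0 <= d)%N ->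
    exists a b m (A : 'M[R]_(m, n)), [/\ I a, I b, a <= b,
      forall i, exists2 t, a <= t <= b & row i A = v t &
      forall t, I t -> (v t <= A)%MS].
  by apply: (main n 0%N 0 t0 t0) => //; [case|rewrite leq_subr].
elim: d k A0 a0 b0 => [|d IH] k A0 a0 b0 Ia0 Ib0 ab0 hA0 hd; have [full|] := pselect (forall t, I t -> (v t <= A0)%MS).
- by exists a0, b0, k, A0.
- move=> /existsNP[t /not_implyP[It nt]]; case: nt; apply: submx_full.
  by rewrite /row_full eqn_leq rank_leq_col /= -subn_eq0 -leqn0.
- by exists a0, b0, k, A0.
move=> /existsNP[t /not_implyP[It nt]].
apply: (IH _ (col_mx A0 (v t)) (Num.min a0 t) (Num.max b0 t)).
- by case: leP.
- by case: leP.
- by rewrite le_max ge_min ab0.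
- move=> i; case: (split_ordP i) => j ->.
    have [u hu e] := hA0 j; exists u; last by rewrite rowKu.
    by move: hu => /andP[h1 h2]; rewrite ge_min h1 le_max h2.
  exists t; first by rewrite ge_min le_max lexx !orbT.
  by rewrite rowKd row_id.
have lt : (\rank A0 < \rank (col_mx A0 (v t)))%N.
  have sub : (A0 <= col_mx A0 (v t))%MS by rewrite -addsmxE addsmxSl.
  rewrite ltn_neqAle mxrankS // andbT (mxrank_leqif_sup sub) -addsmxE addsmx_sub submx_refl.
  exact/negP.
move: hd; rewrite !leq_subLR => /leq_trans; apply.
by rewrite addnS -addSn leq_add2r.
Qed.

End tools.

(** * Linear systems on a subspace *)

Section moment_equation.
Variables (R : realType) (n m : nat) (N : 'M[R]_(m, n)).
Implicit Types (u r : 'rV[R]_n).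

Lemma dot_mulmxr k l (u : 'rV[R]_k) (M : 'M[R]_(k, l)) (w : 'rV[R]_l) :
  dot (u *m M) w = dot u (w *m M^T).
Proof.
have e k' (a b : 'rV[R]_k') : dot a b = (a *m b^T) 0 0 by rewrite dot_mulmx mxE eqxx mulr1n.
by rewrite !e trmx_mul trmxK mulmxA.
Qed.

Lemma perpP u : u *m N^T = 0 <-> forall j, dot u (row j N) = 0.
Proof.
have e j : (u *m N^T) 0 j = dot u (row j N).
  by rewrite mxE; apply: eq_bigr => i _; rewrite !mxE.
split=> [h j|h]; first by rewrite -e h mxE.
by apply/rowP => j; rewrite e h mxE.
Qed.

(** The vectors u with u *m N^T = 0 form a subspace, the orthogonal complement of
    the rows of [N]; when r and the rows of M belong to it, u *m M = r is to be
    solved inside it, where M may be nondegenerate although it is singular.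
    The summand N^T *m N acts on the complement and is 0 on the solution. *)
Lemma solve_perp (M : 'M[R]_n) r : M *m N^T = 0 -> r *m N^T = 0 ->
  M + N^T *m N \in unitmx ->
  let u := r *m invmx (M + N^T *m N) in u *m N^T = 0 /\ u *m M = r.
Proof.
move=> MN rN uM u.
have e : u *m M + u *m N^T *m N = r by rewrite -mulmxA -mulmxDr mulmxKV.
set z := u *m N^T in e *.
have zNN : z *m N *m N^T = 0.
  by have := congr1 (mulmx^~ N^T) e; rewrite mulmxDl -(mulmxA u) MN mulmx0 add0r rN.
have zN : z *m N = 0.
  by apply/eqP; rewrite -dot_eq0 dot_mulmxr zNN dot0r.
have z0 : z = 0.
  by apply/eqP; rewrite -dot_eq0 {1}/z dot_mulmxr trmxK zN dot0r.
by split=> //; move: e; rewrite z0 mul0mx addr0.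
Qed.

End moment_equation.

Section perp_calculus.
Variables (R : realType) (n m : nat) (N : 'M[R]_(m, n)) (I : set R).
Hypothesis oI : open_interval I.

Lemma perp_primitive (f F : R -> 'rV[R]_n) t0 : I t0 -> F t0 = 0 ->
  (forall t, I t -> is_derive t 1 F (f t)) -> (forall t, I t -> f t *m N^T = 0) ->
  forall t, I t -> F t *m N^T = 0.
Proof.
move=> I0 F0 dF fN t It; apply/perpP => j.
have -> : dot (F t) (row j N) = dot (F t0) (row j N).
  apply: (constant_on_interval oI.2 (f := fun t => dot (F t) (row j N))) => // u Iu.
  have := is_derive_dot (dF u Iu) (is_derive_const u 1 (row j N)); move/is_derive_eq; apply.
  by rewrite dot0r addr0; exact: (perpP N _).1 (fN u Iu) j.
by rewrite F0 dot0l.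
Qed.

Lemma perp_derive (f : R -> 'rV[R]_n) df t : I t -> is_derive t 1 f df ->
  (forall t, I t -> f t *m N^T = 0) -> df *m N^T = 0.
Proof.
move=> It hf fN; apply/perpP => j.
have h1 := is_derive_dot hf (is_derive_const t 1 (row j N)).
have h2 : is_derive t 1 (fun u => dot (f u) (row j N)) 0.
  apply: (@is_derive_near R R t 1 R (fun=> 0)).
  apply: filterS (open_nbhs_nbhs (conj oI.1 It)) => u Iu.
  by apply/esym; exact: (perpP N _).1 (fN u Iu) j.
by have [_ e1] := h1; have [_] := h2; rewrite e1 dot0r addr0.
Qed.

End perp_calculus.

Lemma zero_of_null_integral (R : realType) (H h : R -> R) (t0 t1 : R) :
  (forall t, t0 <= t <= t1 -> is_derive t 1 H (h t)) ->
  (forall t, t0 < t < t1 -> 0 <= h t) -> H t1 = H t0 ->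
  forall t, t0 < t < t1 -> h t = 0.
Proof.
move=> dH h0 H10 t ht.
have mono a b : t0 <= a -> a <= b -> b <= t1 -> H a <= H b.
  move=> ta ab bt.
  have d u : a <= u <= b -> is_derive u 1 (fun u => - H u) (- h u).
    by move=> hu; apply: is_derive_opp; apply: dH; lra.
  have := increment_le (M := 0) ab d; rewrite mul0r => hh.
  suff : - H b - - H a <= 0 by lra.
  by apply: hh => u hu; rewrite oppr_le0 h0 //; lra.
have near_t : \near t, H t0 = H t.
  near=> u.
  have h1 : t0 < u by near: u; apply: lt_nbhsr; lra.
  have h2 : u < t1 by near: u; apply: lt_nbhsl; lra.
  by apply/eqP; rewrite eq_le; apply/andP; split; [|rewrite -H10]; apply: mono; lra.
have d0 : is_derive t 1 H 0 by apply: (@is_derive_near R R t 1 R (fun=> H t0)).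
by have [_ e1] := dH t ltac:(lra); have [_] := d0; rewrite e1.
Unshelve. all: by end_near. Qed.

(** * Variations with fixed end placements *)

Section projections.
Variables (R : realType) (U : set (R * R)).

Lemma smooth_fst : smooth U (fun p => p.1).
Proof.
have lin : linear (fst : R * R -> R) by [].
pose fM := GRing.isLinear.Build R (R * R)%type R _ (fst : R * R -> R) lin.
pose f : {linear (R * R)%type -> R} := HB.pack (fst : R * R -> R) fM.
by apply: (smooth_linear U (f := f)) => p; exact: cvg_fst.
Qed.

Lemma smooth_snd : smooth U (fun p => p.2).
Proof.
have lin : linear (snd : R * R -> R) by [].
pose fM := GRing.isLinear.Build R (R * R)%type R _ (snd : R * R -> R) lin.
pose f : {linear (R * R)%type -> R} := HB.pack (snd : R * R -> R) fM.
by apply: (smooth_linear U (f := f)) => p; exact: cvg_snd.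
Qed.

End projections.

Lemma unit_tilt (R : realType) n (a b : 'rV[R]_n) (r s : R) : dot a a = 1 -> dot a b = 0 ->
  0 < r -> r ^+ 2 = 1 + s ^+ 2 * dot b b ->
  dot (r^-1 *: (a + s *: b)) (r^-1 *: (a + s *: b)) = 1.
Proof.
move=> aa ab r0 r2; rewrite dotZl dotZr.
have -> : dot (a + s *: b) (a + s *: b) = r ^+ 2.
  by rewrite r2 !dotE (dotC b a) aa ab; ring.
by field; rewrite gt_eqF.
Qed.

Section constrained_variations.
Variables (R : realType) (n : nat) (I : set R) (x y : R -> 'rV[R]_n).
Hypotheses (oI : open_interval I) (bp : bicycle_path I x y) (us : unit_speed I x).
Let v t := x t - y t.
Let c := back_speed x y.
Let v' := frame_velocity x y.

Variables (t0 t1 : R) (m : nat) (N : 'M[R]_(m, n)).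
Hypotheses (I0 : I t0) (I1 : I t1) (t01 : t0 < t1).
Hypothesis frame_perp : forall t, I t -> v t *m N^T = 0.
Hypothesis frame_spans : forall u : 'rV[R]_n, u *m N^T = 0 ->
  (forall t, t0 < t < t1 -> dot u (v t) = 0) -> u = 0.

Hypothesis sv : smooth I v.

Let IJ u : t0 <= u <= t1 -> I u. Proof. exact: oI.2. Qed.

Section moments.
Variables (f : R -> 'rV[R]_n).
Hypothesis sf : smooth I f.

Lemma moment_ex i : exists F : R -> 'rV[R]_n, [/\ smooth I F, F t0 = 0 &
  forall t, I t -> is_derive t 1 F (v t 0 i *: f t)].
Proof.
apply: vector_primitive => //; apply: smoothZ => //; first exact: oI.1.
by apply: smooth_coord => //; exact: oI.1.
Qed.

Definition moment (i : 'I_n) : R -> 'rV[R]_n := sval (cid (moment_ex i)).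

Lemma momentP i : [/\ smooth I (moment i), moment i t0 = 0 &
  forall t, I t -> is_derive t 1 (moment i) (v t 0 i *: f t)].
Proof. exact: (svalP (cid (moment_ex i))). Qed.

Definition moment_matrix : 'M[R]_n := \matrix_(i, j) moment i t1 0 j.

Lemma mul_moment_matrix (u : 'rV[R]_n) : u *m moment_matrix = \sum_i u 0 i *: moment i t1.
Proof.
rewrite mulmx_sum_row; apply: eq_bigr => i _; congr (_ *: _).
by apply/rowP => j; rewrite !mxE.
Qed.

Lemma moment_matrix_perp : (forall t, I t -> f t *m N^T = 0) -> moment_matrix *m N^T = 0.
Proof.
move=> fN; apply/row_matrixP => i; rewrite row_mul row0.
have -> : row i moment_matrix = moment i t1 by apply/rowP => j; rewrite !mxE.
have [_ m0 dm] := momentP i.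
apply: (perp_primitive oI I0 m0 dm) => // t It.
by rewrite -scalemxAl fN // scaler0.
Qed.

Lemma moment_sum_derive (u : 'rV[R]_n) t : I t ->
  is_derive t 1 (fun t => \sum_i u 0 i *: moment i t) (dot u (v t) *: f t).
Proof.
move=> It.
have h i : is_derive t 1 (fun t => u 0 i *: moment i t) (u 0 i *: (v t 0 i *: f t)).
  have [_ _ dm] := momentP i.
  have := is_derive_scale (is_derive_const t 1 (u 0 i)) (dm t It).
  by move/is_derive_eq; apply; rewrite scale0r add0r.
apply: is_derive_eq (is_derive_bigsum h) _.
by rewrite /dot scaler_suml; apply: eq_bigr => i _; rewrite scalerA.
Qed.

End moments.

(** u . G u is the integral of (u . v)^2 for the Gram matrix G of the components
    of [v] in L^2(t0, t1), and u . (N^T *m N) u = |N u|^2; when both vanish, u is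
    in the span of [v] and orthogonal to it. *)
Lemma gram_unit : moment_matrix sv + N^T *m N \in unitmx.
Proof.
apply: mulmx_inj_unit => u hu.
pose H t := dot (\sum_i u 0 i *: moment sv i t) u.
have dH t : I t -> is_derive t 1 H (dot u (v t) ^+ 2).
  move=> It; have := is_derive_dot (moment_sum_derive sv u It) (is_derive_const t 1 u).
  by move/is_derive_eq; apply; rewrite dot0r addr0 dotZl (dotC (v t)) expr2.
have H0 : H t0 = 0.
  rewrite /H big1 ?dot0l // => i _; have [_ -> _] := momentP sv i.
  by rewrite scaler0.
have sum0 : H t1 + dot (u *m N^T) (u *m N^T) = 0.
  rewrite /H -mul_moment_matrix (dot_mulmxr u N^T) trmxK.
  have -> : dot u (u *m N^T *m N) = dot (u *m (N^T *m N)) u by rewrite mulmxA dotC.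
  by rewrite -dotDl -mulmxDr hu dot0l.
have H1ge : 0 <= H t1.
  have := @increment_le R (fun t => - H t) (fun t => - dot u (v t) ^+ 2) t0 t1 0 (ltW t01)
    (fun t ht => is_derive_opp (dH t (IJ ht))).
  rewrite H0 mul0r oppr0 subr0 oppr_le0; apply=> t _.
  by rewrite oppr_le0 sqr_ge0.
have := dot_ge0 (u *m N^T) => N0.
have uN : u *m N^T = 0 by apply/eqP; rewrite -dot_eq0; apply/eqP; lra.
apply: frame_spans => // t ht.
have := zero_of_null_integral (fun t ht => dH t (IJ ht)) (fun t _ => sqr_ge0 _) _ ht.
rewrite H0; have -> : H t1 = 0 by lra.
by move=> /(_ erefl)/eqP; rewrite sqrf_eq0 => /eqP.
Qed.

Section construction.
Variables (g : R -> R) (w : R -> 'rV[R]_n).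
Hypotheses (sg : smooth I g) (sw : smooth I w) (w0 : w t0 = 0) (w1 : w t1 = 0).
Hypothesis vw : forall t, I t -> dot (v t) (w t) = 0.
Hypothesis w_perp : forall t, I t -> w t *m N^T = 0.

Let stretch (s t : R) := Num.sqrt (1 + s ^+ 2 * dot (w t) (w t)).

(** The frame direction is tilted to the unit vector along v + s w, and the
    velocity of the back wheel is c + s g + mu(s) . v times v + s w. Up to
    [mu] this is polynomial in s, so that the back track is given by integrals
    of functions of time alone, and the condition that it closes up at [t1] is
    a linear system for mu(s), with the Gram matrix of [v] at s = 0. *)
Lemma constrained_variation : exists X Y (mu : R -> 'rV[R]_n) eps M,
  [/\ 0 < eps, 0 <= M, Defs.variation t0 t1 x y X Y,
      (forall s, `|s| <= eps -> enorm (mu s) <= M) &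
      forall s t, `|s| <= eps -> t0 <= t <= t1 ->
        X s t - Y s t = (stretch s t)^-1 *: (v t + s *: w t) /\
        (t0 < t < t1 ->
          back_speed (X s) (Y s) t = stretch s t * (c t + s * g t + dot (mu s) (v t)))].
Proof.
have sc : smooth I c by exact: smooth_back_speed.
have [P1 [sP1 P10 dP1]] : exists F, [/\ smooth I F, F t0 = 0 &
    forall t, I t -> is_derive t 1 F (g t *: v t + c t *: w t)].
  by have oI1 := oI.1; apply: vector_primitive => //; apply: smoothD => //; exact: smoothZ.
have [P2 [sP2 P20 dP2]] : exists F, [/\ smooth I F, F t0 = 0 &
    forall t, I t -> is_derive t 1 F (g t *: w t)].
  by have oI1 := oI.1; apply: vector_primitive => //; exact: smoothZ.
have P1N : P1 t1 *m N^T = 0.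
  apply: (perp_primitive oI I0 P10 dP1) => // t It.
  by rewrite mulmxDl -!scalemxAl frame_perp // w_perp // !scaler0 addr0.
have P2N : P2 t1 *m N^T = 0.
  apply: (perp_primitive oI I0 P20 dP2) => // t It.
  by rewrite -!scalemxAl w_perp // !scaler0.
pose G := moment_matrix sv; pose B := moment_matrix sw.
pose M s := (G + s *: B) + N^T *m N.
have sM (U : set R) : open U -> forall i j, smooth U (fun s => M s i j).
  move=> oU i j.
  rewrite (_ : (fun s => _) = fun s => G i j + s * B i j + (N^T *m N) i j); last first.
    by apply/funext => s; rewrite /M mxE [(G + _) i j]mxE [(_ *: B) i j]mxE.
  apply: smoothD => //; last exact: smooth_cst.
  apply: smoothD => //; first exact: smooth_cst.
  by apply: smoothM => //; [exact: smooth_id|exact: smooth_cst].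
have J0 : \det (M 0) != 0.
  by rewrite /M scale0r addr0 -unitfE -unitmxE gram_unit.
have sdet : smooth setT (fun s => \det (M s)).
  by apply: smooth_det => [|i j]; [exact: openT|exact/sM/openT].
have /nbhs_ballP[e0 /= e00 he0] : \forall s \near (0 : R), \det (M s) != 0.
  have c0 : {for 0, continuous (fun s => \det (M s))} by exact: (sdet 0%N).
  exact: (cvgr_neq0 _ c0 J0).
have unitM (s : R) : `|s| < e0 -> M s \in unitmx.
  move=> hs; rewrite unitmxE unitfE; apply: he0.
  by rewrite /ball /= sub0r normrN.
pose mu s := - (s *: P1 t1 + s ^+ 2 *: P2 t1) *m invmx (M s).
have close (s : R) : `|s| < e0 ->
    s *: P1 t1 + s ^+ 2 *: P2 t1 + mu s *m (G + s *: B) = 0.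
  move=> hs; have [|||_ ->] := @solve_perp R n m N (G + s *: B) (- (s *: P1 t1 + s ^+ 2 *: P2 t1)).
  - by rewrite mulmxDl -scalemxAl !moment_matrix_perp // scaler0 addr0.
  - by rewrite mulNmx mulmxDl -!scalemxAl P1N P2N !scaler0 addr0 oppr0.
  - exact: unitM.
  - by rewrite subrr.
pose V0 : set R := [set s | `|s| < e0].
have oV0 : open V0.
  rewrite (_ : V0 = ball (0 : R) e0); first exact: ball_open.
  by apply/seteqP; split=> s; rewrite /V0 /ball /= sub0r normrN.
have smu i : smooth V0 (fun s => mu s 0 i).
  rewrite (_ : (fun s => _) = fun s => \sum_j (- (s * P1 t1 0 j + s * s * P2 t1 0 j)) * invmx (M s) j i).
    apply: smooth_sum => // j; apply: smoothM => //.
      apply: smoothNr => //; apply: smoothD => //; apply: smoothM => //; try exact: smooth_id; try exact: smooth_cst.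
      by apply: smoothM => //; exact: smooth_id.
    by apply: smooth_invmx => // k l; exact: sM.
  by apply/funext => s; rewrite mxE; apply: eq_bigr => j _; rewrite !mxE -expr2.
have [al [be [alt tbe Ial Ibe hab]]] := open_interval_nbhs_pair oI I0 I1.
move: alt tbe; rewrite lt_min gt_max => /andP[al0 al1] /andP[be0 be1].
pose eps := Num.min e0 (Num.min (t0 - al) (be - t1)).
have eps0 : 0 < eps by rewrite !lt_min e00 !subr_gt0 al0 be1.
have epsI (s t : R) : `|s| < eps -> t0 - eps < t < t1 + eps -> `|s| < e0 /\ I t.
  rewrite !lt_min => /and3P[h _ _] /andP[h1 h2]; split=> //; apply: hab.
  have k1 : eps <= t0 - al by rewrite !ge_min lexx orbT.
  have k2 : eps <= be - t1 by rewrite !ge_min lexx !orbT.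
  by apply/andP; split; lra.
pose Y s t := y t + s *: P1 t + s ^+ 2 *: P2 t
  + (\sum_i mu s 0 i *: moment sv i t + s *: \sum_i mu s 0 i *: moment sw i t).
pose X s t := Y s t + (stretch s t)^-1 *: (v t + s *: w t).
have mu0 : mu 0 = 0 by rewrite /mu scale0r expr0n /= scale0r addr0 oppr0 mul0mx.
have Y0 t : Y 0 t = y t.
  by rewrite /Y mu0 !scale0r expr0n /= scale0r !addr0 big1 ?addr0 // => i _; rewrite mxE scale0r.
have str0 t : stretch 0 t = 1 by rewrite /stretch expr0n /= mul0r addr0 sqrtr1.
have X0 t : X 0 t = x t.
  by rewrite /X Y0 str0 invr1 scale1r scale0r addr0 /v addrC subrK.
have strsq s t : stretch s t ^+ 2 = 1 + s ^+ 2 * dot (w t) (w t).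
  by rewrite /stretch sqr_sqrtr // addr_ge0 // mulr_ge0 ?sqr_ge0 ?dot_ge0.
have strpos s t : 0 < stretch s t.
  by rewrite /stretch sqrtr_gt0 ltr_pwDl // mulr_ge0 ?sqr_ge0 ?dot_ge0.
have XY s t : X s t - Y s t = (stretch s t)^-1 *: (v t + s *: w t) by rewrite /X addrC addKr.
have unit_XY s t : I t -> dot (X s t - Y s t) (X s t - Y s t) = 1.
  by move=> It; rewrite XY (unit_tilt (frame_unit oI bp It) (vw It) (strpos s t) (strsq s t)).
have dY s t : I t -> is_derive t 1 (Y s)
    ((c t + s * g t + dot (mu s) (v t)) *: (v t + s *: w t)).
  move=> It.
  have h1 := is_derive_scale (is_derive_const t 1 s) (dP1 t It).
  have h2 := is_derive_scale (is_derive_const t 1 (s ^+ 2)) (dP2 t It).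
  have h3 := moment_sum_derive sv (mu s) It.
  have h4 := is_derive_scale (is_derive_const t 1 s) (moment_sum_derive sw (mu s) It).
  apply: is_derive_eq (is_derive_add (is_derive_add (is_derive_add (back_derive oI bp It) h1) h2) (is_derive_add h3 h4)) _.
  rewrite -/(c t) -[x t - y t]/(v t).
  move: (v t) (w t) (P1 t) (P2 t) (dot (mu s) (v t)) (\sum_i mu s 0 i *: moment sw i t) => a b p1 p2 d S.
  by apply/rowP => i; rewrite !mxE; ring.
exists X, Y, mu.
have [Mmu Mmu0 hMmu] : exists2 K, 0 <= K & forall s, - (e0 / 2) <= s <= e0 / 2 ->
    `|dot (mu s) (mu s)| <= K.
  apply: bounded_on_segment => s hs.
  have Vs : V0 s by rewrite /V0 /= ltr_norml; lra.
  have sdot : smooth V0 (fun s => dot (mu s) (mu s)).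
    by apply: smooth_sum => // i; exact: smoothM.
  exact: sdot 0%N s Vs.
pose U : set (R * R) := [set p | `|p.1| < eps /\ t0 - eps < p.2 < t1 + eps].
have oU : open U by exact: strip_open.
have UV p : U p -> V0 p.1 by case=> h1 h2; have [] := epsI p.1 p.2 h1 h2.
have UI p : U p -> I p.2 by case=> h1 h2; have [] := epsI p.1 p.2 h1 h2.
have s1 : smooth U (fun p => p.1) by exact: smooth_fst.
have f1 (f : R -> R) : smooth V0 f -> smooth U (fun p => f p.1).
  by move=> sf; exact: (smooth_comp oU UV s1 sf).
have f2 (f : R -> R) : smooth I f -> smooth U (fun p => f p.2).
  by move=> sf; apply: (smooth_comp oU UI _ sf); exact: smooth_snd.
have f2v k (f : R -> 'rV[R]_k) : smooth I f -> smooth U (fun p => f p.2).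
  move=> sf; apply: smooth_row => // i; apply: (f2 (fun t => f t 0 i)).
  by apply: smooth_coord => //; exact: oI.1.
have s1q : smooth U (fun p => p.1 ^+ 2) by exact: smoothM.
have smoment (f : R -> 'rV[R]_n) (sf : smooth I f) :
    smooth U (fun p => \sum_i mu p.1 0 i *: moment sf i p.2).
  apply: smooth_sum => // i; apply: smoothZ => //; first exact: (f1 (fun s => mu s 0 i)).
  by apply: f2v; have [] := momentP sf i.
have sY : smooth U (fun p => Y p.1 p.2).
  have sy : smooth I y by case: bp.
  apply: smoothD => //; last by apply: smoothD => //; exact: smoothZ.
  apply: smoothD => //; last by apply: smoothZ => //; exact: f2v.
  by apply: smoothD => //; [exact: f2v|apply: smoothZ => //; exact: f2v].
have sX : smooth U (fun p => X p.1 p.2).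
  apply: smoothD => //; apply: smoothZ => //.
    apply: smoothV => // [p _|]; first by rewrite gt_eqF.
    apply: smooth_sqrt => // [p _|]; first by rewrite ltr_pwDl // mulr_ge0 ?sqr_ge0 ?dot_ge0.
    apply: smoothD => //; first exact: smooth_cst.
    by apply: smoothM => //; apply: (f2 (fun t => dot (w t) (w t))); apply: smooth_dot => //; exact: oI.1.
  by apply: smoothD => //; [exact: f2v|apply: smoothZ => //; exact: f2v].
have moment0 (f : R -> 'rV[R]_n) (sf : smooth I f) s : \sum_i mu s 0 i *: moment sf i t0 = 0.
  by rewrite big1 // => i _; have [_ -> _] := momentP sf i; rewrite scaler0.
have Yt0 s : Y s t0 = y t0 by rewrite /Y P10 P20 !moment0 !scaler0 !addr0.
have Yt1 s : `|s| < e0 -> Y s t1 = y t1.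
  move=> /close e; rewrite /Y -!mul_moment_matrix -/G -/B -!addrA.
  suff -> : s *: P1 t1 + (s ^+ 2 *: P2 t1 + (mu s *m G + s *: (mu s *m B))) = 0 by rewrite addr0.
  by rewrite -e mulmxDr scalemxAr addrA.
have strend s t : w t = 0 -> stretch s t = 1.
  by move=> wt; rewrite /stretch wt dot0l mulr0 addr0 sqrtr1.
have Xend s t : w t = 0 -> Y s t = y t -> X s t = x t.
  by move=> wt Yt; rewrite /X Yt strend // wt invr1 scale1r scaler0 addr0 /v addrC subrK.
have sk s : no_skid `[t0, t1] (X s) (Y s).
  move=> t; rewrite /= in_itv /= => ht; split.
    by apply/enorm_unit; apply: unit_XY; exact: IJ.
  rewrite (is_derive_derive1 (dY s t (IJ ht))).
  exists ((c t + s * g t + dot (mu s) (v t)) * stretch s t).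
  by rewrite XY scalerA mulfK // gt_eqF.
have var : Defs.variation t0 t1 x y X Y.
  exists eps => //; split => //.
  - move=> s hs; have hs0 : `|s| < e0 by apply: lt_le_trans hs _; rewrite ge_min lexx.
    by split; [apply: Xend|exact: Yt0|apply: Xend => //; exact: Yt1|exact: Yt1].
pose eps' := Num.min (eps / 2) (e0 / 2).
exists eps', (1 + Mmu); split => //.
- by rewrite lt_min !divr_gt0.
- by rewrite addr_ge0.
- move=> s hs; have h : `|dot (mu s) (mu s)| <= Mmu.
    by apply: hMmu; rewrite -ler_norml (le_trans hs) // ge_min lexx orbT.
  have := le_trans (ler_norm _) h; rewrite -enorm_sqr.
  by have := sqr_ge0 (enorm (mu s) - 1); have := sqr_ge0 (enorm (mu s)); lra.
move=> s t hs ht; split=> // ht'.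
have hse : `|s| < eps by apply: le_lt_trans hs _; rewrite gt_min ltr_pdivrMr // ltr_pMr // ltr1n.
have Ust : U (s, t) by split=> //=; lra.
have It := IJ ht.
have near_in : \near t, (`[t0, t1] : set R) t.
  near=> u; rewrite /= in_itv /=; apply/andP; split; apply/ltW.
  - by near: u; apply: lt_nbhsr; lra.
  - by near: u; apply: lt_nbhsl; lra.
have dX : is_derive t 1 (X s) ('D_((0, 1) : R * R) (fun p => X p.1 p.2) (s, t)).
  by apply: (@slice_derive _ _ X (s, t)); exact: (sX 1%N).1.
have [u1 _ u3] := no_skid_velocities near_in (sk s) dX (dY s t It).
rewrite /back_speed (is_derive_derive1 dX).
have := congr1 (fun z => dot z (X s t - Y s t)) u3.
rewrite (dotZl (dot _ _)) u1 mulr1 => <-.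
have -> : v t + s *: w t = stretch s t *: (X s t - Y s t).
  by rewrite XY scalerA divff ?scale1r // gt_eqF.
by rewrite !dotZl u1 mulr1 mulrC.
Unshelve. all: by end_near.
Qed.

End construction.
End constrained_variations.

(** * The Euler-Lagrange equations *)

(** |a + s b| = r differs from 1 by at most s^2 |b|^2 / 2. *)
Lemma tilt_remainder (R : realType) n (e a b : 'rV[R]_n) (r s h k : R) :
  dot a a = 1 -> dot a b = 0 -> 0 < r -> r ^+ 2 = 1 + s ^+ 2 * dot b b ->
  `|h * (r * k - k) - dot e (r^-1 *: (a + s *: b) - (a + s *: b))|
    <= dot b b / 2 * (`|h * k| + enorm e) * s ^+ 2.
Proof.
move=> aa ab r0 r2.
have b0 := mulr_ge0 (sqr_ge0 s) (dot_ge0 b).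
have r1 : 0 <= r - 1 by nra.
have r3 : r - 1 <= dot b b / 2 * s ^+ 2.
  have : (r - 1) ^+ 2 >= 0 by exact: sqr_ge0.
  by nra.
have -> : h * (r * k - k) = (r - 1) * (h * k) by ring.
have nab : enorm (a + s *: b) = r.
  apply/eqP; rewrite -(@eqrXn2 _ 2) ?enorm_ge0 ?ltW // enorm_sqr r2 !dotE (dotC b a) aa ab.
  by apply/eqP; ring.
have -> : r^-1 *: (a + s *: b) - (a + s *: b) = (- (r - 1)) *: (r^-1 *: (a + s *: b)).
  rewrite scalerA -{2}[a + s *: b]scale1r -scalerBl; congr (_ *: _).
  by field; rewrite gt_eqF.
have nu : enorm (r^-1 *: (a + s *: b)) = 1.
  by rewrite enormZ nab gtr0_norm ?invr_gt0 // mulVf // gt_eqF.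
rewrite dotZr mulNr opprK -mulrDr normrM (ger0_norm r1).
have -> : dot b b / 2 * (`|h * k| + enorm e) * s ^+ 2 = (dot b b / 2 * s ^+ 2) * (`|h * k| + enorm e).
  by ring.
apply: ler_pM => //; apply: le_trans (ler_normD _ _) _; rewrite lerD2l.
by apply: le_trans (cauchy_schwarz _ _) _; rewrite nu mulr1.
Qed.

Section euler_lagrange.
Variables (R : realType) (n : nat) (I : set R) (x y : R -> 'rV[R]_n).
Hypotheses (oI : open_interval I) (geo : bicycling_geodesic I x y).
Let v t := x t - y t.
Let c := back_speed x y.
Let v' := frame_velocity x y.

Variables (t0 t1 : R) (m : nat) (N : 'M[R]_(m, n)).
Hypotheses (I0 : I t0) (I1 : I t1) (t01 : t0 < t1).
Hypothesis frame_perp : forall t, I t -> v t *m N^T = 0.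
Hypothesis frame_spans : forall u : 'rV[R]_n, u *m N^T = 0 ->
  (forall t, t0 < t < t1 -> dot u (v t) = 0) -> u = 0.

Let bp : bicycle_path I x y. Proof. by case: geo. Qed.
Let us : unit_speed I x. Proof. by case: geo. Qed.
Let IJ u : t0 <= u <= t1 -> I u. Proof. exact: oI.2. Qed.

(** The multiplier p is chosen so that p . v is the L^2 projection of the back
    speed c on the components of [v]. For the residuals g = c - p . v and
    E = v'' + c p - lambda v, the variation with w = - eta E and with back speed
    perturbed by g has first variation int g^2 + eta |E|^2, the corrections
    mu . v being orthogonal to g. So criticality for this single variation
    makes both residuals vanish. *)
Lemma euler_lagrange : exists2 p : 'rV[R]_n, p *m N^T = 0 &
  forall t, t0 < t < t1 -> c t = dot p (v t) /\
    derive1 v' t + c t *: p = dot (v t) (derive1 v' t + c t *: p) *: v t.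
Proof.
have oI1 := oI.1.
have sv : smooth I v by exact: smooth_frame.
have sc : smooth I c by exact: smooth_back_speed.
have sv' : smooth I v' by exact: smooth_frame_velocity.
have [Cv [sCv Cv0 dCv]] : exists F, [/\ smooth I F, F t0 = 0 &
    forall t, I t -> is_derive t 1 F (c t *: v t)].
  by apply: vector_primitive => //; exact: smoothZ.
have CvN : Cv t1 *m N^T = 0.
  apply: (perp_primitive oI I0 Cv0 dCv) => // t It.
  by rewrite -scalemxAl frame_perp // scaler0.
pose G := moment_matrix oI t0 t1 sv sv.
have GN : G *m N^T = 0 by exact: (moment_matrix_perp oI I0 I1 sv sv frame_perp).
have [pN pG] := solve_perp GN CvN (gram_unit oI I0 I1 t01 frame_spans sv).
set p := Cv t1 *m _ in pN pG; exists p => //.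
clearbody p.
pose g t := c t - dot p (v t).
have sg : smooth I g.
  by apply: smoothBr => //; apply: smooth_dot => //; exact: smooth_cst.
pose E' t := derive1 v' t + c t *: p.
have sE' : smooth I E'.
  apply: smoothD => //; first exact: smooth_derive1.
  by apply: smoothZ => //; exact: smooth_cst.
pose E t := E' t - dot (v t) (E' t) *: v t.
have sE : smooth I E by apply: smoothB => //; apply: smoothZ => //; exact: smooth_dot.
have vv t : I t -> dot (v t) (v t) = 1 by move=> It; exact: (frame_unit oI bp It).
have vE t : I t -> dot (v t) (E t) = 0.
  by move=> It; rewrite /E dotBr dotZr vv // mulr1 subrr.
have E'E t : I t -> dot (E' t) (E t) = dot (E t) (E t).
  by move=> It; rewrite {2}/E dotBl dotZl vE // mulr0 subr0.
(* a weight that vanishes at the end points and is positive between them *)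
pose eta (t : R) := (t - t0) * (t1 - t).
have seta : smooth I eta.
  by apply: smoothM => //; apply: smoothBr => //; try exact: smooth_id; exact: smooth_cst.
pose w t := (- eta t) *: E t.
have sw : smooth I w by apply: smoothZ => //; exact: smoothNr.
have w0 : w t0 = 0 by rewrite /w /eta subrr mul0r oppr0 scale0r.
have w1 : w t1 = 0 by rewrite /w /eta subrr mulr0 oppr0 scale0r.
have vw t : I t -> dot (v t) (w t) = 0 by move=> It; rewrite dotZr vE // mulr0.
have w_perp t : I t -> w t *m N^T = 0.
  have v'N u : I u -> v' u *m N^T = 0.
    by move=> Iu; apply: (perp_derive oI Iu (frame_derive oI bp Iu)).
  move=> It; have v''N : derive1 v' t *m N^T = 0.
    by apply: (perp_derive oI It (smooth_has_derive1 sv' It)).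
  rewrite /w /E /E' -scalemxAl mulmxBl mulmxDl -!scalemxAl pN frame_perp // v''N.
  by rewrite !scaler0 subr0 addr0 scaler0.
have [X [Y [mu [eps [Mmu [eps0 Mmu0 var hmu hXY]]]]]] :=
  constrained_variation oI bp I0 I1 t01 frame_perp frame_spans sv sg sw w0 w1 vw w_perp.
have [K [L [delta [d0 K0 L0 _ hlen]]]] := first_variation oI bp us p I0 I1 t01 var.
have [Act [_ Th0 dTh]] : exists F, [/\ smooth I F, F t0 = 0 &
    forall t, I t -> is_derive t 1 F (g t ^+ 2 + eta t * dot (E t) (E t))].
  apply: scalar_primitive => //; apply: smoothD => //; first exact: smoothM.
  by apply: smoothM => //; exact: smooth_dot.
have is_bounded (f : R -> R) : smooth I f -> exists2 M, 0 <= M & forall t, t0 <= t <= t1 -> `|f t| <= M.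
  by move=> sf; apply: bounded_on_segment => t /IJ It; exact: sf 0%N t It.
have [W W0 hW] := is_bounded _ (smooth_dot oI1 sw sw).
have [Gm Gm0 hGm] := is_bounded _ sg.
have [B B0 hB] := is_bounded _ (smooth_dot oI1 sE' sE').
pose K2 := W / 2 * (Gm * (1 + Gm + Mmu) + (1 + B)).
pose delta' := Num.min (Num.min delta eps) 1.
have d'0 : 0 < delta' by rewrite !lt_min d0 eps0 ltr01.
have key s : `|s| <= delta' ->
    `|Defs.length t0 t1 (X s) - (t1 - t0) - s * Act t1| <= (K + K2) * (t1 - t0) * s ^+ 2.
  rewrite !le_min => /andP[/andP[hs1 hs2] hs3].
  pose gg t := s * (g t ^+ 2 + eta t * dot (E t) (E t)) + g t * dot (mu s) (v t).
  pose GG t := s * Act t + dot (mu s) (Cv t - \sum_i p 0 i *: moment oI t0 sv sv i t).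
  have dGG t : t0 <= t <= t1 -> is_derive t 1 GG (gg t).
    move=> /IJ It; have h1 := is_derive_mul (is_derive_const t 1 s) (dTh t It).
    have h2 := is_derive_dot (is_derive_const t 1 (mu s)) (is_derive_sub (dCv t It) (moment_sum_derive oI t0 sv sv p It)).
    apply: is_derive_eq (is_derive_add h1 h2) _.
    by rewrite mul0r add0r dot0l add0r -scalerBl dotZr.
  have bd t : t0 < t < t1 -> `|g t * (back_speed (X s) (Y s) t - c t)
      - dot (E' t) (X s t - Y s t - v t) - gg t| <= K2 * s ^+ 2.
    move=> ht; have ht' : t0 <= t <= t1 by lra.
    have It := IJ ht'; have [e1 /(_ ht) e2] := hXY s t hs2 ht'.
    set r := Num.sqrt _ in e1 e2.
    have q0 : 0 <= s ^+ 2 * dot (w t) (w t) by rewrite mulr_ge0 ?sqr_ge0 ?dot_ge0.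
    have r0 : 0 < r by rewrite sqrtr_gt0 ltr_pwDl.
    have r2 : r ^+ 2 = 1 + s ^+ 2 * dot (w t) (w t) by rewrite sqr_sqrtr // addr_ge0.
    pose k := c t + s * g t + dot (mu s) (v t).
    have := tilt_remainder (E' t) (g t) k (vv t It) (vw t It) r0 r2.
    have -> : g t * (back_speed (X s) (Y s) t - c t) - dot (E' t) (X s t - Y s t - v t) - gg t
      = g t * (r * k - k) - dot (E' t) (r^-1 *: (v t + s *: w t) - (v t + s *: w t)).
      rewrite e1 e2 -/k /gg.
      have -> : r^-1 *: (v t + s *: w t) - v t =
        (r^-1 *: (v t + s *: w t) - (v t + s *: w t)) + s *: w t.
        by move: (v t) (w t) => a b; rewrite opprD addrA addrNK.
      rewrite dotDr (dotZr s) [dot (E' t) (w t)]dotZr E'E // /k.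
      ring.
    move=> /le_trans; apply; rewrite ler_wpM2r ?sqr_ge0 // /K2.
    have b1 : dot (w t) (w t) <= W by apply: le_trans (ler_norm _) (hW t ht').
    have b2 : enorm (E' t) <= 1 + B.
      have := le_trans (ler_norm _) (hB t ht'); rewrite -enorm_sqr.
      by have := sqr_ge0 (enorm (E' t) - 1); have := sqr_ge0 (enorm (E' t)); lra.
    have b3 : `|g t * k| <= Gm * (1 + Gm + Mmu).
      rewrite normrM; apply: ler_pM => //; first exact: hGm.
      have c1 : `|c t| <= 1.
        rewrite -(@ler_sqr _ `|c t|) ?nnegrE // real_normK ?num_real // expr1n.
        by have := frame_speed oI bp us It; have := dot_ge0 (frame_velocity x y t); rewrite -/c; lra.
      have b4 : `|s * g t| <= Gm.
        by rewrite normrM -[leRHS]mul1r; apply: ler_pM => //; exact: hGm.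
      have b5 : `|dot (mu s) (v t)| <= Mmu.
        apply: le_trans (cauchy_schwarz _ _) _.
        by have -> : enorm (v t) = 1 by [apply/enorm_unit/vv]; rewrite mulr1; exact: hmu.
      rewrite /k; apply: le_trans (ler_normD _ _) _; apply: lerD => //.
      by apply: le_trans (ler_normD _ _) _; apply: lerD.
    apply: ler_pM.
    - by rewrite divr_ge0 // dot_ge0.
    - by rewrite addr_ge0 // enorm_ge0.
    - by rewrite ler_wpM2r // invr_ge0.
    - exact: lerD.
  have := hlen s hs1 gg GG _ dGG bd.
  have -> : GG t1 - GG t0 = s * Act t1.
    rewrite /GG Th0 Cv0 -mul_moment_matrix -/G pG subrr.
    have -> : \sum_i p 0 i *: moment oI t0 sv sv i t0 = 0.
      by rewrite big1 // => i _; have [_ -> _] := momentP oI t0 sv sv i; rewrite scaler0.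
    by rewrite subr0 !dot0r mulr0 !addr0 subr0.
  by move=> /le_trans; apply; rewrite le_eqVlt; apply/orP; left; apply/eqP; ring.
have len0 : Defs.length t0 t1 (X 0) = t1 - t0.
  have := key 0 ltac:(by rewrite normr0 ltW); rewrite expr0n /= mulr0 mul0r subr0 normr_le0.
  by rewrite subr_eq0 => /eqP.
have der : is_derive (0 : R) 1 (fun s => Defs.length t0 t1 (X s)) (Act t1).
  by apply: (is_derive_of_quadratic d'0) => s hs; rewrite len0; exact: key.
have Th1 : Act t1 = 0.
  have [_ _ crit] := geo; have [_ e1] := crit t0 t1 I0 I1 t01 X Y var.
  by have [_] := der; rewrite e1.
move=> t ht; have It : I t by apply: IJ; lra.
have etapos : 0 < eta t by rewrite mulr_gt0 // subr_gt0; lra.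
have := zero_of_null_integral (fun t ht => dTh t (IJ ht)) _ _ ht.
rewrite Th0 Th1 => /(_ _ erefl) z.
have {}z : g t ^+ 2 + eta t * dot (E t) (E t) = 0.
  apply: z => u hu; rewrite addr_ge0 ?sqr_ge0 // mulr_ge0 ?dot_ge0 //.
  by rewrite mulr_ge0 // subr_ge0; lra.
have z1 : eta t * dot (E t) (E t) >= 0 by rewrite mulr_ge0 ?dot_ge0 // ltW.
have z2 := sqr_ge0 (g t).
have /eqP : g t ^+ 2 = 0 by lra.
rewrite sqrf_eq0 subr_eq0 => /eqP gt0; split=> //.
have /eqP : eta t * dot (E t) (E t) = 0 by lra.
rewrite mulf_eq0 gt_eqF //= dot_eq0 subr_eq0 => /eqP.
by [].
Qed.

End euler_lagrange.

(** * The momentum equation of bicycling geodesics *)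

Section momentum.
Variables (R : realType) (n : nat) (I : set R) (x y : R -> 'rV[R]_n).

(** The normal extremals of the length of the front track. [p] is the Lagrange
    multiplier of the displacement of the back wheel. In terms of the frame
    direction v the second equation is v'' = - c p + (2 c^2 - 1) v. *)
Definition momentum_equation (p : 'rV[R]_n) : Prop := forall t, I t ->
  dot p (x t - y t) = back_speed x y t /\
  derive1 (derive1 x) t = (dot p (derive1 x t) - 1) *: (x t - y t)
    + back_speed x y t *: (derive1 x t - p).

Hypotheses (oI : open_interval I) (bp : bicycle_path I x y) (us : unit_speed I x).
Let v t := x t - y t.
Let c := back_speed x y.
Let v' := frame_velocity x y.
Let T := derive1 x.

Lemma front_velocity_derive t : I t -> is_derive t 1 T (derive1 T t).
Proof. by move=> It; apply: (smooth_has_derive1 _ It); exact: smooth_front_velocity bp. Qed.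

Lemma front_acceleration_orth t : I t -> dot (T t) (derive1 T t) = 0.
Proof.
move=> It; have d1 := is_derive_dot (front_velocity_derive It) (front_velocity_derive It).
have d2 : is_derive t 1 (fun u => dot (T u) (T u)) 0.
  apply: (@is_derive_near R R t 1 R (fun=> 1)).
  by apply: filterS (interval_near oI It) => u Iu; rewrite (front_unit us Iu).
have [_ e1] := d1; have [_] := d2; rewrite e1 (dotC (derive1 T t)) => h.
lra.
Qed.

Lemma dot_frame_velocity u t : dot u (v' t) = dot u (T t) - c t * dot u (v t).
Proof. by rewrite /v' /frame_velocity dotBr dotZr. Qed.

Section with_momentum.
Variable p : 'rV[R]_n.
Hypothesis pv : forall t, I t -> c t = dot p (v t).

Lemma back_speed_derive t : I t -> is_derive t 1 c (dot p (v' t)).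
Proof.
move=> It; apply: (@is_derive_near R R t 1 R (fun u => dot p (v u))).
  by apply: filterS (interval_near oI It) => u Iu; rewrite pv.
have := is_derive_dot (is_derive_const t 1 p) (frame_derive oI bp It).
by move/is_derive_eq; apply; rewrite dot0l add0r.
Qed.

Lemma frame_acceleration t : I t -> derive1 v' t + c t *: p =
  (derive1 T t - ((dot p (T t) - 1) *: v t + c t *: (T t - p))) + (2 * c t ^+ 2 - 1) *: v t.
Proof.
move=> It; have := is_derive_sub (front_velocity_derive It)
  (is_derive_scale (back_speed_derive It) (frame_derive oI bp It)).
move/is_derive_derive1; rewrite -[derive1 _ t]/(derive1 v' t) => ->.
have e : dot p (v' t) = dot p (T t) - c t ^+ 2.
  by rewrite dot_frame_velocity -pv // expr2.
rewrite -[frame_velocity x y t]/(v' t) e /v' /frame_velocity -[x t - y t]/(v t) -/c -/T.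
by move: (T t) (v t) (c t) (derive1 T t) (dot p _) => a b k d h; apply/rowP => i; rewrite !mxE; ring.
Qed.

Lemma front_acceleration_along_frame t : I t -> dot (derive1 T t) (v t) = dot p (T t) - 1.
Proof.
move=> It; have d1 := is_derive_dot (front_velocity_derive It) (frame_derive oI bp It).
have [_ e1] := back_speed_derive It; have [_ e2] := d1.
have e3 : dot (derive1 T t) (v t) + dot (T t) (v' t) = dot p (v' t) by rewrite -e1 -e2.
rewrite !dot_frame_velocity -pv // (front_unit us It) in e3.
have e4 : dot (T t) (v t) = c t by [].
by move: e3; rewrite e4; lra.
Qed.

End with_momentum.

(** The component of the second equation along v holds automatically, by
    differentiating x' . v = p . v. *)
Lemma momentum_of_euler_lagrange p : (forall t, I t -> c t = dot p (v t) /\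
    derive1 v' t + c t *: p = dot (v t) (derive1 v' t + c t *: p) *: v t) ->
  momentum_equation p.
Proof.
move=> EL; have pv t : I t -> c t = dot p (v t) by case/EL.
move=> t It; split; first by rewrite -pv.
have [_ e] := EL t It; have acc := frame_acceleration pv It.
rewrite acc in e; move: e.
set Z := (derive1 T t - _); set k := dot (v t) _ => e.
have vv := frame_unit oI bp It.
have vZ : dot (v t) Z = 0.
  have alg (a b d q : 'rV[R]_n) (h e' : R) : dot b b = 1 -> dot d b = h -> dot a b = dot q b ->
      dot b (d - (h *: b + e' *: (a - q))) = 0.
    by move=> bb db ab; rewrite !dotE bb (dotC b d) db (dotC b a) ab (dotC b q); ring.
  apply: alg => //; first exact: front_acceleration_along_frame.
  by rewrite -pv.
have eZ : Z = (k - (2 * c t ^+ 2 - 1)) *: v t by rewrite scalerBl -e addrK.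
have : Z = 0.
  move: vZ; rewrite eZ dotZr vv mulr1 => ->; by rewrite scale0r.
by move/eqP; rewrite subr_eq0 => /eqP ->.
Qed.

(** Along a solution the integrand of the first variation is a multiple of
    v . (V - v) = - |V - v|^2 / 2, hence quadratic in the parameter. *)
Lemma geodesic_of_momentum p : momentum_equation p -> bicycling_geodesic I x y.
Proof.
move=> mom; have pv t : I t -> c t = dot p (v t) by move=> /mom[-> _].
split=> // t0 t1 I0 I1 t01 X Y var.
have IJ u : t0 <= u <= t1 -> I u by exact: oI.2.
have [K [L [delta [d0 K0 L0 lip hlen]]]] := first_variation oI bp us p I0 I1 t01 var.
have [eps eps0 [_ _ sk _ _]] := var.
pose d := Num.min delta (eps / 2).
have dpos : 0 < d by rewrite lt_min d0 divr_gt0.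
have key s : `|s| <= d -> `|Defs.length t0 t1 (X s) - (t1 - t0)| <= (K + L ^+ 2 / 2) * (t1 - t0) * s ^+ 2.
  rewrite le_min => /andP[hs1 hs2].
  have hse : `|s| < eps by apply: le_lt_trans hs2 _; rewrite ltr_pdivrMr // ltr_pMr // ltr1n.
  have := hlen s hs1 (fun=> 0) (fun=> 0) (L ^+ 2 / 2 * s ^+ 2) (fun t _ => is_derive_const t 1 0).
  rewrite subr0 subr0 => h; apply: le_trans (h _) _; last by rewrite le_eqVlt; apply/orP; left; apply/eqP; ring.
  move=> t ht; have ht' : t0 <= t <= t1 by lra.
  have It := IJ t ht'; have [_ mt] := mom t It.
  rewrite -/c -[x t - y t]/(v t) -pv // subrr mul0r sub0r subr0 normrN.
  rewrite (frame_acceleration pv It) mt subrr add0r dotZl normrM.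
  have VV : dot (X s t - Y s t) (X s t - Y s t) = 1.
    by apply/enorm_unit; have [] := sk s hse t; rewrite /= ?in_itv.
  rewrite (dotBr _ _ (v t)) (dot_unit_pair (frame_unit oI bp It) VV) (frame_unit oI bp It).
  have -> : 1 - enorm (X s t - Y s t - (x t - y t)) ^+ 2 / 2 - 1 =
    - (enorm (X s t - Y s t - v t) ^+ 2 / 2) by rewrite /v; ring.
  have q0 : 0 <= enorm (X s t - Y s t - v t) ^+ 2 / 2 by rewrite divr_ge0 ?sqr_ge0.
  rewrite normrN (ger0_norm q0).
  have c1 : c t ^+ 2 <= 1.
    by have := frame_speed oI bp us It; have := dot_ge0 (frame_velocity x y t); rewrite -/c; lra.
  have c2 : `|2 * c t ^+ 2 - 1| <= 1.
    by rewrite ler_norml; have := sqr_ge0 (c t); lra.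
  apply: le_trans (_ : _ <= 1 * (L ^+ 2 / 2 * s ^+ 2)) _; last by rewrite mul1r.
  apply: ler_pM => //.
  have : enorm (X s t - Y s t - v t) ^+ 2 <= (L * `|s|) ^+ 2.
    by rewrite ler_sqr ?nnegrE ?enorm_ge0 ?mulr_ge0 //; exact: lip.
  by rewrite exprMn real_normK ?num_real //; lra.
have len0 : Defs.length t0 t1 (X 0) = t1 - t0.
  have := key 0 ltac:(by rewrite normr0 ltW); rewrite expr0n /= mulr0 normr_le0.
  by rewrite subr_eq0 => /eqP.
by apply: (is_derive_of_quadratic dpos) => s hs; rewrite len0 mulr0 subr0; exact: key.
Qed.

End momentum.

Section geodesics.
Variables (R : realType) (n : nat) (I : set R) (x y : R -> 'rV[R]_n).
Hypothesis oI : open_interval I.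

(** On a segment that contains spanning times, the multiplier is determined by
    the values of p . v = c, as it belongs to the span of v; so all these
    segments have the same one. *)
Lemma momentum_of_geodesic : bicycling_geodesic I x y -> exists p, momentum_equation I x y p.
Proof.
move=> geo; have [bp us _] := geo.
have [[ts Its]|nI] := pselect (exists t, I t); last first.
  by exists 0 => t It; case: nI; exists t.
pose v t := x t - y t.
have [a [b [k [A [Ia Ib ab rowA spanA]]]]] := finite_spanning_times v oI.2 Its.
pose N := kermx A^T.
have AN : A *m N^T = 0 by rewrite -(trmxK A) -trmx_mul mulmx_ker trmx0.
have frame_perp t : I t -> v t *m N^T = 0.
  by move=> /spanA/submxP[D ->]; rewrite -mulmxA AN mulmx0.
have spans t0 t1 : t0 < a -> b < t1 -> forall u : 'rV[R]_n, u *m N^T = 0 ->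
    (forall t, t0 < t < t1 -> dot u (v t) = 0) -> u = 0.
  move=> t0a bt1 u uN uv.
  have uA : u *m A^T = 0.
    apply/perpP => i; have [t /andP[h1 h2] ->] := rowA i; apply: uv.
    by rewrite (lt_le_trans t0a h1) (le_lt_trans h2 bt1).
  have /submxP[D eD] : (u <= N)%MS by apply/sub_kermxP.
  by apply/eqP; rewrite -dot_eq0 {1}eD dot_mulmxr uN dot0r.
have EL t0 t1 : I t0 -> I t1 -> t0 < a -> b < t1 -> exists2 p : 'rV[R]_n, p *m N^T = 0 &
  forall t, t0 < t < t1 -> back_speed x y t = dot p (v t) /\
    derive1 (frame_velocity x y) t + back_speed x y t *: p
      = dot (v t) (derive1 (frame_velocity x y) t + back_speed x y t *: p) *: v t.
  move=> I0 I1 t0a bt1; apply: (euler_lagrange oI geo I0 I1 _ frame_perp (spans t0 t1 t0a bt1)).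
  by apply: lt_trans t0a (le_lt_trans ab bt1).
have [t0 [t1 [t0m mt1 I0 I1 _]]] := open_interval_nbhs_pair oI Ia Ib.
move: t0m mt1; rewrite lt_min gt_max => /andP[t0a t0b] /andP[at1 bt1].
have [p pN hp] := EL t0 t1 I0 I1 t0a bt1.
exists p; apply: momentum_of_euler_lagrange => // t It.
have [u0 [u1 [u0m mu1 Iu0 Iu1 _]]] := open_interval_nbhs_pair oI I0 It.
have [w0 [w1 [w0m mw1 Iw0 Iw1 _]]] := open_interval_nbhs_pair oI I1 It.
move: u0m mu1 w0m mw1; rewrite !lt_min !gt_max => /andP[? ?] /andP[? ?] /andP[? ?] /andP[? ?].
have [q qN hq] := EL u0 w1 Iu0 Iw1 ltac:(lra) ltac:(lra).
have pq : p = q.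
  apply/eqP; rewrite -subr_eq0; apply/eqP; apply: (spans t0 t1 t0a bt1).
    by rewrite mulmxBl pN qN subrr.
  move=> r hr; have [e1 _] := hp r hr; have [e2 _] := hq r ltac:(lra).
  by rewrite dotBl -e1 -e2 subrr.
by rewrite pq; apply: hq; lra.
Qed.

Theorem geodesic_momentumP : bicycling_geodesic I x y <->
  [/\ bicycle_path I x y, unit_speed I x & exists p, momentum_equation I x y p].
Proof.
split=> [geo|[bp us [p mom]]]; last exact: geodesic_of_momentum mom.
by have [bp us _] := geo; split=> //; exact: momentum_of_geodesic.
Qed.

End geodesics.

(** * Geodesics lie in a 3-dimensional affine subspace *)

Section span.
Variable F : fieldType.

Lemma rank3_extension n (S : 'M[F]_(3, n)) : (3 <= n)%N ->
  exists2 W : 'M[F]_(3, n), \rank W = 3%N & (S <= W)%MS.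
Proof.
move=> n3; exists (pid_mx 3 *m row_ebase S).
  by rewrite mxrankMfree ?row_free_unit ?row_ebase_unit // rank_pid_mx.
rewrite -{1}(mulmx_ebase S).
have -> : pid_mx (\rank S) = (pid_mx (\rank S) : 'M[F]_(3, 3)) *m (pid_mx 3 : 'M[F]_(3, n)).
  have r3 := rank_leq_row S.
  by rewrite mul_pid_mx (minn_idPl r3) (minn_idPr r3).
by rewrite mulmxA -mulmxA submxMl.
Qed.

End span.

Section affine_span.
Variables (R : realType) (n : nat) (I : set R) (x y : R -> 'rV[R]_n).
Hypotheses (oI : open_interval I) (bp : bicycle_path I x y) (us : unit_speed I x).
Variable p : 'rV[R]_n.
Hypothesis mom : momentum_equation I x y p.
Let v t := x t - y t.
Let T := derive1 x.
Let c := back_speed x y.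

Lemma submx_of_orth m (S : 'M[R]_(m, n)) (z : 'rV[R]_n) :
  (forall u : 'rV[R]_n, (forall i, dot u (row i S) = 0) -> dot u z = 0) -> (z <= S)%MS.
Proof.
move=> h; rewrite submxE; apply/eqP/rowP => j; rewrite [RHS]mxE.
have -> : (z *m cokermx S) 0 j = dot (row j (cokermx S)^T) z.
  by rewrite mxE; apply: eq_bigr => i _; rewrite !mxE mulrC.
apply: h => i.
have := congr1 (fun M : 'M[R]_(m, n) => M i j) (mulmx_coker S); rewrite !mxE => <-.
by apply: eq_bigr => k _; rewrite !mxE mulrC.
Qed.

(** (u . v, u . x') solves a linear system and vanishes at [t0]. *)
Lemma orth_preserved t0 (u : 'rV[R]_n) : I t0 -> dot u p = 0 -> dot u (v t0) = 0 ->
  dot u (T t0) = 0 -> forall t, I t -> dot u (v t) = 0 /\ dot u (y t - y t0) = 0.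
Proof.
move=> I0 up uv uT.
have dv t : I t -> is_derive t 1 (fun t => dot u (v t)) (dot u (T t) - c t * dot u (v t)).
  move=> It; have := is_derive_dot (is_derive_const t 1 u) (frame_derive oI bp It).
  by move/is_derive_eq; apply; rewrite dot0l add0r dot_frame_velocity.
have dT t : I t -> is_derive t 1 (fun t => dot u (T t)) ((dot p (T t) - 1) * dot u (v t) + c t * dot u (T t)).
  move=> It; have := is_derive_dot (is_derive_const t 1 u) (front_velocity_derive bp It).
  move/is_derive_eq; apply; have [_ ->] := mom It.
  by rewrite dot0l add0r dotDr !dotZr (dotBr (derive1 x t) p u) up subr0.
pose f t := dot u (v t) * dot u (v t) + dot u (T t) * dot u (T t).
have df t (It : I t) := is_derive_add (is_derive_mul (dv t It) (dv t It)) (is_derive_mul (dT t It) (dT t It)).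
have f0 : forall t, I t -> f t = 0.
  apply: (gronwall_zero (M := enorm p + 2) oI.2 I0 df) => [t _|t It|].
  - by rewrite addr_ge0 // -expr2 sqr_ge0.
  - have c1 : `|c t| <= 1.
      rewrite -(@ler_sqr _ `|c t|) ?nnegrE // real_normK ?num_real // expr1n.
      by have := frame_speed oI bp us It; have := dot_ge0 (frame_velocity x y t); rewrite -/c; lra.
    have p1 : `|dot p (T t)| <= enorm p.
      apply: le_trans (cauchy_schwarz _ _) _.
      by rewrite (us It) mulr1.
    rewrite /f; move: c1 p1; set a := dot u (v t); set b := dot u (T t); set d := dot p _; set P := enorm p.
    have -> : (b - c t * a) * a + a * (b - c t * a) + (((d - 1) * a + c t * b) * b + b * ((d - 1) * a + c t * b))
      = d * (2 * a * b) + c t * (2 * (b * b - a * a)) by ring.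
    move=> c1 p1; apply: le_trans (ler_normD _ _) _; rewrite [leRHS]mulrDl; apply: lerD.
      rewrite normrM; apply: ler_pM => //; rewrite ler_norml.
      by have := sqr_ge0 (a - b); have := sqr_ge0 (a + b); rewrite !expr2; nra.
    rewrite normrM -[leRHS]mul1r; apply: ler_pM => //; rewrite ler_norml.
    by have := sqr_ge0 a; have := sqr_ge0 b; rewrite !expr2; nra.
  - by rewrite /f uv uT !mulr0 addr0.
have v0 t : I t -> dot u (v t) = 0.
  move=> It; have := f0 t It; rewrite /f -!expr2 => /eqP.
  by rewrite paddr_eq0 ?sqr_ge0 // !sqrf_eq0 => /andP[/eqP].
move=> t It; split; first exact: v0.
have -> : dot u (y t - y t0) = dot u (y t0 - y t0); last by rewrite subrr dot0r.
apply: (constant_on_interval oI.2 (f := fun t => dot u (y t - y t0))) => // r Ir.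
have := is_derive_dot (is_derive_const r 1 u) (is_derive_sub (back_derive oI bp Ir) (is_derive_const r 1 (y t0))).
by move/is_derive_eq; apply; rewrite dot0l add0r subr0 dotZr v0 // mulr0.
Qed.

End affine_span.

Theorem geodesic_in_3space (R : realType) (n : nat) (I : set R) (x y : R -> 'rV[R]_n) :
  (3 <= n)%N -> open_interval I -> bicycling_geodesic I x y ->
  exists (o : 'rV[R]_n) (W : 'M[R]_(3, n)),
    \rank W = 3%N /\ forall t, I t -> (x t - o <= W)%MS /\ (y t - o <= W)%MS.
Proof.
move=> n3 oI /(geodesic_momentumP x y oI)[bp us [p mom]].
have [[t0 I0]|nI] := pselect (exists t, I t); last first.
  have [W W3 _] := rank3_extension (0 : 'M[R]_(3, n)) n3.
  by exists 0, W; split=> // t It; case: nI; exists t.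
pose S : 'M[R]_(3, n) := \matrix_i (if i == 0 then p else if i == 1 then x t0 - y t0 else derive1 x t0).
have [W W3 SW] := rank3_extension S n3.
exists (y t0), W; split=> // t It.
have orth u : (forall i, dot u (row i S) = 0) -> dot u (x t - y t) = 0 /\ dot u (y t - y t0) = 0.
  move=> h; apply: (orth_preserved oI bp us mom I0 _ _ _ It).
  - by have := h 0; rewrite rowK.
  - by have := h 1; rewrite rowK.
  - by have := h 2%:R; rewrite rowK.
have hy : (y t - y t0 <= S)%MS by apply: submx_of_orth => u /orth[].
have hv : (x t - y t <= S)%MS by apply: submx_of_orth => u /orth[].
split; last exact: submx_trans hy SW.
have -> : x t - y t0 = (x t - y t) + (y t - y t0) by rewrite addrA subrK.
exact: submx_trans (addmx_sub hv hy) SW.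
Qed.

(** * The front track in space as a solution of x'' = x' * K *)

Section cross_product.
Variable R : realType.
Notation vec := 'rV[R]_3.

Lemma dot3E (u v : vec) : dot u v = u 0 0 * v 0 0 + u 0 1 * v 0 1 + u 0 2%:R * v 0 2%:R.
Proof.
rewrite /dot !big_ord_recl big_ord0 addr0 addrA.
by congr (_ + _ + _); congr (_ * _); congr (_ _ _); apply/val_inj.
Qed.

Lemma cross0E (u v : vec) : cross u v 0 0 = u 0 1 * v 0 2%:R - u 0 2%:R * v 0 1.
Proof. by rewrite mxE. Qed.

Lemma cross1E (u v : vec) : cross u v 0 1 = u 0 2%:R * v 0 0 - u 0 0 * v 0 2%:R.
Proof. by rewrite mxE. Qed.

Lemma cross2E (u v : vec) : cross u v 0 2%:R = u 0 0 * v 0 1 - u 0 1 * v 0 0.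
Proof. by rewrite mxE. Qed.

Definition vec3E := (dot3E, cross0E, cross1E, cross2E).

Lemma vec3P (u v : vec) : u 0 0 = v 0 0 -> u 0 1 = v 0 1 -> u 0 2%:R = v 0 2%:R -> u = v.
Proof.
move=> h0 h1 h2; apply/rowP => i.
have [->|->|->] : [\/ i = 0, i = 1 | i = 2%:R] => //.
by case: i => -[|[|[|//]]] hi; [apply: Or31|apply: Or32|apply: Or33]; apply/val_inj.
Qed.

Lemma crossC (u v : vec) : cross u v = - cross v u.
Proof. by apply: vec3P; rewrite !vec3E !mxE /=; ring. Qed.

Lemma crossDl (u v w : vec) : cross (u + v) w = cross u w + cross v w.
Proof. by apply: vec3P; rewrite !vec3E !mxE /=; ring. Qed.

Lemma crossZl a (u v : vec) : cross (a *: u) v = a *: cross u v.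
Proof. by apply: vec3P; rewrite !vec3E !mxE /=; ring. Qed.

Lemma crossDr (u v w : vec) : cross w (u + v) = cross w u + cross w v.
Proof. by apply: vec3P; rewrite !vec3E !mxE /=; ring. Qed.

Lemma crossZr a (u v : vec) : cross v (a *: u) = a *: cross v u.
Proof. by apply: vec3P; rewrite !vec3E !mxE /=; ring. Qed.

Lemma crossNl (u v : vec) : cross (- u) v = - cross u v.
Proof. by rewrite -scaleN1r crossZl scaleN1r. Qed.

Lemma crossNr (u v : vec) : cross v (- u) = - cross v u.
Proof. by rewrite -scaleN1r crossZr scaleN1r. Qed.

Lemma crossBl (u v w : vec) : cross (u - v) w = cross u w - cross v w.
Proof. by rewrite crossDl crossNl. Qed.

Lemma crossBr (u v w : vec) : cross w (u - v) = cross w u - cross w v.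
Proof. by rewrite crossDr crossNr. Qed.

Lemma crossvv (u : vec) : cross u u = 0.
Proof. by apply: vec3P; rewrite !vec3E !mxE /=; ring. Qed.

Lemma cross0l (u : vec) : cross 0 u = 0.
Proof. by rewrite -[X in cross X](subrr u) crossBl subrr. Qed.

Lemma cross0r (u : vec) : cross u 0 = 0.
Proof. by rewrite crossC cross0l oppr0. Qed.

Definition crossE := (crossDl, crossDr, crossBl, crossBr, crossZl, crossZr, crossNl, crossNr,
  crossvv, cross0l, cross0r).

Lemma triple_r (a b c : vec) : cross a (cross b c) = dot a c *: b - dot a b *: c.
Proof. by apply: vec3P; rewrite !vec3E !mxE /= ?vec3E; ring. Qed.

Lemma triple_l (a b c : vec) : cross (cross a b) c = dot a c *: b - dot b c *: a.
Proof. by apply: vec3P; rewrite !vec3E !mxE /= ?vec3E; ring. Qed.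

Lemma dot_cross_rot (a b c : vec) : dot a (cross b c) = dot b (cross c a).
Proof. by rewrite !vec3E; ring. Qed.

Lemma dot_cross_cross (a b c d : vec) :
  dot (cross a b) (cross c d) = dot a c * dot b d - dot a d * dot b c.
Proof. by rewrite !vec3E; ring. Qed.

Lemma dot_cross1 (a b : vec) : dot a (cross a b) = 0.
Proof. by rewrite !vec3E; ring. Qed.

Lemma dot_cross2 (a b : vec) : dot b (cross a b) = 0.
Proof. by rewrite !vec3E; ring. Qed.

(** The difference has norm 0 because the square of the triple product is a Gram
    determinant. *)
Lemma orthonormal_expansion (a b z : vec) : dot a a = 1 -> dot b b = 1 -> dot a b = 0 ->
  z = dot z a *: a + dot z b *: b + dot z (cross a b) *: cross a b.
Proof.
move=> aa bb ab; apply/eqP; rewrite -subr_eq0 -dot_eq0; apply/eqP.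
have gram : dot z (cross a b) ^+ 2 = dot z z * (dot a a * dot b b - dot a b ^+ 2)
    - dot z a * (dot z a * dot b b - dot a b * dot z b)
    + dot z b * (dot z a * dot a b - dot a a * dot z b).
  by rewrite !vec3E; ring.
have nn := dot_cross_cross a b a b; rewrite aa bb ab (dotC b a) ab in nn gram.
have na := dot_cross1 a b; have nb := dot_cross2 a b.
move: (cross a b) gram nn na nb => n gram nn na nb.
rewrite !dotE aa bb ab nn (dotC b a) ab na nb (dotC n a) (dotC n b) na nb (dotC a z) (dotC b z) (dotC n z).
have -> : dot z z = dot z a ^+ 2 + dot z b ^+ 2 + dot z n ^+ 2 by rewrite gram; ring.
ring.
Qed.

End cross_product.

Lemma rod_acceleration (R : realType) (a b p : 'rV[R]_3) : dot a a = 1 ->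
  cross a (cross b p + cross a b) = (dot p a - 1) *: b + dot a b *: (a - p).
Proof.
move=> aa; rewrite crossDr !triple_r aa (dotC p a).
by apply/rowP => i; rewrite !mxE; ring.
Qed.

Section spatial.
Variables (R : realType) (I : set R) (x y : R -> 'rV[R]_3).
Hypotheses (oI : open_interval I) (bp : bicycle_path I x y) (us : unit_speed I x).
Let v t := x t - y t.
Let T := derive1 x.
Let c := back_speed x y.
Let w t := cross (T t) (v t).

Let vv t (It : I t) : dot (v t) (v t) = 1 := frame_unit oI bp It.
Let TT t (It : I t) : dot (T t) (T t) = 1 := front_unit us It.
Let Tv t : dot (T t) (v t) = c t := erefl.
Let dv t (It : I t) := frame_derive oI bp It.
Let dT t (It : I t) := front_velocity_derive bp It.

(** The angular velocity of x', up to sign: along solutions of the momentum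
    equation x'' = x' * K. Then K also equals (x - x1) * p + delta p. *)
Definition rod_field (p : 'rV[R]_3) t := cross (v t) p + w t.

Section with_momentum.
Variable p : 'rV[R]_3.
Hypothesis mom : momentum_equation I x y p.

Lemma acceleration_rod_field t : I t -> derive1 T t = cross (T t) (rod_field p t).
Proof.
by move=> It; have [_ ->] := mom It; rewrite [RHS]rod_acceleration //; exact: TT.
Qed.

Lemma rod_field_derive t : I t -> is_derive t 1 (rod_field p) (cross (T t) p).
Proof.
move=> It; have := is_derive_add (is_derive_cross (dv It) (is_derive_const t 1 p)) (is_derive_cross (dT It) (dv It)).
move/is_derive_eq; apply; have [_ ->] := mom It; rewrite /frame_velocity.
move: (dot p _ - 1) (back_speed x y t) (x t - y t) => h k a.
rewrite !crossE (crossC p a).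
by move: (cross _ _) (cross _ _) (cross _ _) => A B C; apply/rowP => i; rewrite !mxE; ring.
Qed.

Lemma axial_momentum_constant s t : I s -> I t -> dot p (w s) = dot p (w t).
Proof.
apply: (constant_on_interval oI.2 (f := fun t => dot p (w t))) => u Iu.
have := is_derive_dot (is_derive_const u 1 p) (is_derive_cross (dT Iu) (dv Iu)).
move/is_derive_eq; apply; have [_ ->] := mom Iu; rewrite /frame_velocity.
move: (dot p _ - 1) (back_speed x y u) (x u - y u) => h k a.
rewrite !crossE dot0l add0r !dotE dot_cross1.
ring.
Qed.

End with_momentum.

Section ode.
Hypothesis I0 : I 0.
Variable p : 'rV[R]_3.
Hypothesis p0 : p != 0.

Let x1 := y 0 + (enorm p ^+ 2)^-1 *: cross (w 0) p.
Let K t := cross (x t - x1) p + (dot (w 0) p / enorm p ^+ 2) *: p.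

Lemma ode_field0 : K 0 = rod_field p 0.
Proof.
rewrite /K /rod_field /x1 opprD addrA -[x 0 - y 0]/(v 0) crossBl crossZl triple_l enorm_sqr.
have pp : dot p p != 0 by rewrite dot_eq0.
move: (w 0) (cross (v 0) p) => z q.
by apply/rowP => i; rewrite !mxE; field.
Qed.

Lemma ode_field_derive t : I t -> is_derive t 1 K (cross (T t) p).
Proof.
move=> It; have := is_derive_add (is_derive_cross (is_derive_sub (front_derive bp It) (is_derive_const t 1 x1)) (is_derive_const t 1 p))
  (is_derive_const t 1 ((dot (w 0) p / enorm p ^+ 2) *: p)).
by move/is_derive_eq; apply; rewrite cross0r subr0 !addr0.
Qed.

Lemma ode_of_momentum : momentum_equation I x y p -> front_track_ode I x y p.
Proof.
move=> mom ? ? ? ? t It; rewrite -[LHS]/(derive1 T t) -[RHS]/(cross (T t) (K t)).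
suff -> : K t = rod_field p t by exact: acceleration_rod_field.
apply/eqP; rewrite -subr_eq0; apply/eqP/rowP => i; rewrite [RHS]mxE.
have -> : (K t - rod_field p t) 0 i = (K 0 - rod_field p 0) 0 i.
  apply: (constant_on_interval oI.2 (f := fun t => (K t - rod_field p t) 0 i)) => // u Iu.
  have := is_derive_coord i (is_derive_sub (ode_field_derive Iu) (rod_field_derive mom Iu)).
  by rewrite subrr mxE.
by rewrite ode_field0 subrr mxE.
Qed.

(** Z = K - v * p - x' * v solves Z' = - c Z + (Z . v) x' with Z(0) = 0. Once
    Z = 0, the function x' . v - p . v is constant, and it is 0 initially. *)
Lemma momentum_of_ode : dot (x 0 - y 0) (derive1 x 0 - p) = 0 -> front_track_ode I x y p ->
  momentum_equation I x y p.
Proof.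
move=> init ode.
have ode' t : I t -> derive1 T t = cross (T t) (K t) by exact: ode.
pose Z t := K t - rod_field p t.
have dZ t : I t -> is_derive t 1 Z ((- c t) *: Z t + dot (Z t) (v t) *: T t).
  move=> It; have := is_derive_sub (ode_field_derive It)
    (is_derive_add (is_derive_cross (dv It) (is_derive_const t 1 p)) (is_derive_cross (dT It) (dv It))).
  move/is_derive_eq; apply.
  rewrite ode' // /frame_velocity /Z /rod_field /w -[x t - y t]/(v t) -/(c t) -/(T t).
  rewrite !triple_l -(Tv t).
  have alg (a b k : 'rV[R]_3) : cross a p - (cross (a - dot a b *: b) p + cross b 0 +
      (dot a b *: k - dot k b *: a + cross a (a - dot a b *: b)))
    = - dot a b *: (k - (cross b p + cross a b)) + dot (k - (cross b p + cross a b)) b *: a.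
    rewrite !crossE !dotBl !dotDl (dotC (cross b p)) dot_cross1 (dotC (cross a b)) dot_cross2.
    move: (cross a p) (cross b p) (cross a b) => A B C.
    by apply/rowP => i; rewrite !mxE; ring.
  exact: alg.
have ZZ : forall t, I t -> dot (Z t) (Z t) = 0.
  apply: (gronwall_zero (f := fun t => dot (Z t) (Z t)) (M := 4) oI.2 I0 (fun u Iu => is_derive_dot (dZ u Iu) (dZ u Iu))) => // [u _|u Iu|].
  - exact: dot_ge0.
  - have c1 : `|c u| <= 1.
      rewrite -(@ler_sqr _ `|c u|) ?nnegrE // real_normK ?num_real // expr1n.
      by have := frame_speed oI bp us Iu; have := dot_ge0 (frame_velocity x y u); rewrite -/c; lra.
    have alg (z a b : 'rV[R]_3) (k : R) : `|k| <= 1 -> enorm a = 1 -> enorm b = 1 ->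
       `|dot (- k *: z + dot z b *: a) z + dot z (- k *: z + dot z b *: a)| <= 4 * dot z z.
      move=> k1 na nb.
      have h1 := cauchy_schwarz z b; have h2 := cauchy_schwarz z a.
      rewrite na mulr1 in h2; rewrite nb mulr1 in h1.
      have -> : dot (- k *: z + dot z b *: a) z + dot z (- k *: z + dot z b *: a) =
         2 * (- k * dot z z + dot z b * dot z a) by rewrite !dotE (dotC a z); ring.
      rewrite normrM ger0_norm //; have -> : 4 * dot z z = 2 * (dot z z + dot z z) by ring.
      rewrite ler_wpM2l //; apply: le_trans (ler_normD _ _) _; apply: lerD.
        rewrite normrM normrN (ger0_norm (dot_ge0 z)) -[leRHS]mul1r.
        by rewrite ler_wpM2r // dot_ge0.
      by rewrite normrM -enorm_sqr expr2; apply: ler_pM.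
    by apply: alg => //; [exact: us|apply/enorm_unit; exact: vv].
  - by rewrite /Z ode_field0 subrr dot0l.
have Z0 t : I t -> Z t = 0 by move=> /ZZ/eqP; rewrite dot_eq0 => /eqP.
have KE t : I t -> derive1 T t = (dot p (T t) - 1) *: v t + c t *: (T t - p).
  move=> It; rewrite ode' //.
  have -> : K t = rod_field p t by apply/eqP; rewrite -subr_eq0; apply/eqP/(Z0 t It).
  by rewrite [LHS]rod_acceleration //; exact: TT.
have ce t : I t -> c t - dot p (v t) = 0.
  move=> It; have -> : c t - dot p (v t) = c 0 - dot p (v 0).
    apply: (constant_on_interval oI.2 (f := fun t => c t - dot p (v t))) => // u Iu.
    have := is_derive_sub (is_derive_dot (dT Iu) (dv Iu)) (is_derive_dot (is_derive_const u 1 p) (dv Iu)).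
    move/is_derive_eq; apply; rewrite KE //.
    have alg (a b : 'rV[R]_3) : dot a a = 1 -> dot b b = 1 ->
      dot ((dot p a - 1) *: b + dot a b *: (a - p)) b + dot a (a - dot a b *: b)
       - (dot 0 b + dot p (a - dot a b *: b)) = 0.
      by move=> aa bb; rewrite !dotE aa bb; ring.
    exact: alg (TT Iu) (vv Iu).
  by rewrite -[RHS]init [RHS]dotBr [in RHS]dotC [in RHS](dotC _ p).
move=> t It; split; first by apply/esym/eqP; rewrite -subr_eq0; apply/eqP; exact: ce.
exact: KE.
Qed.

End ode.

(** The back wheel does not move, so c = 0, and x'' is orthogonal to x' and to the
    plane's normal, whence x'' = - v. *)
Lemma circle_momentum : unit_circle_about I x y -> momentum_equation I x y 0.
Proof.
move=> [q [n [n0 h]]].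
have c0 t : I t -> c t = 0.
  move=> It; have d0 : is_derive t 1 y 0.
    apply: (@is_derive_near R R t 1 _ (fun=> q)).
    by apply: filterS (interval_near oI It) => u Iu; have [->] := h u Iu.
  have [_ e1] := d0; have [_] := back_derive oI bp It; rewrite e1 => e.
  have := congr1 (fun z => dot z (v t)) e; rewrite dot0l dotZl (vv It) mulr1.
  by move=> e2; rewrite /c -e2.
have pv t : I t -> c t = dot 0 (v t) by move=> It; rewrite dot0l c0.
have vn t : I t -> dot (v t) n = 0 by move=> It; rewrite /v; have [-> _ ->] := h t It.
have v'T t : frame_velocity x y t = T t - c t *: v t by [].
have Tn t : I t -> dot (T t) n = 0.
  move=> It; have d1 := is_derive_dot (dv It) (is_derive_const t 1 n).
  have d2 : is_derive t 1 (fun u => dot (v u) n) 0.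
    apply: (@is_derive_near R R t 1 R (fun=> 0)).
    by apply: filterS (interval_near oI It) => u Iu; rewrite vn.
  have [_ e1] := d1; have [_] := d2; rewrite e1 dot0r addr0 v'T c0 // scale0r subr0.
  by [].
move=> t It; split; first by rewrite dot0l -/c c0.
rewrite -/c -/T -[x t - y t]/(v t) c0 // scale0r addr0 dot0l sub0r scaleN1r.
have T'n : dot (derive1 T t) n = 0.
  have d1 := is_derive_dot (dT It) (is_derive_const t 1 n).
  have d2 : is_derive t 1 (fun u => dot (T u) n) 0.
    apply: (@is_derive_near R R t 1 R (fun=> 0)).
    by apply: filterS (interval_near oI It) => u Iu; rewrite Tn.
  by have [_ e1] := d1; have [_] := d2; rewrite e1 dot0r addr0.
have T'v := front_acceleration_along_frame oI bp us pv It.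
rewrite dot0l sub0r in T'v.
have T'T := front_acceleration_orth oI bp us It.
have Tv0 : dot (v t) (T t) = 0 by rewrite dotC Tv c0.
have en := orthonormal_expansion n (vv It) (TT It) Tv0.
rewrite !(dotC n) vn // Tn // !scale0r !add0r in en.
have k0 : dot (cross (v t) (T t)) n != 0.
  by apply: contra n0 => /eqP k; rewrite en k scale0r.
rewrite [LHS](orthonormal_expansion _ (vv It) (TT It) Tv0).
rewrite [dot _ (v t)]T'v (dotC _ (T t)) T'T scale0r addr0 scaleN1r.
move: T'n; rewrite {1}en dotZr => /eqP; rewrite mulf_eq0 (negbTE k0) /= => /eqP ->.
by rewrite scale0r addr0.
Qed.

Lemma circle_of_zero_momentum t0 : I t0 -> momentum_equation I x y 0 -> unit_circle_about I x y.
Proof.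
move=> I0 mom; have c0 t : I t -> c t = 0 by move=> It; have [e _] := mom t It; rewrite /c -e dot0l.
have vT : dot (v t0) (T t0) = 0 by rewrite dotC Tv c0.
have yc t : I t -> y t = y t0.
  move=> It; apply/rowP => i.
  apply: (constant_on_interval oI.2 (f := fun t => y t 0 i)) => // u Iu.
  by have := is_derive_coord i (back_derive oI bp Iu); rewrite -/c c0 // scale0r mxE.
exists (y t0), (cross (v t0) (T t0)); split.
  by rewrite -dot_eq0 dot_cross_cross (vv I0) (TT I0) vT mul0r subr0 mulr1 oner_neq0.
move=> t It; rewrite -{2 3}(yc t It); split; first exact: yc.
  by apply/enorm_unit; exact: vv.
rewrite dotC; have [] := orth_preserved oI bp us mom I0 _ _ _ It (u := cross (v t0) (T t0)) => //.
- by rewrite dot0r.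
- by rewrite dotC dot_cross1.
- by rewrite dotC dot_cross2.
Qed.

Theorem geodesic_iff_ode : I 0 -> bicycling_geodesic I x y <->
  unit_circle_about I x y \/
  exists p : 'rV[R]_3, [/\ p != 0, dot (x 0 - y 0) (derive1 x 0 - p) = 0 & front_track_ode I x y p].
Proof.
move=> I0; split.
  move=> /(geodesic_momentumP x y oI)[_ _ [p mom]].
  have [p0|p0] := eqVneq p 0; first by left; apply: (circle_of_zero_momentum I0); rewrite -p0.
  right; exists p; split=> //; last exact: ode_of_momentum.
  have [e _] := mom 0 I0.
  by rewrite dotBr dotC -[dot _ _]/(back_speed x y 0) -e (dotC p) subrr.
move=> h; apply/(geodesic_momentumP x y oI); split=> //.
case: h => [/circle_momentum mom|[p [p0 init ode]]]; first by exists 0.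
by exists p; exact: momentum_of_ode.
Qed.

End spatial.

(** * Curvature and torsion of front tracks *)

Section frenet_equations.
Variables (R : realType) (I : set R) (x : R -> 'rV[R]_3) (k tau : R -> R).
Hypotheses (oI : open_interval I) (fr : frenet I x k tau).
Let T := derive1 x.

Lemma frenet_frame : exists N B : R -> 'rV[R]_3, [/\ smooth I N, smooth I B &
  forall t, I t ->
    [/\ [/\ dot (T t) (T t) = 1, dot (N t) (N t) = 1 & dot (T t) (N t) = 0],
        B t = cross (T t) (N t),
        is_derive t 1 T (k t *: N t),
        is_derive t 1 N (- k t *: T t + tau t *: B t) &
        is_derive t 1 B (- tau t *: N t)]].
Proof.
have [Tf [N [B [[sT sN sB] _ _ h]]]] := fr; exists N, B; split=> // t It.
have [[/enorm_unit T1 /enorm_unit N1 TN] eB eT eT' [eN' eB']] := h t It.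
rewrite -/(T t) in eT; split; rewrite ?eT //.
- apply: (@is_derive_near _ _ _ _ _ Tf).
    by apply: filterS (interval_near oI It) => u Iu; have [_ _ e _ _] := h u Iu; rewrite /T e.
  by rewrite -eT'; exact: smooth_has_derive1.
- by rewrite -eN'; exact: smooth_has_derive1.
- by rewrite -eB'; exact: smooth_has_derive1.
Qed.

End frenet_equations.

Section frame_algebra.
Variable R : realType.
Implicit Types (a b : 'rV[R]_3).

Lemma frame_dots a b : dot a a = 1 -> dot b b = 1 -> dot a b = 0 ->
  [/\ dot (cross a b) (cross a b) = 1, dot a (cross a b) = 0, dot b (cross a b) = 0,
      cross a (cross a b) = - b & cross b (cross a b) = a].
Proof.
move=> aa bb ab; split.
- by rewrite dot_cross_cross aa bb ab mul0r subr0 mulr1.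
- exact: dot_cross1.
- exact: dot_cross2.
- by rewrite triple_r aa ab scale0r sub0r scale1r.
- by rewrite triple_r bb (dotC b a) ab scale0r subr0 scale1r.
Qed.

End frame_algebra.

Lemma derive_unique (R : realType) (W : normedModType R) (I : set R) (f g : R -> W) (t : R) df dg :
  open_interval I -> I t -> (forall u, I u -> f u = g u) ->
  is_derive t 1 f df -> is_derive t 1 g dg -> df = dg.
Proof.
move=> oI It fg hf hg; have h : is_derive t 1 g df.
  by apply: is_derive_near hf; apply: filterS (interval_near oI It) => u; exact: fg.
by have [_ <-] := h; have [_ <-] := hg.
Qed.

Section bicycle_curvature.
Variables (R : realType) (I : set R) (x y : R -> 'rV[R]_3).
Hypotheses (oI : open_interval I) (bp : bicycle_path I x y) (us : unit_speed I x).
Variable p : 'rV[R]_3.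
Hypothesis mom : momentum_equation I x y p.
Let v t := x t - y t.
Let T := derive1 x.
Let c := back_speed x y.
Let K := rod_field x y p.

Lemma rod_field_axial t : dot (T t) (K t) = dot p (cross (T t) (v t)).
Proof. by rewrite /K /rod_field dotDr dot_cross1 addr0 dot_cross_rot dot_cross_rot. Qed.

Lemma rod_field_momentum t : dot p (K t) = dot p (cross (T t) (v t)).
Proof. by rewrite /K /rod_field dotDr dot_cross2 add0r. Qed.

(** K = v * (p - x') with v orthogonal to p - x'. *)
Lemma rod_field_sqr t : I t -> dot (K t) (K t) = dot (p - T t) (p - T t).
Proof.
move=> It; have [e _] := mom It.
have -> : K t = cross (v t) (p - T t).
  by rewrite crossBr /K /rod_field -/T -[x t - y t]/(v t) (crossC (T t)).
rewrite dot_cross_cross (frame_unit oI bp It) mul1r.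
have -> : dot (v t) (p - T t) = 0.
  by rewrite dotBr (dotC _ p) (dotC _ (T t)) [dot p _]e subrr.
by rewrite mul0r subr0.
Qed.

(** x'' = x' * K and x' . K = - b give K = - b T - k B, and then K' = T * p gives
    the components of [p] in the Frenet frame: p . N = - k' and
    p . B = - k (tau - b), while |K|^2 = |p - T|^2 gives p . T. The first
    equation is the derivative of p . N, the second one is p . K = - b, and the
    third one is the norm of [p]. *)
Lemma bicycle_equations_of_momentum t0 a b k tau : I t0 ->
  b = - dot p (cross (T t0) (v t0)) -> a ^+ 2 + b ^+ 2 = dot p p ->
  frenet I x k tau -> bicycle_equations I a b k tau.
Proof.
move=> I0 eb eab fr; have sx : smooth I x by case: bp.
have sk : smooth I k by case: fr => ? [? [? []]].
have [N [B [sN sB fE]]] := frenet_frame oI fr.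
have dotpw t : I t -> dot p (cross (T t) (v t)) = - b.
  by move=> It; rewrite (axial_momentum_constant oI bp mom It I0) eb opprK.
have KE t : I t -> K t = (- b) *: T t - k t *: B t.
  move=> It; have [[TT NN TN] eB dT _ _] := fE t It.
  have e1 := is_derive_derive1 dT.
  have := triple_r (T t) (T t) (K t).
  rewrite -(acceleration_rod_field us mom It) -/T e1 TT scale1r rod_field_axial dotpw //.
  by rewrite crossZr -eB => ->; rewrite opprB addrC subrK.
have pc t : I t -> dot p (N t) = - derive1 k t /\ dot p (B t) = - (k t * (tau t - b)).
  move=> It; have [[TT NN TN] eB dT dN dB] := fE t It.
  have [BB TB NB TxB NxB] := frame_dots TT NN TN; rewrite -eB in BB TB NB TxB NxB.
  have e := derive_unique oI It KE (rod_field_derive oI bp mom It)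
    (is_derive_sub (is_derive_scale (is_derive_const t 1 (- b)) dT) (is_derive_scale (smooth_has_derive1 sk It) dB)).
  have eN := congr1 (dot (N t)) e; have e2 := congr1 (dot (B t)) e.
  rewrite !dotE NN BB (dotC (N t) (T t)) TN (dotC (B t) (T t)) TB (dotC (B t) (N t)) NB in eN e2.
  rewrite -/T dot_cross_rot dot_cross_rot in eN; rewrite -/T dot_cross_rot dot_cross_rot in e2.
  have NT : cross (N t) (T t) = - B t by rewrite crossC -eB.
  have BT : cross (B t) (T t) = N t by rewrite crossC TxB opprK.
  rewrite NT dotNr in eN; rewrite BT in e2.
  by split; lra.
have hE t : I t -> dot p (T t) = (1 + a ^+ 2 - k t ^+ 2) / 2.
  move=> It; have [[TT NN TN] eB dT dN dB] := fE t It.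
  have [BB TB NB _ _] := frame_dots TT NN TN; rewrite -eB in BB TB NB.
  have := rod_field_sqr It; rewrite KE // !dotE TT BB (dotC (B t)) TB (dotC (T t) p) -eab.
  lra.
move=> t It; have [[TT NN TN] eB dT dN dB] := fE t It; have [pN pB] := pc t It.
split.
- have dk' : is_derive t 1 (derive1 k) (derive1n 2 k t).
    by apply: (smooth_has_derive1 _ It); exact: smooth_derive1.
  have e : forall u, I u -> dot p (N u) = - derive1 k u by move=> u /pc[].
  have := derive_unique oI It e (is_derive_dot (is_derive_const t 1 p) dN) (is_derive_opp dk').
  rewrite dot0l add0r !dotE hE // pB; lra.
- have := rod_field_momentum t; rewrite dotpw // KE // !dotE hE // pB; lra.
- have [BB TB NB _ _] := frame_dots TT NN TN; rewrite -eB in BB TB NB.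
  have := congr1 (dot p) (orthonormal_expansion p TT NN TN).
  rewrite -eB !dotE -eab hE // pN pB; lra.
Qed.

End bicycle_curvature.

(** * Existence of Frenet frames *)

Lemma straight_of_zero_acceleration (R : realType) n (I : set R) (x : R -> 'rV[R]_n) :
  open_interval I -> smooth I x -> (forall t, I t -> derive1 (derive1 x) t = 0) ->
  straight_line I x.
Proof.
move=> oI sx h; have [[t0 I0]|nI] := pselect (exists t, I t); last first.
  by exists 0, 0 => t It; case: nI; exists t.
have sT := smooth_derive1 sx.
have Tc t : I t -> derive1 x t = derive1 x t0.
  move=> It; apply/rowP => i.
  apply: (constant_on_interval oI.2 (f := fun t => derive1 x t 0 i)) => // u Iu.
  by have := is_derive_coord i (smooth_has_derive1 sT Iu); rewrite h // mxE.
exists (x t0 - t0 *: derive1 x t0), (derive1 x t0) => t It.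
suff e : x t - t *: derive1 x t0 = x t0 - t0 *: derive1 x t0 by rewrite -e subrK.
apply/rowP => i.
apply: (constant_on_interval oI.2 (f := fun t => (x t - t *: derive1 x t0) 0 i)) => // u Iu.
have := is_derive_coord i (is_derive_sub (smooth_has_derive1 sx Iu) (is_derive_scale (is_derive_id u 1) (is_derive_const u 1 (derive1 x t0)))).
by rewrite Tc // scaler0 addr0 scale1r subrr mxE.
Qed.

Section frame_existence.
Variables (R : realType) (I : set R) (x : R -> 'rV[R]_3).
Hypotheses (oI : open_interval I) (sx : smooth I x) (us : unit_speed I x).
Let T := derive1 x.

Let sT : smooth I T. Proof. exact: smooth_derive1. Qed.
Let dT t (It : I t) : is_derive t 1 T (derive1 T t) := smooth_has_derive1 sT It.
Let TT t : I t -> dot (T t) (T t) = 1. Proof. by move=> /us/enorm_unit. Qed.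

Lemma orth_of_unit (f : R -> 'rV[R]_3) (df : 'rV[R]_3) t : (forall u, I u -> dot (f u) (f u) = 1) ->
  I t -> is_derive t 1 f df -> dot (f t) df = 0.
Proof.
move=> f1 It hf; have := derive_unique oI It f1 (is_derive_dot hf hf) (is_derive_const t 1 (1 : R)).
by rewrite (dotC df) => e; lra.
Qed.

Lemma dot_derive_of_orth (f g : R -> 'rV[R]_3) (df dg : 'rV[R]_3) t :
  (forall u, I u -> dot (f u) (g u) = 0) -> I t -> is_derive t 1 f df -> is_derive t 1 g dg ->
  dot (f t) dg = - dot df (g t).
Proof.
move=> fg It hf hg; have := derive_unique oI It fg (is_derive_dot hf hg) (is_derive_const t 1 (0 : R)).
by move=> e; lra.
Qed.

(** The frame is determined by a unit normal field to which x'' is parallel. *)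
Lemma frenet_of_normal (N : R -> 'rV[R]_3) : smooth I N ->
  (forall t, I t -> dot (N t) (N t) = 1) -> (forall t, I t -> dot (T t) (N t) = 0) ->
  (forall t, I t -> dot (derive1 T t) (cross (T t) (N t)) = 0) ->
  exists k tau, frenet I x k tau.
Proof.
move=> sN NN TN T'B; have oI1 := oI.1.
pose B t := cross (T t) (N t).
pose k t := dot (derive1 T t) (N t); pose tau t := dot (derive1 N t) (B t).
have sB : smooth I B by exact: smooth_cross.
have sk : smooth I k by apply: smooth_dot => //; exact: smooth_derive1.
have stau : smooth I tau by apply: smooth_dot => //; exact: smooth_derive1.
exists k, tau, T, N, B; split=> // t It.
have dN := smooth_has_derive1 sN It.
have T'E : derive1 T t = k t *: N t.
  rewrite [LHS](orthonormal_expansion _ (TT It) (NN t It) (TN t It)) T'B // scale0r addr0.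
  by rewrite (dotC _ (T t)) (orth_of_unit TT It (dT It)) scale0r add0r.
have N'E : derive1 N t = - k t *: T t + tau t *: B t.
  rewrite [LHS](orthonormal_expansion _ (TT It) (NN t It) (TN t It)).
  rewrite (dotC _ (N t)) (orth_of_unit NN It dN) scale0r addr0.
  by rewrite (dotC _ (T t)) (dot_derive_of_orth TN It (dT It) dN).
split=> //; first by split; [exact: us|exact/enorm_unit/NN|exact: TN].
split=> //; rewrite (is_derive_derive1 (is_derive_cross (dT It) dN)) T'E N'E.
have [_ _ _ TB _] := frame_dots (TT It) (NN t It) (TN t It).
by rewrite !crossE !scaler0 add0r add0r TB scalerN scaleNr.
Qed.

Lemma frenet_of_nonzero_acceleration : (forall t, I t -> derive1 T t != 0) ->
  exists k tau, frenet I x k tau.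
Proof.
move=> T'0; have oI1 := oI.1; have sT' := smooth_derive1 sT.
pose r t := Num.sqrt (dot (derive1 T t) (derive1 T t)).
have rpos t : I t -> 0 < r t by move=> /T'0 h; rewrite sqrtr_gt0 dot_gt0.
have rr t : I t -> r t ^+ 2 = dot (derive1 T t) (derive1 T t).
  by move=> It; rewrite sqr_sqrtr // dot_ge0.
apply: (@frenet_of_normal (fun t => (r t)^-1 *: derive1 T t)).
- apply: smoothZ => //; apply: smoothV => // [t It|]; first by rewrite gt_eqF ?rpos.
  by apply: smooth_sqrt => // [t /T'0|]; [rewrite dot_gt0|exact: smooth_dot].
- move=> t It; rewrite dotZl dotZr -rr //; field; rewrite gt_eqF ?rpos //.
- by move=> t It; rewrite dotZr (orth_of_unit TT It (dT It)) mulr0.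
- by move=> t It; rewrite crossZr dotZr dot_cross2 mulr0.
Qed.

(** [M] is rotated about x' by the integral of the difference between the
    prescribed rate of rotation and its own. *)
Lemma normal_with_torsion (M : R -> 'rV[R]_3) (tau : R -> R) t0 : I t0 -> smooth I M -> smooth I tau ->
  (forall t, I t -> dot (M t) (M t) = 1) -> (forall t, I t -> dot (T t) (M t) = 0) ->
  exists N : R -> 'rV[R]_3, [/\ smooth I N, N t0 = M t0,
    (forall t, I t -> dot (N t) (N t) = 1), (forall t, I t -> dot (T t) (N t) = 0) &
    forall t, I t -> dot (derive1 N t) (cross (T t) (N t)) = tau t].
Proof.
move=> I0 sM stau MM TM; have oI1 := oI.1.
pose M2 t := cross (T t) (M t).
have sM2 : smooth I M2 by exact: smooth_cross.
have sM' := smooth_derive1 sM.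
have [th [sth th0 dth]] : exists F, [/\ smooth I F, F t0 = 0 &
    forall t, I t -> is_derive t 1 F (tau t - dot (derive1 M t) (M2 t))].
  by apply: scalar_primitive => //; apply: smoothBr => //; exact: smooth_dot.
have [scos ssin] := smooth_trigo R.
have sc : smooth I (fun t => cos (th t)) by exact: (smooth_comp oI1 (J := setT) _ sth scos).
have ss : smooth I (fun t => sin (th t)) by exact: (smooth_comp oI1 (J := setT) _ sth ssin).
pose N t := cos (th t) *: M t + sin (th t) *: M2 t.
have sN : smooth I N by apply: smoothD => //; exact: smoothZ.
have cs t := cos2Dsin2 (th t).
have dots t It := frame_dots (TT It) (MM t It) (TM t It).
have NN t : I t -> dot (N t) (N t) = 1.
  move=> It; have [M2M2 _ MM2 _ _] := dots t It.
  rewrite /N !dotE (dotC (M2 t)) -/(M2 t) MM // [dot (M2 t) _]M2M2 [dot (M t) (M2 t)]MM2.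
  by rewrite -[RHS](cs t); ring.
have TN t : I t -> dot (T t) (N t) = 0.
  by move=> It; have [_ TM2 _ _ _] := dots t It; rewrite /N !dotE TM // [dot _ (M2 t)]TM2 !mulr0 addr0.
exists N; split => //; first by rewrite /N th0 cos0 sin0 scale1r scale0r addr0.
move=> t It; have [M2M2 TM2 MM2 TxM2 _] := dots t It.
have dc : is_derive t 1 (fun t => cos (th t)) (- sin (th t) * (tau t - dot (derive1 M t) (M2 t))).
  by apply: is_derive_chain; exact: dth.
have ds : is_derive t 1 (fun t => sin (th t)) (cos (th t) * (tau t - dot (derive1 M t) (M2 t))).
  by apply: is_derive_chain; exact: dth.
have dM := smooth_has_derive1 sM It; have dM2 := smooth_has_derive1 sM2 It.
rewrite (is_derive_derive1 (is_derive_add (is_derive_scale dc dM) (is_derive_scale ds dM2))).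
have -> : cross (T t) (N t) = cos (th t) *: M2 t - sin (th t) *: M t.
  by rewrite /N crossDr !crossZr [cross _ (M2 t)]TxM2 scalerN.
have M'M := orth_of_unit MM It dM.
have M2'M2 : dot (M2 t) (derive1 M2 t) = 0.
  by apply: (orth_of_unit _ It dM2) => u Iu; have [] := dots u Iu.
have MM2' : dot (M t) (derive1 M2 t) = - dot (derive1 M t) (M2 t).
  by apply: (dot_derive_of_orth _ It dM dM2) => u Iu; have [_ _ ] := dots u Iu.
move: M2M2 MM2 M'M M2'M2 MM2'; rewrite -/(M2 t) => M2M2 MM2 M'M M2'M2 MM2'.
rewrite !dotE M2M2 (MM t It) (dotC (M2 t) (M t)) MM2 (dotC (derive1 M t) (M t)) M'M.
rewrite (dotC (derive1 M2 t) (M2 t)) M2'M2 (dotC (derive1 M2 t) (M t)) MM2'.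
move: (cs t) (dot (derive1 M t) (M2 t)) => h w.
transitivity ((cos (th t) ^+ 2 + sin (th t) ^+ 2) * tau t); first by ring.
by rewrite h mul1r.
Qed.

End frame_existence.

Section bicycle_frame.
Variables (R : realType) (I : set R) (x y : R -> 'rV[R]_3).
Hypotheses (oI : open_interval I) (bp : bicycle_path I x y) (us : unit_speed I x).
Variable p : 'rV[R]_3.
Hypothesis mom : momentum_equation I x y p.
Let v t := x t - y t.
Let T := derive1 x.
Let K := rod_field x y p.
Let sx : smooth I x. Proof. by case: bp. Qed.
Let sT : smooth I T. Proof. exact: smooth_derive1. Qed.
Let dT t (It : I t) : is_derive t 1 T (derive1 T t) := smooth_has_derive1 sT It.
Let TT t (It : I t) : dot (T t) (T t) = 1 := front_unit us It.
Let T'K t (It : I t) : derive1 T t = cross (T t) (K t) := acceleration_rod_field us mom It.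
Let dK t (It : I t) : is_derive t 1 K (cross (T t) p) := rod_field_derive oI bp mom It.

(** K' = x' * p = x' * (p - x'), and |p - x'| = |K|. *)
Lemma rod_field_zero t0 : I t0 -> K t0 = 0 -> forall t, I t -> K t = 0.
Proof.
move=> I0 K0.
have h : forall t, I t -> dot (K t) (K t) = 0.
  apply: (gronwall_zero (f := fun t => dot (K t) (K t)) (M := 2) oI.2 I0
    (fun u Iu => is_derive_dot (dK Iu) (dK Iu))) => // [u _|u Iu|]; first exact: dot_ge0.
  - have -> : cross (T u) p = cross (T u) (p - T u) by rewrite crossBr crossvv subr0.
    have eD : enorm (p - T u) = enorm (K u) by rewrite /enorm (rod_field_sqr oI bp mom Iu).
    have nc : enorm (cross (T u) (p - T u)) <= enorm (K u).
      rewrite -eD -ler_sqr ?nnegrE ?enorm_ge0 // !enorm_sqr dot_cross_cross (TT Iu).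
      by rewrite (dotC (p - T u) (T u)); have := sqr_ge0 (dot (T u) (p - T u)); rewrite expr2; lra.
    rewrite (dotC (cross _ _) (K u)).
    have -> (d : R) : d + d = 2 * d by ring.
    rewrite normrM ger0_norm //.
    rewrite ler_wpM2l // -enorm_sqr expr2; apply: le_trans (cauchy_schwarz _ _) _.
    by rewrite ler_wpM2l // enorm_ge0.
  - by rewrite K0 dot0l.
by move=> t /h/eqP; rewrite dot_eq0 => /eqP.
Qed.

Lemma straight_of_rod_field_zero t0 : I t0 -> K t0 = 0 -> straight_line I x.
Proof.
move=> I0 K0; apply: straight_of_zero_acceleration => // t It.
by rewrite [LHS](T'K It) (rod_field_zero I0 K0 It) cross0r.
Qed.

(** At an inflection point K = - b x', so b <> 0 for a curve that is not straight,
    and then [p] is nowhere parallel to x': its normal component is a smooth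
    normal field. The equation k^2 (2 tau - b) = b (a^2 - 1) forces a^2 = 1 and
    tau = b / 2, so this field is rotated to one with torsion b / 2. That x''
    is parallel to the result N amounts to K . N = 0; with B = x' * N, the pair
    K . N, p . B + (b / 2) K . B solves a linear system, and it vanishes at the
    inflection point. *)
Lemma frenet_of_inflection t0 : I t0 -> derive1 T t0 = 0 -> ~ straight_line I x ->
  exists k tau, frenet I x k tau.
Proof.
move=> I0 infl ns; have oI1 := oI.1.
pose b := - dot p (cross (T t0) (v t0)).
have TK t : I t -> dot (T t) (K t) = - b.
  move=> It; rewrite [LHS]rod_field_axial opprK.
  exact: (axial_momentum_constant oI bp mom It I0).
have pK t : I t -> dot p (K t) = - b.
  by move=> It; rewrite [LHS]rod_field_momentum -[LHS]rod_field_axial; exact: TK.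
have K0 : K t0 = (- b) *: T t0.
  have := triple_r (T t0) (T t0) (K t0); rewrite -T'K // infl cross0r TT // scale1r TK //.
  by move/eqP; rewrite eq_sym subr_eq0 => /eqP.
have b0 : b != 0.
  apply/eqP => b0; apply: ns; apply: (straight_of_rod_field_zero I0).
  by rewrite K0 b0 oppr0 scale0r.
pose q t := p - dot (T t) p *: T t.
have sq : smooth I q.
  apply: smoothB => //; first exact: smooth_cst.
  by apply: smoothZ => //; apply: smooth_dot => //; exact: smooth_cst.
have Tq t : I t -> dot (T t) (q t) = 0 by move=> It; rewrite /q dotBr dotZr TT // mulr1 subrr.
have q0 t : I t -> q t != 0.
  move=> It; apply/eqP => qt.
  have pE : p = dot (T t) p *: T t by apply/eqP; rewrite -subr_eq0; exact/eqP.
  have := pK t It; rewrite {1}pE dotZl TK // => e.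
  have h1 : dot (T t) p = 1.
    have /eqP : (dot (T t) p - 1) * b = 0 by lra.
    by rewrite mulf_eq0 (negbTE b0) orbF subr_eq0 => /eqP.
  have pT : p - T t = 0 by apply/eqP; rewrite subr_eq0 {1}pE h1 scale1r.
  have := rod_field_sqr oI bp mom It; rewrite -/T pT dot0l => /eqP.
  rewrite dot_eq0 => /eqP Kt; have := TK t It; rewrite [K t]Kt dot0r.
  by move/eqP; rewrite eq_sym oppr_eq0 (negbTE b0).
pose r t := Num.sqrt (dot (q t) (q t)).
have rpos t : I t -> 0 < r t by move=> /q0 h; rewrite sqrtr_gt0 dot_gt0.
have rr t : I t -> r t ^+ 2 = dot (q t) (q t).
  by move=> It; rewrite sqr_sqrtr // dot_ge0.
have sM : smooth I (fun t => (r t)^-1 *: q t).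
  apply: smoothZ => //; apply: smoothV => // [t It|]; first by rewrite gt_eqF ?rpos.
  by apply: smooth_sqrt => // [t /q0|]; [rewrite dot_gt0|exact: smooth_dot].
have MM t : I t -> dot ((r t)^-1 *: q t) ((r t)^-1 *: q t) = 1.
  by move=> It; rewrite dotZl dotZr -rr //; field; rewrite gt_eqF ?rpos.
have TM t : I t -> dot (T t) ((r t)^-1 *: q t) = 0 by move=> It; rewrite dotZr Tq // mulr0.
have [N [sN N0 NN TN tors]] := normal_with_torsion oI sx us I0 sM (smooth_cst I (b / 2)) MM TM.
pose B t := cross (T t) (N t).
have dN t (It : I t) := smooth_has_derive1 sN It.
have T'N t : I t -> dot (derive1 T t) (N t) = - dot (K t) (B t).
  by move=> It; rewrite T'K // dotC dot_cross_rot dot_cross_rot /B (crossC (N t)) dotNr.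
have T'B t : I t -> dot (derive1 T t) (B t) = dot (K t) (N t).
  move=> It; have [_ _ _ TxB _] := frame_dots (TT It) (NN t It) (TN t It).
  rewrite T'K // dotC dot_cross_rot dot_cross_rot (crossC (B t)) [cross (T t) (B t)]TxB.
  by rewrite opprK.
have N'E t : I t -> derive1 N t = dot (K t) (B t) *: T t + (b / 2) *: B t.
  move=> It; rewrite [LHS](orthonormal_expansion _ (TT It) (NN t It) (TN t It)) tors //.
  rewrite (dotC _ (N t)) (orth_of_unit oI NN It (dN t It)) scale0r addr0.
  by rewrite (dotC _ (T t)) (dot_derive_of_orth oI TN It (dT It) (dN t It)) T'N // opprK.
have B'E t : I t -> is_derive t 1 B (- dot (K t) (N t) *: T t - (b / 2) *: N t).
  move=> It; apply: is_derive_eq (is_derive_cross (dT It) (dN t It)) _.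
  have [BB TB NB TxB _] := frame_dots (TT It) (NN t It) (TN t It).
  have NT : cross (N t) (T t) = - B t by rewrite crossC.
  have NxB : cross (N t) (B t) = T t by have [] := frame_dots (TT It) (NN t It) (TN t It).
  rewrite [derive1 T t](orthonormal_expansion _ (TT It) (NN t It) (TN t It)).
  rewrite (dotC _ (T t)) (orth_of_unit oI TT It (dT It)) scale0r add0r T'N // T'B // N'E //.
  have BN : cross (B t) (N t) = - T t by rewrite crossC NxB.
  rewrite -/(B t) in TxB *.
  by rewrite !crossE TxB BN !scaler0 add0r add0r !scalerN scaleNr.
pose f t := dot (K t) (N t); pose g t := dot p (B t) + (b / 2) * dot (K t) (B t).
have df t : I t -> is_derive t 1 f (- g t).
  move=> It; apply: is_derive_eq (is_derive_dot (dK It) (dN t It)) _.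
  have e1 : dot (cross (T t) p) (N t) = - dot p (B t).
    by rewrite dotC dot_cross_rot dot_cross_rot (crossC (N t)) dotNr.
  have e2 : dot (K t) (T t) = - b by rewrite dotC TK.
  by rewrite N'E // e1 dotDr !dotZr e2 /g; field.
have dg t : I t -> is_derive t 1 g ((b ^+ 2 / 4 - dot p (T t)) * f t).
  move=> It; have dB := B'E t It.
  have := is_derive_add (is_derive_dot (is_derive_const t 1 p) dB) (is_derive_mul (is_derive_const t 1 (b / 2)) (is_derive_dot (dK It) dB)).
  move/is_derive_eq; apply.
  have [_ _ _ TxB _] := frame_dots (TT It) (NN t It) (TN t It).
  have -> : dot (cross (T t) p) (B t) = dot p (N t).
    rewrite dotC dot_cross_rot dot_cross_rot (crossC (B t)) [cross (T t) (B t)]TxB.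
    by rewrite opprK.
  have e2 : dot (K t) (T t) = - b by rewrite dotC TK.
  by rewrite dot0l add0r !dotBr !dotZr e2 /f; field.
have f0 : f t0 = 0 by rewrite /f K0 dotZl TN // mulr0.
have g0 : g t0 = 0.
  have [_ TB _ _ _] := frame_dots (TT I0) (NN t0 I0) (TN t0 I0).
  rewrite /g K0 dotZl [dot (T t0) (B t0)]TB !mulr0 addr0 /B N0 crossZr dotZr.
  by rewrite /q crossBr crossZr crossvv scaler0 subr0 dot_cross2 mulr0.
pose Mb := 1 + b ^+ 2 / 4 + enorm p.
have e0 : forall t, I t -> f t * f t + g t * g t = 0.
  apply: (gronwall_zero (f := fun t => f t * f t + g t * g t) (M := Mb) oI.2 I0
    (fun u Iu => is_derive_add (is_derive_mul (df u Iu) (df u Iu)) (is_derive_mul (dg u Iu) (dg u Iu)))) => [u _|u Iu|].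
  - by rewrite addr_ge0 // -expr2 sqr_ge0.
  - have p1 : `|dot p (T u)| <= enorm p.
      apply: le_trans (cauchy_schwarz _ _) _.
      by rewrite (us Iu) mulr1.
    move: p1; rewrite /Mb; set P := enorm p; set d := dot p _; move: (f u) (g u) => F G p1.
    have -> : - G * F + F * - G + ((b ^+ 2 / 4 - d) * F * G + G * ((b ^+ 2 / 4 - d) * F))
       = (b ^+ 2 / 4 - d - 1) * (2 * F * G) by ring.
    rewrite normrM; apply: ler_pM => //.
      apply: le_trans (ler_normB _ _) _; rewrite normr1.
      have := ler_normB (b ^+ 2 / 4) d; rewrite (ger0_norm (_ : 0 <= b ^+ 2 / 4)); last by rewrite divr_ge0 ?sqr_ge0.
      by lra.
    by rewrite ler_norml; have := sqr_ge0 (F - G); have := sqr_ge0 (F + G); rewrite !expr2; lra.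
  - by rewrite f0 g0 !mul0r addr0.
apply: (frenet_of_normal oI sx us sN NN TN) => t It.
rewrite [LHS]T'B //; have := e0 t It; rewrite -!expr2 => /eqP.
by rewrite paddr_eq0 ?sqr_ge0 // !sqrf_eq0 => /andP[/eqP].
Qed.

Lemma bicycle_frenet : ~ straight_line I x -> exists k tau, frenet I x k tau.
Proof.
move=> ns; have [h|] := pselect (forall t, I t -> derive1 T t != 0).
  exact: frenet_of_nonzero_acceleration h.
move=> /existsNP[t /not_implyP[It /negP/negPn/eqP e]].
exact: frenet_of_inflection It e ns.
Qed.

End bicycle_frame.

(** * From Kirchhoff rods to bicycling geodesics *)

Section rod_to_bicycle.
Variables (R : realType) (I : set R) (x : R -> 'rV[R]_3) (k tau : R -> R) (a b : R).
Hypotheses (oI : open_interval I) (sx : smooth I x) (us : unit_speed I x).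
Hypotheses (ns : ~ straight_line I x) (fr : frenet I x k tau).
Hypothesis rod : rod_equations I ((1 + a ^+ 2) / 2) b (b * (a ^+ 2 - 1)) k tau.
Hypothesis cons : rod_conservation I ((1 + a ^+ 2) / 2) b (Num.sqrt (a ^+ 2 + b ^+ 2)) k tau.
Let T := derive1 x.

Let sk : smooth I k. Proof. by case: fr => ? [? [? []]]. Qed.
Let stau : smooth I tau. Proof. by case: fr => ? [? [? []]]. Qed.
Let dk t (It : I t) : is_derive t 1 k (derive1 k t) := smooth_has_derive1 sk It.
Let dk' t (It : I t) : is_derive t 1 (derive1 k) (derive1n 2 k t) :=
  smooth_has_derive1 (smooth_derive1 sk) It.
Let dtau t (It : I t) : is_derive t 1 tau (derive1 tau t) := smooth_has_derive1 stau It.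

Let eq1 t (It : I t) : derive1n 2 k t = k t * (tau t * (tau t - b) + (1 + a ^+ 2 - k t ^+ 2) / 2).
Proof. by have [-> _] := rod It; field. Qed.

Let eq2 t (It : I t) : k t ^+ 2 * (2 * tau t - b) = b * (a ^+ 2 - 1).
Proof. by have [_ ->] := rod It. Qed.

Let eq3 t (It : I t) : derive1 k t ^+ 2 + (1 + a ^+ 2 - k t ^+ 2) ^+ 2 / 4
  + k t ^+ 2 * (tau t - b) ^+ 2 = a ^+ 2 + b ^+ 2.
Proof.
have := cons It; rewrite sqr_sqrtr ?addr_ge0 ?sqr_ge0 // => <-.
by field.
Qed.

(** By uniqueness for the linear equation k'' = phi k, where phi is bounded on
    segments, a double zero would make k vanish identically. *)
Lemma curvature_zeros_simple t : I t -> k t = 0 -> derive1 k t != 0.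
Proof.
move=> It kt; apply/eqP => k't; apply: ns; apply: straight_of_zero_acceleration => // u Iu.
have [N [B [_ _ fE]]] := frenet_frame oI fr.
have [_ _ dT _ _] := fE u Iu; rewrite (is_derive_derive1 dT).
suff -> : k u = 0 by rewrite scale0r.
have [al [be [alm mbe Ial Ibe sub]]] := open_interval_nbhs_pair oI It Iu.
move: alm mbe; rewrite lt_min gt_max => /andP[a1 a2] /andP[b1 b2].
pose phi t := tau t * (tau t - b) + (1 + a ^+ 2 - k t ^+ 2) / 2.
have oI1 := oI.1.
have sphi : smooth I phi.
  apply: smoothD => //.
    by apply: smoothM => //; apply: smoothBr => //; exact: smooth_cst.
  apply: smoothM => //; last exact: smooth_cst.
  by apply: smoothBr => //; [exact: smooth_cst|exact: smoothM].
have [M M0 hM] := @bounded_on_segment R al be phi (fun t ht => sphi 0%N t (sub t ht)).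
pose J : set R := `]al, be[.
have itvJ : is_interval J by exact: interval_is_interval.
have JI r : J r -> al <= r <= be by rewrite /J /= in_itv /= => /andP[? ?]; rewrite !ltW.
have Jt : J t by rewrite /J /= in_itv /= a1 b1.
have Ju : J u by rewrite /J /= in_itv /= a2 b2.
have dE r (Jr : J r) : is_derive r 1 (fun r => k r * k r + derive1 k r * derive1 k r)
    (2 * k r * derive1 k r * (1 + phi r)).
  have Ir := sub r (JI r Jr).
  apply: is_derive_eq (is_derive_add (is_derive_mul (dk Ir) (dk Ir)) (is_derive_mul (dk' Ir) (dk' Ir))) _.
  by rewrite eq1 // -/(phi r); ring.
have := gronwall_zero (f := fun r => k r * k r + derive1 k r * derive1 k r) (M := 1 + M) itvJ Jt dE.
move=> /(_ _ _ _ u Ju) h.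
have : k u * k u + derive1 k u * derive1 k u = 0.
  apply: h => [r _|r Jr|]; [by rewrite addr_ge0 // -expr2 sqr_ge0| |by rewrite kt k't !mul0r addr0].
  rewrite mulrC normrM; apply: ler_pM => //.
    apply: le_trans (ler_normD _ _) _; rewrite normr1 lerD2l; exact: hM (JI r Jr).
  have := sqr_ge0 (k r - derive1 k r); have := sqr_ge0 (k r + derive1 k r).
  by rewrite ler_norml !expr2; lra.
by rewrite -!expr2 => /eqP; rewrite paddr_eq0 ?sqr_ge0 // !sqrf_eq0 => /andP[/eqP].
Qed.

(** Away from inflection points this is the derivative of [eq2]; there it is the
    derivative of k (k tau' + (2 tau - b) k') = 0, as k' does not vanish. *)
Lemma torsion_derivative t : I t -> k t * derive1 tau t + (2 * tau t - b) * derive1 k t = 0.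
Proof.
move=> It; pose be u := k u * derive1 tau u + (2 * tau u - b) * derive1 k u.
have kb u : I u -> k u * be u = 0.
  move=> Iu.
  have h := is_derive_mul (is_derive_mul (dk Iu) (dk Iu)) (is_derive_sub (is_derive_mul (is_derive_const u 1 (2 : R)) (dtau Iu)) (is_derive_const u 1 b)).
  have e : forall r, I r -> k r * k r * (2 * tau r - b) = b * (a ^+ 2 - 1).
    by move=> r Ir; rewrite -expr2 eq2.
  have := derive_unique oI Iu e h (is_derive_const u 1 (b * (a ^+ 2 - 1))) => e2.
  have : 2 * (k u * be u) = 0 by rewrite -[RHS]e2 /be; ring.
  lra.
have [k0|k0] := eqVneq (k t) 0; last first.
  by have /eqP := kb t It; rewrite mulf_eq0 (negbTE k0) /= => /eqP.
have oI1 := oI.1.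
have sbe : smooth I be.
  apply: smoothD => //; apply: smoothM => //; try exact: smooth_derive1.
  by apply: smoothBr => //; [apply: smoothM => //; exact: smooth_cst|exact: smooth_cst].
have /eqP : derive1 k t * be t = 0.
  have <- := derive_unique oI It kb (is_derive_mul (dk It) (smooth_has_derive1 sbe It)) (is_derive_const t 1 (0 : R)).
  by rewrite k0 mul0r addr0.
by rewrite mulf_eq0 (negbTE (curvature_zeros_simple It k0)) /= => /eqP.
Qed.

(** The vector p is defined by the components that it has in the Frenet frame for
    a bicycling geodesic, and it is constant by the rod equations. In the same
    way K = - b T - k B satisfies K' = x' * p. The frame direction is then the
    solution v of v * (p - x') = K, v . (p - x') = 0, where
    |p - x'|^2 = k^2 + b^2 never vanishes: for b = 0 the conservation law would
    make a zero of k a double zero. *)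
Lemma bicycle_of_rod : exists y, bicycling_geodesic I x y.
Proof.
have [[t0 I0]|nI] := pselect (exists t, I t); last first.
  by case: ns; exists 0, 0 => t It; case: nI; exists t.
have oI1 := oI.1; have sT := smooth_derive1 sx.
have [N [B [sN sB fE]]] := frenet_frame oI fr.
pose h t := (1 + a ^+ 2 - k t ^+ 2) / 2.
pose P t := h t *: T t - derive1 k t *: N t - (k t * (tau t - b)) *: B t.
have dP t : I t -> is_derive t 1 P 0.
  move=> It; have [_ _ dT dN dB] := fE t It.
  have dh : is_derive t 1 h (- k t * derive1 k t).
    have := is_derive_mul (is_derive_sub (is_derive_const t 1 (1 + a ^+ 2)) (is_derive_mul (dk It) (dk It))) (is_derive_const t 1 (2^-1 : R)).
    by move/is_derive_eq; apply; field.
  have d2 := is_derive_mul (dk It) (is_derive_sub (dtau It) (is_derive_const t 1 b)).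
  apply: is_derive_eq (is_derive_sub (is_derive_sub (is_derive_scale dh dT) (is_derive_scale (dk' It) dN)) (is_derive_scale d2 dB)) _.
  have t1 := torsion_derivative It; rewrite eq1 // /h.
  have t2 : k t * derive1 tau t = - ((2 * tau t - b) * derive1 k t) by lra.
  rewrite subr0 t2.
  move: (derive1 x t) (N t) (B t) => e1 e2 e3.
  by apply/rowP => i; rewrite !mxE; field.
pose p := P t0.
have PE t : I t -> P t = p.
  move=> It; apply/rowP => i.
  apply: (constant_on_interval oI.2 (f := fun t => P t 0 i)) => // u Iu.
  by have := is_derive_coord i (dP u Iu); rewrite mxE.
pose K t := (- b) *: T t - k t *: B t.
pose D t := p - T t.
have facts t : I t -> [/\ dot (D t) (D t) = k t ^+ 2 + b ^+ 2, dot (K t) (K t) = k t ^+ 2 + b ^+ 2,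
    dot (D t) (K t) = 0, derive1 T t = cross (T t) (K t) & is_derive t 1 K (cross (T t) p)].
  move=> It; have [[TT NN TN] eB dT dN dB] := fE t It.
  have [BB TB NB TxB NxB] := frame_dots TT NN TN; rewrite -eB in BB TB NB TxB NxB.
  have e2 := eq2 It; have e3 := eq3 It.
  have DE : D t = (h t - 1) *: T t - derive1 k t *: N t - (k t * (tau t - b)) *: B t.
    by rewrite /D -(PE t It) /P scalerBl scale1r; move: (T t) (N t) (B t) => A1 A2 A3;
      apply/rowP => i; rewrite !mxE; ring.
  have [NT BT BN] : [/\ dot (N t) (T t) = 0, dot (B t) (T t) = 0 & dot (B t) (N t) = 0].
    by rewrite !(dotC _ (T t)) (dotC (B t)) TN TB NB.
  split.
  - rewrite DE !dotE TT NN BB TN TB NB NT BT BN /h; lra.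
  - rewrite /K !dotE TT BB TB BT; ring.
  - rewrite DE /K !dotE TT BB TB NB NT BT /h; lra.
  - rewrite (is_derive_derive1 dT) /K !crossE TxB scaler0 scalerN sub0r opprK //.
  - have := is_derive_sub (is_derive_scale (is_derive_const t 1 (- b)) dT) (is_derive_scale (dk It) dB).
    move/is_derive_eq; apply; rewrite -(PE t It) /P !crossE TxB -eB.
    by move: (T t) (N t) (B t) => A1 A2 A3; apply/rowP => i; rewrite !mxE; ring.
have Dpos t : I t -> 0 < dot (D t) (D t).
  move=> It; have [-> _ _ _ _] := facts t It.
  have [k0|k0] := eqVneq (k t) 0; last by rewrite ltr_pwDl ?sqr_ge0 // exprn_even_gt0.
  have [b0|b0] := eqVneq b 0; last by rewrite ltr_wpDl ?sqr_ge0 // exprn_even_gt0.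
  have := eq3 It; rewrite k0 b0 expr0n /= => e.
  have : derive1 k t ^+ 2 = - ((1 - a ^+ 2) ^+ 2 / 4) by rewrite -[LHS]addr0; lra.
  have := sqr_ge0 (derive1 k t); have := sqr_ge0 (1 - a ^+ 2) => s1 s2 s3.
  have /eqP : derive1 k t ^+ 2 = 0 by lra.
  by rewrite sqrf_eq0 (negbTE (curvature_zeros_simple It k0)).
have sK : smooth I K.
  by apply: smoothB => //; apply: smoothZ => //; exact: smooth_cst.
have sD : smooth I D by apply: smoothB => //; exact: smooth_cst.
pose v t := (dot (D t) (D t))^-1 *: cross (D t) (K t).
have sv : smooth I v.
  apply: smoothZ => //; last exact: smooth_cross.
  apply: smoothV => // [t It|]; first by rewrite gt_eqF ?Dpos.
  exact: smooth_dot.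
have vfacts t : I t -> [/\ dot (v t) (v t) = 1, dot (v t) (D t) = 0, cross (v t) (D t) = K t
    & dot (v t) (K t) = 0].
  move=> It; have [DD KK DK _ _] := facts t It; have d0 := Dpos t It.
  split.
  - rewrite /v dotZl dotZr dot_cross_cross KK DK DD; field.
    by rewrite gt_eqF // -DD.
  - by rewrite /v dotZl dotC dot_cross1 mulr0.
  - by rewrite /v crossZl triple_l (dotC (K t)) DK scale0r subr0 scalerA mulVf ?scale1r // gt_eqF.
  - by rewrite /v dotZl dotC dot_cross2 mulr0.
have v'E t : I t -> derive1 v t = T t - dot (T t) (v t) *: v t.
  move=> It; have [vv vD vxD vK] := vfacts t It; have [_ _ _ T'K dK] := facts t It.
  have dv := smooth_has_derive1 sv It; have dT := smooth_has_derive1 sT It.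
  have dD := is_derive_sub (is_derive_const t 1 p) dT.
  have e1 := derive_unique oI It (fun u Iu => let: And4 _ e _ _ := vfacts u Iu in e) (is_derive_dot dv dD) (is_derive_const t 1 (0 : R)).
  have e2 := derive_unique oI It (fun u Iu => let: And4 _ _ e _ := vfacts u Iu in e) (is_derive_cross dv dD) dK.
  apply/eqP; rewrite -subr_eq0; set z := _ - _.
  have KvD : cross (K t) (v t) = D t.
    by rewrite -vxD triple_l vv scale1r (dotC (D t)) vD scale0r subr0.
  have zD : dot z (D t) = 0.
    have e3 : dot (v t) (derive1 T t) = dot (T t) (D t).
      by rewrite T'K dot_cross_rot KvD.
    rewrite sub0r dotNr -/T e3 in e1.
    rewrite /z !dotBl dotZl vD; lra.
  have zxD : cross z (D t) = 0.
    rewrite sub0r crossNr -/T T'K triple_r vK scale0r sub0r opprK in e2.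
    rewrite /z !crossBl crossZl vxD.
    have -> : cross (T t) (D t) = cross (T t) p by rewrite /D crossBr crossvv subr0.
    by rewrite -e2 (dotC (v t)) addrK subrr.
  have := triple_r (D t) z (D t); rewrite zxD cross0r (dotC (D t) z) zD scale0r subr0.
  by move/esym/eqP; rewrite scaler_eq0 gt_eqF ?Dpos.
exists (fun t => x t - v t).
have eXY t : x t - (x t - v t) = v t by rewrite opprB addrC subrK.
have dy t : I t -> is_derive t 1 (fun t => x t - v t) (dot (T t) (v t) *: v t).
  move=> It; apply: is_derive_eq (is_derive_sub (smooth_has_derive1 sx It) (smooth_has_derive1 sv It)) _.
  by rewrite v'E // opprB addrC subrK.
apply/(geodesic_momentumP x _ oI); split => //.
  split=> //; first exact: smoothB.
  move=> t It; rewrite eXY; split; first by apply/enorm_unit; have [] := vfacts t It.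
  by exists (dot (T t) (v t)); exact: is_derive_derive1 (dy t It).
exists p => t It; rewrite /back_speed eXY -/T.
have [vv vD vxD _] := vfacts t It; have [_ _ _ T'K _] := facts t It.
split; first by move: vD; rewrite /D dotBr (dotC (v t) p) (dotC (v t)) => /eqP; rewrite subr_eq0 => /eqP.
rewrite T'K -rod_acceleration; last by have [[TT _ _] _ _ _ _] := fE t It.
by rewrite -vxD /D crossBr (crossC (T t) (v t)).
Qed.

End rod_to_bicycle.

Lemma rod_parameters (R : realType) (I : set R) (x : R -> 'rV[R]_3) (a b : R) :
  curvature_torsion_satisfy I x (bicycle_equations I a b) ->
  kirchhoff_rod_with_parameters I ((1 + a ^+ 2) / 2) b (b * (a ^+ 2 - 1))
    (Num.sqrt (a ^+ 2 + b ^+ 2)) x.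
Proof.
move=> [ex all]; split=> // k tau fr; have be := all k tau fr.
split=> t It; have [e1 e2 e3] := be t It.
  by split=> //; rewrite e1; field.
by rewrite sqr_sqrtr ?addr_ge0 ?sqr_ge0 // -e3; field.
Qed.

Section curvature_of_geodesics.
Variables (R : realType) (I : set R) (x y : R -> 'rV[R]_3).
Hypotheses (oI : open_interval I) (bp : bicycle_path I x y) (us : unit_speed I x).

Lemma bicycle_curvature_torsion p t0 : momentum_equation I x y p -> I t0 -> ~ straight_line I x ->
  exists a b : R,
    [/\ a ^+ 2 + b ^+ 2 = enorm p ^+ 2, b = - dot (cross (derive1 x t0) (x t0 - y t0)) p &
        curvature_torsion_satisfy I x (bicycle_equations I a b)].
Proof.
move=> mom I0 ns.
pose b := - dot p (cross (derive1 x t0) (x t0 - y t0)).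
have bp2 : b ^+ 2 <= dot p p.
  rewrite sqrrN; apply: le_trans (cauchy_schwarz_sqr _ _) _.
  rewrite -[leRHS]mulr1 ler_wpM2l ?dot_ge0 // dot_cross_cross (front_unit us I0) (frame_unit oI bp I0).
  by rewrite (dotC (x t0 - y t0)); have := sqr_ge0 (dot (derive1 x t0) (x t0 - y t0)); rewrite expr2; lra.
have ab : Num.sqrt (dot p p - b ^+ 2) ^+ 2 + b ^+ 2 = dot p p.
  by rewrite sqr_sqrtr ?subr_ge0 // subrK.
exists (Num.sqrt (dot p p - b ^+ 2)), b; split.
- by rewrite enorm_sqr.
- by rewrite /b dotC.
split; first exact: (bicycle_frenet oI bp us mom ns).
by move=> k tau; exact: (bicycle_equations_of_momentum oI bp us mom I0 erefl ab).
Qed.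

End curvature_of_geodesics.

Theorem theorem1 (R : realType) :
  (* (a) *)
  (forall (n : nat) (I : set R) (x y : R -> 'rV[R]_n),
     (3 <= n)%N -> open_interval I -> bicycling_geodesic I x y ->
     exists (o : 'rV[R]_n) (W : 'M[R]_(3, n)),
       \rank W = 3%N /\
       forall t, I t -> (x t - o <= W)%MS /\ (y t - o <= W)%MS)
  /\
  (* (b) *)
  ((forall (I : set R) (x y : R -> 'rV[R]_3),
      open_interval I -> bicycling_geodesic I x y ->
      kirchhoff_rod I x /\
      (straight_line I x \/
       exists a b : R,
         curvature_torsion_satisfy I x (bicycle_equations I a b) /\
         kirchhoff_rod_with_parameters I ((1 + a ^+ 2) / 2) b
           (b * (a ^+ 2 - 1)) (Num.sqrt (a ^+ 2 + b ^+ 2)) x))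
   /\
   (forall (I : set R) (x : R -> 'rV[R]_3),
      open_interval I -> smooth I x -> unit_speed I x -> ~ straight_line I x ->
      ((exists y : R -> 'rV[R]_3, bicycling_geodesic I x y) <->
       exists a b : R,
         kirchhoff_rod_with_parameters I ((1 + a ^+ 2) / 2) b
           (b * (a ^+ 2 - 1)) (Num.sqrt (a ^+ 2 + b ^+ 2)) x)))
  /\
  (* (c) *)
  (forall (I : set R) (x y : R -> 'rV[R]_3),
     open_interval I -> I 0 -> bicycle_path I x y -> unit_speed I x ->
     (bicycling_geodesic I x y <->
        unit_circle_about I x y \/
        exists p : 'rV[R]_3,
          [/\ p != 0, dot (x 0 - y 0) (derive1 x 0 - p) = 0
            & front_track_ode I x y p])
     /\
     (forall p : 'rV[R]_3,
        p != 0 -> dot (x 0 - y 0) (derive1 x 0 - p) = 0 ->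
        front_track_ode I x y p -> ~ straight_line I x ->
        exists a b : R,
          [/\ a ^+ 2 + b ^+ 2 = enorm p ^+ 2,
              b = - dot (cross (derive1 x 0) (x 0 - y 0)) p
            & curvature_torsion_satisfy I x (bicycle_equations I a b)])).
Proof.
have curv (I : set R) (x y : R -> 'rV[R]_3) : open_interval I -> bicycling_geodesic I x y ->
    ~ straight_line I x -> exists a b, curvature_torsion_satisfy I x (bicycle_equations I a b).
  move=> oI /(geodesic_momentumP x y oI)[bp us [p mom]] ns.
  have [t0 I0] : exists t0, I t0.
    by apply: contrapT => nI; apply: ns; exists 0, 0 => t It; case: nI; exists t.
  by have [a [b [_ _ h]]] := bicycle_curvature_torsion oI bp us mom I0 ns; exists a, b.
split; first by move=> n I x y; exact: geodesic_in_3space.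
split; first split.
- move=> I x y oI geo; have [st|ns] := pselect (straight_line I x); first by split; left.
  have [a [b h]] := curv I x y oI geo ns; have rod := rod_parameters h.
  split; right; last by exists a, b.
  exists ((1 + a ^+ 2) / 2), b, (b * (a ^+ 2 - 1)); split; first by case: h.
  by move=> k tau fr; have [_ /(_ k tau fr)[]] := rod.
- move=> I x oI sx us ns; split=> [[y geo]|[a [b [[k [tau fr]] h]]]].
    by have [a [b h]] := curv I x y oI geo ns; exists a, b; exact: rod_parameters.
  have [rod cons] := h k tau fr.
  exact: bicycle_of_rod oI sx us ns fr rod cons.
move=> I x y oI I0 bp us; split; first exact: geodesic_iff_ode.
move=> p p0 init ode ns.
exact: (bicycle_curvature_torsion oI bp us (momentum_of_ode oI bp us I0 p0 init ode) I0 ns).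
Qed.
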